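(* Let $\mathcal P=\{P_1,\ldots,P_N\}$ be a finite system of three-dimensional convex polyhedra whose two-dimensional faces are paired by affine homeomorphisms. Then the polyhedra $P_i$ admit subdivisions into tetrahedra, using only their original vertices, such that the subdivisions agree under every face pairing: for every face pairing $\phi_\alpha:F_\alpha^-\to F_\alpha^+$, the map $\phi_\alpha$ carries the triangulation induced on $F_\alpha^-$ onto the triangulation induced on $F_\alpha^+$.
   Context: Each $P_i$ lies in a real affine $3$-space $A_i$ and is the convex hull of finitely many points, with nonempty interior in $A_i$. The face pairing is as follows: the set of all two-dimensional faces of all the $P_i$ (regarded as disjoint) is partitioned into pairs $\{F_\alpha^-,F_\alpha^+\}$ of two distinct faces, and for each pair one is given an affine homeomorphism $\phi_\alpha:F_\alpha^-\to F_\alpha^+$ (the reverse pairing being $\phi_\alpha^{-1}$). The two faces of a pair may belong to the same polyhedron. A subdivision of $P_i$ into tetrahedra using only its original vertices is a decomposition of $P_i$ as a finite union of nondegenerate tetrahedra, each the convex hull of four affinely independent vertices of $P_i$, such that any two of the tetrahedra meet in a common (possibly empty) face. It induces a triangulation of each two-dimensional face of $P_i$. *)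

(* Defs.v *)
From HB Require Import structures.
From mathcomp Require Import all_boot all_order all_algebra.
From mathcomp Require Import all_classical all_reals all_analysis.
Set Implicit Arguments.
Unset Strict Implicit.
Unset Printing Implicit Defensive.
Import Order.TTheory GRing.Theory Num.Theory.
Import numFieldNormedType.Exports.
Local Open Scope classical_set_scope.
Local Open Scope ring_scope.

Definition conv_hull (R : realType) (V : lmodType R) (k : nat) (v : 'I_k -> V)
    : set V :=
  [set x | exists w : 'I_k -> R,
     [/\ forall i, 0 <= w i, \sum_i w i = 1 & x = \sum_i w i *: v i]].

Definition aff_indep (R : realType) (V : lmodType R) (k : nat) (v : 'I_k -> V)
    : Prop :=
  forall c : 'I_k -> R,
    \sum_i c i = 0 -> \sum_i c i *: v i = 0 -> forall i, c i = 0.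

Definition aff_dim (R : realType) (V : lmodType R) (A : set V) (d : nat)
    : Prop :=
  (exists v : 'I_d.+1 -> V, aff_indep v /\ forall i, A (v i)) /\
  ~ (exists v : 'I_d.+2 -> V, aff_indep v /\ forall i, A (v i)).

(* The form f may be zero, so set0 and A itself count as faces of A. *)
Definition is_face (R : realType) (V : lmodType R) (A F : set V) : Prop :=
  exists (f : {scalar V}) (c : R),
    (forall x, A x -> f x <= c) /\ F = A `&` [set x | f x = c].

Definition is_vertex (R : realType) (V : lmodType R) (A : set V) (v : V)
    : Prop :=
  is_face A [set v].

Definition polyhedron (R : realType) (P : set 'rV[R]_3) : Prop :=
  (exists (k : nat) (v : 'I_k -> 'rV[R]_3), P = conv_hull v) /\
  interior P !=set0.

(* Tagging a face with the index of its polyhedron makes the P i disjoint, even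
   though they all live in the same model 'rV[R]_3 of affine 3-space. *)
Definition is_2face (R : realType) (N : nat) (P : 'I_N -> set 'rV[R]_3)
    (F : 'I_N * set 'rV[R]_3) : Prop :=
  is_face (P F.1) F.2 /\ aff_dim F.2 2.

Definition affine_on (R : realType) (V W : lmodType R) (A : set V)
    (phi : V -> W) : Prop :=
  forall (x y : V) (t : R), A x -> A y -> 0 <= t <= 1 ->
    phi (t *: x + (1 - t) *: y) = t *: phi x + (1 - t) *: phi y.

(* Only the restriction of phi to A matters; its values outside A are junk. *)
Definition affine_homeo (R : realType) (A B : set 'rV[R]_3)
    (phi : 'rV[R]_3 -> 'rV[R]_3) : Prop :=
  [/\ set_bij A B phi, affine_on A phi, {within A, continuous phi} &
      exists psi : 'rV[R]_3 -> 'rV[R]_3,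
        (forall x, A x -> psi (phi x) = x) /\ {within B, continuous psi}].

Record face_pairing (R : realType) (N : nat) (P : 'I_N -> set 'rV[R]_3)
    (K : Type) (Fm Fp : K -> 'I_N * set 'rV[R]_3)
    (phi : K -> 'rV[R]_3 -> 'rV[R]_3) : Prop := FacePairing {
  pairing_neg : forall a, is_2face P (Fm a);
  pairing_pos : forall a, is_2face P (Fp a);
  pairing_distinct : forall a, Fm a <> Fp a;
  pairing_partition : forall F, is_2face P F ->
    exists! a : K, F = Fm a \/ F = Fp a;
  pairing_homeo : forall a, affine_homeo (Fm a).2 (Fp a).2 (phi a) }.

Definition tetrahedron_of (R : realType) (P T : set 'rV[R]_3) : Prop :=
  exists v : 'I_4 -> 'rV[R]_3,
    [/\ aff_indep v, forall i, is_vertex P (v i) & T = conv_hull v].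

Record tet_subdivision (R : realType) (P : set 'rV[R]_3)
    (D : set (set 'rV[R]_3)) : Prop := TetSubdivision {
  subdivision_finite : finite_set D;
  subdivision_tet : forall T, D T -> tetrahedron_of P T;
  subdivision_cover : \bigcup_(T in D) T = P;
  subdivision_face : forall T T', D T -> D T' ->
    is_face T (T `&` T') /\ is_face T' (T `&` T') }.

(* The triangles of the induced triangulation; its edges and vertices are
   determined by them. *)
Definition induced_triangulation (R : realType) (D : set (set 'rV[R]_3))
    (F : set 'rV[R]_3) : set (set 'rV[R]_3) :=
  [set G | aff_dim G 2 /\ exists2 T, D T & G = T `&` F].

(* Main.v *)
(* Give every vertex of every polyhedron a height.  The pairing of two faces with
   k vertices imposes k - 3 linear conditions on the heights modulo affine
   functions: that the heights on the two faces differ by an affine function.  Sweeping a polyhedron with V vertices by a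
   generic linear form shows that sum_F (k_F - 3) <= 2 (V - 4) over its faces F,
   strictly if V > 4.  Since each condition is shared by two faces, there are
   fewer conditions than heights as soon as some polyhedron is not a
   tetrahedron, so there are compatible heights that are not affine on some
   polyhedron.  The lower convex envelopes of the heights then subdivide the
   polyhedra without new vertices, compatibly with the pairings and properly
   somewhere.  The cells, with the new walls glued by the identity, form a system
   of the same kind, and one iterates until all cells are tetrahedra.

   Points of 3-space are lifted to 'rV_4 by a first coordinate 1: affine
   functions become linear forms and convex hulls become cones.  Polyhedra and
   cells are finite sets of vertices in a finite type X, placed by
   q : X -> 'rV_4. *)
From HB Require Import structures.
Require Import Defs.
From mathcomp Require Import all_boot all_order all_algebra.
From mathcomp Require Import all_classical all_reals all_analysis.
From mathcomp Require Import ring lra zify.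
Set Implicit Arguments.
Unset Strict Implicit.
Unset Printing Implicit Defensive.
Import Order.TTheory GRing.Theory Num.Theory.
Import numFieldNormedType.Exports.

(** * Farkas' lemma and rotation of supporting forms *)

(** Coning each cell from its least vertex in a total order of the vertices is not an option: the
    gluings may identify vertices of one cell with each other along cycles, so no order need be
    compatible with them. Heights have to agree only up to an affine function on each face, and this
    slack is what the dimension count exploits. The bound on the faces comes from incidences,
    without Euler's formula: the sweep controls the sum of [k_F - 2], and the fact that every vertex
    lies on at least three facets turns this into a bound on the sum of [k_F - 3], in fact with the
    factor 3/2 in place of 2, whence strictness. Envelopes of heights that differ by an affine
    function on a face have the same cells there, so the pieces of an old face inherit its gluing.
    Only two-dimensional faces must be controlled: a lower-dimensional face has at most two
    vertices, is a simplex already, and admits no choice. The iteration ends because a proper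
    subdivision of a polyhedron leaves its full vertex set inside no cell. *)

Section Dot.
Local Open Scope ring_scope.
Variables (R : realFieldType) (n : nat).
Implicit Types u v w : 'rV[R]_n.

Definition dot u v : R := (u *m v^T) 0 0.

Lemma dotE u v : dot u v = \sum_i u 0 i * v 0 i.
Proof. by rewrite /dot mxE; apply: eq_bigr => i _; rewrite mxE. Qed.

Lemma dotC u v : dot u v = dot v u.
Proof. by rewrite !dotE; apply: eq_bigr => i _; rewrite mulrC. Qed.

Lemma dotDl u v w : dot (u + v) w = dot u w + dot v w.
Proof. by rewrite /dot mulmxDl mxE. Qed.

Lemma dotZl a u w : dot (a *: u) w = a * dot u w.
Proof. by rewrite /dot -scalemxAl mxE. Qed.

Lemma dotNl u w : dot (- u) w = - dot u w.
Proof. by rewrite -scaleN1r dotZl mulN1r. Qed.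

Lemma dot0l w : dot 0 w = 0.
Proof. by rewrite /dot mul0mx mxE. Qed.

Lemma dotDr u v w : dot w (u + v) = dot w u + dot w v.
Proof. by rewrite dotC dotDl !(dotC w). Qed.

Lemma dotZr a u w : dot w (a *: u) = a * dot w u.
Proof. by rewrite dotC dotZl dotC. Qed.

Lemma dotNr u w : dot w (- u) = - dot w u.
Proof. by rewrite dotC dotNl dotC. Qed.

Lemma dot0r w : dot w 0 = 0.
Proof. by rewrite dotC dot0l. Qed.

Lemma dot_suml (I : Type) (r : seq I) (P : pred I) (F : I -> 'rV[R]_n) w :
  dot (\sum_(i <- r | P i) F i) w = \sum_(i <- r | P i) dot (F i) w.
Proof.
by apply: (big_morph (dot^~ w)) => [x y|]; rewrite ?dotDl ?dot0l.
Qed.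

Lemma dot_sumr (I : Type) (r : seq I) (P : pred I) (F : I -> 'rV[R]_n) w :
  dot w (\sum_(i <- r | P i) F i) = \sum_(i <- r | P i) dot w (F i).
Proof. by rewrite dotC dot_suml; apply: eq_bigr => i _; rewrite dotC. Qed.

Lemma dot_ge0 u : 0 <= dot u u.
Proof. by rewrite dotE; apply: sumr_ge0 => i _; rewrite -expr2 sqr_ge0. Qed.

Lemma dot_eq0 u : (dot u u == 0) = (u == 0).
Proof.
apply/eqP/eqP => [|->]; last by rewrite dot0l.
rewrite dotE => /eqP; rewrite psumr_eq0; last by move=> i _; rewrite -expr2 sqr_ge0.
move=> /allP h; apply/rowP => i; rewrite mxE.
by have /eqP := h i (mem_index_enum _); rewrite -expr2 => /eqP; rewrite sqrf_eq0 => /eqP.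
Qed.

Lemma dot_gt0 u : u != 0 -> 0 < dot u u.
Proof. by move=> u0; rewrite lt_neqAle dot_ge0 eq_sym dot_eq0 u0. Qed.

Lemma dot_eq0P u : (forall v, dot u v = 0) -> u = 0.
Proof. by move=> h; apply/eqP; rewrite -dot_eq0 h. Qed.

(* Induction on the number of generators (Bartl): either the last generator is
   superfluous, or it is projected away along a vector x0 that violates it. *)
Lemma farkas (I : finType) (S : {set I}) (a : I -> 'rV[R]_n) (y : 'rV[R]_n) :
  (exists w : I -> R, (forall i, 0 <= w i) /\ y = \sum_(i in S) w i *: a i) \/
  (exists u, (forall i, i \in S -> dot u (a i) <= 0) /\ 0 < dot u y).
Proof.
elim: {S}#|S| {-2}S (erefl #|S|) a y => [|m IH] S cS a y.
  have /eqP -> : S == finset.set0 by rewrite -cards_eq0 cS.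
  have [->|y0] := eqVneq y 0.
    by left; exists (fun=> 0); split => // ; rewrite big_set0.
  by right; exists y; split; [move=> i; rewrite inE | exact: dot_gt0].
have [k kS] : exists k, k \in S by apply/card_gt0P; rewrite cS.
have cS' : #|S :\ k| = m by move: (cardsD1 k S); rewrite kS cS => -[].
case: (IH _ cS' a y) => [[w [w0 ->]]|[x0 [x0S x0y]]].
  left; exists (fun i => if i == k then 0 else w i); split.
    by move=> i; case: eqP.
  rewrite [RHS](big_setD1 k) //= eqxx scale0r add0r.
  by apply: eq_bigr => i; rewrite !inE => /andP[/negbTE -> _].
case: (lerP (dot x0 (a k)) 0) => [x0k|x0k].
  right; exists x0; split=> // i iS.
  by have [->//|ik] := eqVneq i k; apply: x0S; rewrite !inE ik.
wlog x01 : x0 x0S x0y x0k / dot x0 (a k) = 1.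
  move=> h; apply: (h ((dot x0 (a k))^-1 *: x0)).
  - move=> i iS; rewrite dotZl pmulr_rle0 ?invr_gt0 //; exact: x0S.
  - by rewrite dotZl pmulr_rgt0 ?invr_gt0.
  - by rewrite dotZl pmulr_rgt0 ?invr_gt0.
  - by rewrite dotZl mulVf ?gt_eqF.
case: (IH _ cS' (fun i => a i - dot x0 (a i) *: a k) (y - dot x0 y *: a k)).
  move=> [w [w0 e]]; left.
  exists (fun i => if i == k then dot x0 y - \sum_(j in S :\ k) w j * dot x0 (a j) else w i).
  split.
    move=> i; case: eqP => // _; rewrite subr_ge0; apply: (le_trans _ (ltW x0y)).
    by apply: sumr_le0 => j jS; rewrite mulr_ge0_le0 ?w0 ?x0S.
  rewrite (big_setD1 k) //= eqxx.
  rewrite (eq_bigr (fun i => w i *: a i)); last first.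
    by move=> i; rewrite !inE => /andP[/negbTE -> _].
  rewrite -[LHS](subrK (dot x0 y *: a k)) e.
  rewrite (eq_bigr (fun i => w i *: a i - (w i * dot x0 (a i)) *: a k)); last first.
    by move=> i _; rewrite scalerBr scalerA.
  rewrite sumrB -scaler_suml scalerBl.
  by rewrite [RHS]addrC addrA addrAC.
move=> [u [uS uy]]; right; exists (u - dot u (a k) *: x0); split.
  move=> i iS; have [->|ik] := eqVneq i k.
    by rewrite dotDl dotNl dotZl x01 mulr1 subrr.
  have : i \in S :\ k by rewrite !inE ik.
  by move=> /uS; rewrite !(dotDr, dotDl, dotNr, dotNl, dotZr, dotZl) [X in _ - X]mulrC.
by move: uy; rewrite !(dotDr, dotDl, dotNr, dotNl, dotZr, dotZl) [X in _ - X]mulrC.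
Qed.

End Dot.

Section Rotation.
Local Open Scope ring_scope.
Variables (R : realFieldType).

(** The ratio test of linear programming: the least [a x / b x] over the indices with [b x > 0] is
    the largest admissible step, and the minimising index becomes tight. *)
Lemma exists_min_ratio (X : finType) (A : {set X}) (a b : X -> R) (x0 : X) :
  x0 \in A -> 0 < b x0 -> (forall x, x \in A -> 0 < b x -> 0 < a x) ->
  exists t, [/\ 0 < t, forall x, x \in A -> 0 < b x -> t * b x <= a x &
    exists x, [/\ x \in A, 0 < b x & t * b x = a x]].
Proof.
move=> x0A bx0 ha.
have P0 : (x0 \in A) && (0 < b x0) by rewrite x0A.
case: (@Order.TotalTheory.arg_minP _ _ _ x0 (fun x => (x \in A) && (0 < b x)) (fun x =>
    a x / b x) P0).
move=> x /andP[xA bx] hx; exists (a x / b x); split.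
- by rewrite divr_gt0 // ha.
- move=> y yA by0; rewrite -ler_pdivlMr //; apply: hx; by rewrite yA.
- by exists x; split=> //; rewrite divfK // gt_eqF.
Qed.

(* A form that is maximally tight on A is moved, inside the hyperplane where d
   is constant, until a further constraint becomes tight. *)
Lemma rotation (E : lmodType R) (X : finType) (A : {set X}) (ev : X -> E -> R)
    (d : E -> R) (f : E) :
  (forall x, scalar (ev x)) -> scalar d ->
  (forall u, (forall x, x \in A -> ev x u = 0) -> u = 0) ->
  (forall x, x \in A -> ev x f <= 0) -> 0 < d f ->
  exists f', [/\ forall x, x \in A -> ev x f' <= 0, 0 < d f',
    forall x, x \in A -> ev x f = 0 -> ev x f' = 0 &
    forall u, (forall x, x \in A -> ev x f' = 0 -> ev x u = 0) ->
      exists c, u = c *: f'].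
Proof.
move=> evL dL span.
have evZ x a u : ev x (a *: u) = a * ev x u.
  have e0 : ev x 0 = 0.
    by have := evL x (-1) 0 0; rewrite scaler0 add0r mulN1r addNr.
  by have := evL x a u 0; rewrite e0 !addr0.
have dZ a u : d (a *: u) = a * d u.
  have e0 : d 0 = 0 by have := dL (-1) 0 0; rewrite scaler0 add0r mulN1r addNr.
  by have := dL a u 0; rewrite e0 !addr0.
pose Z f := [set x in A | ev x f == 0].
(* Induction on the number of constraints that are not yet tight. *)
move: {2}(#|A| - #|Z f|)%N (leqnn (#|A| - #|Z f|)%N) => m.
elim: m f => [|m IH] f mf fA df.
  exists f; split=> // u hu; exists 0; rewrite scale0r; apply: span => x xA.
  apply: hu => //; have : Z f = A.
    apply/eqP; rewrite eqEcard; apply/andP; split; last by lia.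
    by apply/fintype.subsetP => y; rewrite inE => /andP[].
  by move=> eZ; move: xA; rewrite -{1}eZ inE => /andP[_ /eqP].
case: (pselect (forall u, (forall x, x \in A -> ev x f = 0 -> ev x u = 0) ->
      exists c, u = c *: f)) => [h|]; first by exists f.
move=> /existsNP[u /not_implyP[uZ uf]].
(* The multiple of [f] makes [d] vanish on [g], so moving along [g] keeps [d f] unchanged and the
   tight constraints tight. *)
pose g := (- (d u / d f)) *: f + u.
have dg : d g = 0 by rewrite /g dL mulNr divfK ?gt_eqF // addNr.
have gZ x : x \in A -> ev x f = 0 -> ev x g = 0.
  by move=> xA xf; rewrite /g evL xf mulr0 add0r uZ.
have [x [xA xg]] : exists x, x \in A /\ ev x g != 0.
  apply: contrapT => h; apply: uf; exists (d u / d f).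
  apply/eqP; rewrite -subr_eq0 addrC -scaleNr; apply/eqP.
  apply: span => x xA; apply/eqP; apply: contrapT => /negP hx.
  by apply: h; exists x.
have {x xA xg} [g' [dg' gZ' [x [xA xg]]]] : exists g', [/\ d g' = 0,
    forall x, x \in A -> ev x f = 0 -> ev x g' = 0 &
    exists x, x \in A /\ 0 < ev x g'].
  case: (ltrP 0 (ev x g)) => [xg'|xg']; first by exists g; split=> //; exists x.
  exists ((-1) *: g); split; first by rewrite dZ dg mulr0.
    by move=> y yA yf; rewrite evZ gZ ?mulr0.
  by exists x; split=> //; rewrite evZ mulN1r oppr_gt0 lt_neqAle xg.
have [] := @exists_min_ratio _ A (fun x => - ev x f) (fun x => ev x g') x xA xg.
  move=> y yA yg; rewrite oppr_gt0 lt_neqAle fA // andbT.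
  by apply/negP => /eqP /(gZ' _ yA) e; rewrite e ltxx in yg.
move=> t [t0 ht [z [zA zg hz]]].
have evf y : ev y (t *: g' + f) = t * ev y g' + ev y f by rewrite evL.
have df' : d (t *: g' + f) = d f by rewrite dL dg' mulr0 add0r.
have fA' y : y \in A -> ev y (t *: g' + f) <= 0.
  move=> yA; rewrite evf; case: (ltrP 0 (ev y g')) => yg.
    by have := ht y yA yg; lra.
  have := fA y yA; have : t * ev y g' <= 0 by rewrite mulr_ge0_le0 // ltW.
  lra.
have fZ y : y \in A -> ev y f = 0 -> ev y (t *: g' + f) = 0.
  by move=> yA yf; rewrite evf yf gZ' // mulr0 addr0.
have mf' : (#|A| - #|Z (t *: g' + f)%R| <= m)%N.
  have : (Z f \proper Z (t *: g' + f)).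
    rewrite finset.properEneq; apply/andP; split; last first.
      apply/fintype.subsetP => y; rewrite !inE => /andP[yA /eqP yf].
      by rewrite yA fZ ?eqxx.
    apply/negP => /eqP e.
    have : z \in Z (t *: g' + f) by rewrite inE zA evf hz addNr eqxx.
    rewrite -e inE => /andP[_ /eqP zf]; by rewrite gZ' ?ltxx in zg.
  move=> /proper_card c.
  have : (#|Z (t *: g' + f)%R| <= #|A|)%N by apply/subset_leq_card/fintype.subsetP =>
      y; rewrite inE => /andP[].
  lia.
have df'0 : 0 < d (t *: g' + f) by rewrite df'.
have [f' [h1 h2 h3 h4]] := IH _ mf' fA' df'0.
by exists f'; split=> // y yA yf; apply: h3 => //; apply: fZ.
Qed.

End Rotation.

(** * Dimension counts and general position *)

Section Dimension.
Local Open Scope ring_scope.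
Variables (R : realFieldType) (n : nat).

Lemma orthogonal_ex (k : nat) (F : 'I_k -> 'rV[R]_n) : (k < n)%N ->
  exists2 d : 'rV[R]_n, d != 0 & forall i, dot d (F i) = 0.
Proof.
move=> kn; pose M : 'M[R]_(n, k) := \matrix_(i, j) F j 0 i.
have : kermx M != 0.
  rewrite -mxrank_eq0 mxrank_ker; have := rank_leq_col M; lia.
case/rowV0Pn => d /sub_kermxP dM d0; exists d => // i.
have -> : dot d (F i) = (d *m M) 0 i.
  by rewrite dotE mxE; apply: eq_bigr => j _; rewrite mxE.
by rewrite dM mxE.
Qed.

(** The [U i] lie in the orthogonal complement of the independent [W j], whose dimension [n - m] is
    smaller than [k]. *)
Lemma dependency_ex (k m : nat) (U : 'I_k -> 'rV[R]_n) (W : 'I_m -> 'rV[R]_n) :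
  (n < k + m)%N -> (forall i j, dot (U i) (W j) = 0) ->
  (forall c : 'rV[R]_m, \sum_j c 0 j *: W j = 0 -> c = 0) ->
  exists2 a : 'rV[R]_k, a != 0 & \sum_i a 0 i *: U i = 0.
Proof.
move=> nkm UW Wf.
pose MU : 'M[R]_(k, n) := \matrix_i U i; pose MW : 'M[R]_(m, n) := \matrix_j W j.
have mulE p (a : 'rV[R]_p) (V : 'I_p -> 'rV[R]_n) : a *m (\matrix_i V i) = \sum_i a 0 i *: V i.
  by rewrite mulmx_sum_row; apply: eq_bigr => i _; rewrite rowK.
have rW : \rank MW = m.
  by apply/eqP; apply: inj_row_free => v; rewrite mulE; apply: Wf.
have UW0 : MU *m MW^T = 0.
  apply/matrixP => i j; rewrite !mxE -[RHS](UW i j) dotE.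
  by apply: eq_bigr => z _; rewrite !mxE.
have := mulmx0_rank_max UW0; rewrite mxrank_tr rW => rU.
have : kermx MU != 0 by rewrite -mxrank_eq0 mxrank_ker; lia.
case/rowV0Pn => a /sub_kermxP aM a0; exists a => //.
by rewrite -mulE.
Qed.

(** Finitely many hyperplanes do not cover the space: if a [u] that is good for the tail is
    orthogonal to [d], it is moved along [d] by a step larger in absolute value than every ratio at
    which another product could vanish. *)
Lemma avoid_ex (s : seq 'rV[R]_n) : (forall d, d \in s -> d != 0) ->
  exists u, forall d, d \in s -> dot u d != 0.
Proof.
elim: s => [|d s IH] h; first by exists 0.
have [|u hu] := IH; first by move=> d' d's; apply: h; rewrite inE d's orbT.
have [ud|ud] := eqVneq (dot u d) 0; last first.
  by exists u => d'; rewrite inE => /orP[/eqP ->|/hu].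
pose r d' : R := `| dot u d' / dot d d'|.
pose eps : R := 1 + \sum_(d' <- s) r d'.
have eps0 : 0 < eps by rewrite /eps addrC ltr_wpDl // sumr_ge0 // => ? _; exact: normr_ge0.
exists (u + eps *: d) => d'; rewrite dotDl dotZl inE => /orP[/eqP ->|d's].
  by rewrite ud add0r mulf_neq0 ?gt_eqF // dot_gt0 // h // mem_head.
have [dd'|dd'] := eqVneq (dot d d') 0; first by rewrite dd' mulr0 addr0 hu.
apply/eqP => e; have : eps = r d'.
  rewrite /r; have -> : dot u d' / dot d d' = - eps.
    by rewrite -[dot u d']opprK (addr0_eq e) mulNr mulfK.
  by rewrite normrN gtr0_norm.
apply/eqP; rewrite gt_eqF // /eps (big_rem d') //= addrCA ltrDl.
by rewrite addrC ltr_wpDl // sumr_ge0 // => ? _; exact: normr_ge0.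
Qed.

End Dimension.

(** * Cones, facets and regular subdivisions *)

Section Cones.
Local Open Scope ring_scope.
Variables (R : realFieldType) (n : nat) (X : finType) (q : X -> 'rV[R]_n).
Implicit Types (A B C E F G T b : {set X}) (u l f g e : 'rV[R]_n) (h : X -> R).

Definition ev u x : R := dot u (q x).

Definition ann A u := forall x, x \in A -> ev u x = 0.

Definition spans A := forall u, ann A u -> u = 0.

(** Linear independence in dual form: any values on [E] are interpolated by a form. Independence is
    mostly used this way, to produce forms with prescribed signs. *)
Definition indep E := forall g : X -> R,
  exists u, forall x, x \in E -> ev u x = g x.

(* The last condition says that B has codimension one. *)
Definition facet_by A B f := [/\ forall x, x \in A -> ev f x <= 0,
  B = [set x in A | ev f x == 0], f != 0 &
  forall u, ann B u -> exists c, u = c *: f].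

Definition facet A B := exists f, facet_by A B f.

Definition cone A (y : 'rV[R]_n) := exists w : X -> R,
  (forall x, 0 <= w x) /\ y = \sum_(x in A) w x *: q x.

(** [C] is the vertex set of a full-dimensional cell of the lower convex envelope of the heights
    [h]; the graph of [l] supports the lifted points along that cell. *)
Definition cell_by A h C l := [/\ forall x, x \in A -> ev l x <= h x,
  C = [set x in A | ev l x == h x] & spans C].

Definition cell A h C := exists l, cell_by A h C l.

Lemma evD u l x : ev (u + l) x = ev u x + ev l x.
Proof. exact: dotDl. Qed.

Lemma evZ a u x : ev (a *: u) x = a * ev u x.
Proof. exact: dotZl. Qed.

Lemma evN u x : ev (- u) x = - ev u x.
Proof. exact: dotNl. Qed.

Lemma ev0 x : ev 0 x = 0.
Proof. exact: dot0l. Qed.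

Definition evE := (evD, evN, evZ, ev0).

Lemma spansS A B : A \subset B -> spans A -> spans B.
Proof. by move=> /fintype.subsetP AB sA u uB; apply: sA => x /AB /uB. Qed.

Lemma spans_eq A u l : spans A -> (forall x, x \in A -> ev u x = ev l x) -> u = l.
Proof.
move=> sA e; apply/eqP; rewrite -subr_eq0; apply/eqP; apply: sA => x xA.
by rewrite !evE e ?subrr.
Qed.

Lemma spans_ex A u : spans A -> u != 0 -> exists2 x, x \in A & ev u x != 0.
Proof.
move=> sA u0; apply: contrapT => hx; move/eqP: u0; apply; apply: sA => x xA.
by apply/eqP; apply: contrapT => /negP hx'; apply: hx; exists x.
Qed.

Lemma facet_sub A B f : facet_by A B f -> B \subset A.
Proof. by case=> _ -> _ _; apply/fintype.subsetP => x; rewrite inE => /andP[]. Qed.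

Lemma facet_ann A B f : facet_by A B f -> ann B f.
Proof. by case=> _ -> _ _ x; rewrite inE => /andP[_ /eqP]. Qed.

Lemma facet_in A B f x : facet_by A B f -> x \in A -> ev f x = 0 -> x \in B.
Proof. by case=> _ -> _ _ xA xf; rewrite inE xA xf eqxx. Qed.

Lemma facet_lt A B f x : facet_by A B f -> x \in A -> x \notin B -> ev f x < 0.
Proof.
move=> F xA xB; case: (F) => fA _ _ _; rewrite lt_neqAle fA // andbT.
by apply: contra xB => /eqP /(facet_in F xA).
Qed.

Lemma facet_spans A B f : facet_by A B f -> spans A ->
  exists2 x, x \in A & ev f x < 0.
Proof.
move=> F sA; case: (F) => fA _ f0 _; have [x xA xf] := spans_ex sA f0.
by exists x => //; rewrite lt_neqAle xf fA.
Qed.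

Lemma cell_sub A h C l : cell_by A h C l -> C \subset A.
Proof. by case=> _ -> _; apply/fintype.subsetP => x; rewrite inE => /andP[]. Qed.

Lemma cell_eq A h C l x : cell_by A h C l -> x \in C -> ev l x = h x.
Proof. by case=> _ -> _; rewrite inE => /andP[_ /eqP]. Qed.

Lemma cell_in A h C l x : cell_by A h C l -> x \in A -> ev l x = h x -> x \in C.
Proof. by case=> _ -> _ xA e; rewrite inE xA e eqxx. Qed.

Lemma cell_lt A h C l x : cell_by A h C l -> x \in A -> x \notin C -> ev l x < h x.
Proof.
move=> Cl xA xC; case: (Cl) => lh _ _; rewrite lt_neqAle lh // andbT.
by apply: contra xC => /eqP /(cell_in Cl xA).
Qed.

Lemma cell_by_inj A h C C' l : cell_by A h C l -> cell_by A h C' l -> C = C'.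
Proof. by case=> _ -> _ [_ -> _]. Qed.

Lemma cell_spansI A h C C' l l' : cell_by A h C l -> cell_by A h C' l' ->
  spans (C :&: C') -> C = C'.
Proof.
move=> Cl Cl' s; have e : l = l'.
  apply: (spans_eq s) => x; rewrite inE => /andP[xC xC'].
  by rewrite (cell_eq Cl) // (cell_eq Cl').
by rewrite e in Cl; apply: cell_by_inj Cl Cl'.
Qed.

Lemma coneS A B y : A \subset B -> cone A y -> cone B y.
Proof.
move=> AB [w [w0 ->]]; exists (fun x => if x \in A then w x else 0); split.
  by move=> x; case: ifP.
rewrite [RHS](big_setID A) /= [X in _ + X]big1 ?addr0; last first.
  by move=> x; rewrite inE => /andP[/negbTE -> _]; rewrite scale0r.
rewrite (finset.setIidPr AB); apply: eq_bigr => x xA; by rewrite xA.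
Qed.

Lemma cone_gen A x : x \in A -> cone A (q x).
Proof.
move=> xA; exists (fun y => (y == x)%:R); split; first by move=> y; rewrite ler0n.
rewrite (big_setD1 x) //= eqxx scale1r big1 ?addr0 // => y.
by rewrite !inE => /andP[/negbTE -> _]; rewrite scale0r.
Qed.

Lemma dot_cone u A (w : X -> R) :
  dot u (\sum_(x in A) w x *: q x) = \sum_(x in A) w x * ev u x.
Proof. by rewrite dot_sumr; apply: eq_bigr => x _; rewrite dotZr. Qed.

Lemma cone_le0 u A y : (forall x, x \in A -> ev u x <= 0) -> cone A y -> dot u y <= 0.
Proof.
move=> uA [w [w0 ->]]; rewrite dot_cone; apply: sumr_le0 => x xA.
by rewrite mulr_ge0_le0 ?uA.
Qed.

(** A vanishing sum of nonpositive terms has only zero terms, so generators off the face carry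
    weight zero. *)
Lemma cone_tight u A y : (forall x, x \in A -> ev u x <= 0) -> cone A y ->
  dot u y = 0 -> cone [set x in A | ev u x == 0] y.
Proof.
move=> uA [w [w0 ->]]; rewrite dot_cone => e.
exists w; split=> //.
rewrite [RHS](eq_bigl (fun x => (x \in A) && (ev u x == 0))); last first.
  by move=> x; rewrite inE.
rewrite [LHS](bigID (fun x => ev u x == 0)) /= [X in _ + X]big1 ?addr0 //.
move=> x /andP[xA xu]; have : \sum_(x in A) - (w x * ev u x) == 0.
  by rewrite sumrN e oppr0.
rewrite psumr_eq0; last first.
  by move=> z zA; rewrite oppr_ge0 mulr_ge0_le0 ?uA.
move=> /allP /(_ x (mem_index_enum _)) /implyP /(_ xA).
by rewrite oppr_eq0 mulf_eq0 (negbTE xu) orbF => /eqP ->; rewrite scale0r.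
Qed.

Lemma cone_face g A T E y : (forall x, x \in A -> ev g x <= 0) ->
  E = [set x in A | ev g x == 0] -> T \subset A -> cone T y -> cone E y ->
  cone (T :&: E) y.
Proof.
move=> gA -> TA Ty Ey; have gy : dot g y = 0.
  case: Ey => w [_ ->]; rewrite dot_cone big1 // => x.
  by rewrite inE => /andP[_ /eqP ->]; rewrite mulr0.
have gT x : x \in T -> ev g x <= 0 by move=> /(fintype.subsetP TA) /gA.
apply: coneS (cone_tight gT Ty gy); apply/fintype.subsetP => x.
by rewrite !inE => /andP[xT ->]; rewrite xT (fintype.subsetP TA).
Qed.

Lemma indepS E F : F \subset E -> indep E -> indep F.
Proof.
by move=> /fintype.subsetP FE iE g; have [u hu] := iE g; exists u => x /FE /hu.
Qed.

Lemma indep_uniq E (w w' : X -> R) : indep E ->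
  \sum_(x in E) w x *: q x = \sum_(x in E) w' x *: q x ->
  forall x, x \in E -> w x = w' x.
Proof.
move=> iE e x xE; have [u hu] := iE (fun z => (z == x)%:R).
have := congr1 (dot u) e; rewrite !dot_cone.
rewrite (big_setD1 x) //= [in RHS](big_setD1 x) //= hu // eqxx !mulr1.
by rewrite !big1 ?addr0 // => z; rewrite !inE => /andP[zx zE];
  rewrite hu // (negbTE zx) mulr0.
Qed.

(** Any subset [F] of an independent set spans a face of its cone, cut out by the form that is 0 on
    [F] and -1 elsewhere. *)
Lemma cone_indepI T E F y : indep T -> E \subset T -> F \subset T ->
  cone E y -> cone F y -> cone (E :&: F) y.
Proof.
move=> iT ET FT Ey Fy; have [g hg] := iT (fun x => if x \in F then 0 else -1).
apply: (@cone_face g T E F) => //.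
  by move=> x xT; rewrite hg //; case: ifP => // _; rewrite oppr_le0.
apply/setP => x; rewrite inE; case: (boolP (x \in T)) => xT /=; last first.
  by apply/negbTE; apply: contra xT; exact: (fintype.subsetP FT).
by rewrite hg //; case: (x \in F); rewrite ?eqxx // oppr_eq0 oner_eq0.
Qed.

(* If h is not induced by a form, the lifted vectors (q x, h x) span, and the
   tight sets of their supporting forms with positive height component are the
   cells of the subdivision. *)
Lemma cell_tighten A h l (y : 'rV[R]_n) (s : R) :
  spans A -> (forall x, x \in A -> ev l x <= h x) -> s < dot l y ->
  (forall l', (forall x, x \in A -> ev l' x <= 0) -> dot l' y <= 0) ->
  (forall l' t, (forall x, x \in A -> ev l' x <= - (t * h x)) ->
     0 < t -> dot l' y <= - (t * s)) ->
  exists l', [/\ cell_by A h [set x in A | ev l' x == h x] l', s < dot l' y &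
    forall x, x \in A -> ev l x = h x -> ev l' x = h x].
Proof.
move=> sA lh sy nov noup.
case: (pselect (exists u, forall x, x \in A -> ev u x = h x)) => [[u hu]|nlin].
  exists u; split; last by move=> x xA _; rewrite hu.
    split=> // [x xA|]; first by rewrite hu.
    apply: spansS sA; apply/fintype.subsetP => x xA; by rewrite inE xA hu ?eqxx.
  apply: (lt_le_trans sy); rewrite -subr_le0 -dotNl -dotDl; apply: nov => x xA.
  by rewrite !evE hu // subr_le0 lh.
pose lev x (p : 'rV[R]_n * R^o) := ev p.1 x - p.2 * h x.
pose ld (p : 'rV[R]_n * R^o) := dot p.1 y - p.2 * s.
have levL x : scalar (lev x).
  move=> a [u1 u2] [v1 v2]; rewrite /lev /= !evE mulrDl opprD -mulrA mulrBr.
  by rewrite addrACA.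
have ldL : scalar ld.
  by move=> a [u1 u2] [v1 v2]; rewrite /ld /= dotDl dotZl mulrDl opprD -mulrA mulrBr addrACA.
have lspan (u : 'rV[R]_n * R^o) : (forall x, x \in A -> lev x u = 0) -> u = 0.
  case: u => u1 u2 hu; rewrite /lev /= in hu.
  have [u20|u20] := eqVneq u2 0.
    rewrite u20 in hu *; congr (_, _); apply: sA => x xA.
    by have := hu x xA; rewrite mul0r subr0.
  case: nlin; exists (u2^-1 *: u1) => x xA; rewrite evE.
  by have /eqP := hu x xA; rewrite subr_eq0 => /eqP ->; rewrite mulKf.
have lA x : x \in A -> lev x (l, 1) <= 0 by move=> xA; rewrite /lev mul1r subr_le0 lh.
have ld0 : 0 < ld (l, 1) by rewrite /ld mul1r subr_gt0.
have [[l' t] [hA hd hZ hmax]] := rotation levL ldL lspan lA ld0.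
rewrite /lev /ld /= in hA hd hZ hmax.
(* The two hypotheses on [y] and [s] exclude supporting forms whose height component is zero or
   negative. *)
have t0 : 0 < t.
  rewrite ltNge le_eqVlt; apply/negP => /orP[/eqP t0|t0].
    rewrite t0 mul0r subr0 in hd; have := @nov l'; rewrite leNgt hd => /(_ _)/negP.
    by apply=> // x xA; have := hA x xA; rewrite t0 mul0r subr0.
  have := @noup l' (- t); rewrite oppr_gt0 t0 mulNr opprK => /(_ _ isT).
  rewrite leNgt -subr_gt0 hd => /(_ _)/negP; apply=> // x xA.
  by have := hA x xA; rewrite subr_le0 mulNr opprK.
have tZ x : x \in A -> ev (t^-1 *: l') x = h x <-> ev l' x - t * h x = 0.
  move=> xA; rewrite evE; split=> [<-|/eqP].
    by rewrite mulVKf ?gt_eqF // subrr.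
  by rewrite subr_eq0 => /eqP ->; rewrite mulKf ?gt_eqF.
exists (t^-1 *: l'); split.
- split=> // [x xA|u hu].
    by rewrite evE mulrC ler_pdivrMr // mulrC -subr_le0 hA.
  have [x xA xe|c [e1 e2]] := hmax (u, 0).
    by rewrite mul0r subr0 hu // inE xA; apply/eqP; apply/tZ.
  have : c = 0.
    by move/esym/eqP: e2; rewrite mulf_eq0 (gt_eqF t0) orbF => /eqP.
  by rewrite e1 => ->; rewrite scale0r.
- by rewrite dotZl mulrC ltr_pdivlMr // mulrC -subr_gt0.
- by move=> x xA e; apply/tZ => //; apply: hZ => //; rewrite mul1r e subrr.
Qed.

(** Tightening towards [y = 0] and [s = -1], where the conditions on [y] and [s] hold trivially,
    enlarges the tight set of [l] until it spans. *)
Lemma cell_extend A h l : spans A -> (forall x, x \in A -> ev l x <= h x) ->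
  exists C l', cell_by A h C l' /\
    forall x, x \in A -> ev l x = h x -> x \in C.
Proof.
move=> sA lh; have [|||l' [c _ hl']] := @cell_tighten A h l 0 (-1) sA lh.
- by rewrite dot0r oppr_lt0.
- by move=> l' _; rewrite dot0r.
- by move=> l' t _ t0; rewrite dot0r mulrN1 opprK ltW.
by exists [set x in A | ev l' x == h x], l'; split=> // x xA /(hl' x xA); apply: cell_in c xA.
Qed.

(** Finitely many strict inequalities survive a small perturbation; half of the critical step keeps
    them strict. *)
Lemma small_eps (S : {set X}) (a b : X -> R) : (forall x, x \in S -> a x < 0) ->
  exists2 e, 0 < e & forall x, x \in S -> a x + e * b x < 0.
Proof.
move=> aS; case: (pselect (exists2 x, x \in S & 0 < b x)) => [[x xS xb]|nb].
  have [|t [t0 ht _]] := exists_min_ratio xS xb (a := fun x => - a x).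
    by move=> y yS _; rewrite oppr_gt0 aS.
  exists (t / 2); first by rewrite divr_gt0.
  move=> y yS; have ay := aS y yS; case: (ltrP 0 (b y)) => yb.
    have := ht y yS yb; have : 0 < t * b y by rewrite mulr_gt0.
    by move=> *; rewrite mulrAC; lra.
  have : t / 2 * b y <= 0 by rewrite mulr_ge0_le0 // divr_ge0 // ltW.
  lra.
exists 1 => // x xS; have := aS x xS; rewrite mul1r.
have : b x <= 0 by rewrite leNgt; apply/negP => xb; apply: nb; exists x.
lra.
Qed.

Lemma large_M (S : {set X}) (a b : X -> R) : (forall x, x \in S -> a x < 0) ->
  exists2 M, 0 < M & forall x, x \in S -> M * a x + b x < 0.
Proof.
move=> aS; have [e e0 he] := small_eps b aS.
exists e^-1; first by rewrite invr_gt0.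
move=> x xS; have := he x xS; rewrite -(pmulr_rlt0 (e^-1 * a x + b x) e0).
by rewrite mulrDr mulVKf ?gt_eqF.
Qed.

(** [e] is constantly 1 on the points, so its multiples are the constant heights, and a sufficiently
    low constant lies below [h]. *)
Lemma lower_form A h e : (forall x, ev e x = 1) ->
  exists l, forall x, x \in A -> ev l x <= h x.
Proof.
move=> e1; exists (- (\sum_(x in A) `|h x|) *: e) => x xA.
rewrite evZ e1 mulr1 lerNl (le_trans (ler_norm _)) // normrN.
by rewrite (big_setD1 x) //= lerDl; apply: sumr_ge0.
Qed.

(** Choose the cell whose form is largest at [y]. If its cone missed [y], Farkas would give [g]
    nonpositive on the cell and positive at [y]; adding a small multiple of [g] stays below [h], and
    tightening yields a cell with a larger value at [y]. *)
Lemma cell_cover A h e y : (forall x, ev e x = 1) -> spans A -> cone A y ->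
  exists2 C, cell A h C & cone C y.
Proof.
move=> e1 sA Ay.
have [l0 l0h] := lower_form A h e1.
have [C0 [l0' [C0c _]]] := cell_extend sA l0h.
have /choice[l hl] : forall C, exists l, cell A h C -> cell_by A h C l.
  move=> C; case: (pselect (cell A h C)) => [[l hl]|nC]; first by exists l.
  by exists 0.
have P0 : (fun C => `[< cell A h C >]) C0 by apply/asboolP; exists l0'.
have := @Order.TotalTheory.arg_maxP _ _ _ C0 (fun C => `[< cell A h C >]) (fun C =>
    dot (l C) y) P0.
case=> C /asboolP cC Cmax; exists C => //.
have lC := hl _ cC; have [lh _ sC] := lC.
case: (farkas C q y) => // -[g [gC gy]].
have [|eps eps0 heps] := small_eps (S := A :\: C) (a := fun x => ev (l C) x - h x) (ev g).
  by move=> x; rewrite inE => /andP[xC xA]; rewrite subr_lt0 (cell_lt lC).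
have lgh x : x \in A -> ev (l C + eps *: g) x <= h x.
  move=> xA; rewrite !evE; case: (boolP (x \in C)) => xC.
    have := cell_eq lC xC; have : eps * ev g x <= 0 by rewrite mulr_ge0_le0 ?gC // ltW.
    lra.
  have := heps x; rewrite inE xA xC => /(_ isT); lra.
have [|||l' [c sl' _]] := @cell_tighten A h _ y (dot (l C) y) sA lgh.
- by rewrite dotDl dotZl ltrDl mulr_gt0.
- by move=> l' hl'; apply: cone_le0 Ay.
- move=> l' t hl' t0; case: Ay => w [w0 ->]; rewrite !dot_cone mulr_sumr -sumrN.
  apply: ler_sum => x xA; have -> : - (t * (w x * ev (l C) x)) = w x * (- (t * ev
      (l C) x)) by ring.
  apply: ler_wpM2l => //; apply: (le_trans (hl' x xA)).
  by rewrite lerN2 ler_wpM2l ?lh // ltW.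
set C' := [set x in A | ev l' x == h x] in c.
have cC' : cell A h C' by exists l'.
have lC' := hl _ cC'; have ell : l' = l C'.
  case: (c) => _ _ s; apply: (spans_eq s) => x xC.
  by rewrite (cell_eq c) // (cell_eq lC').
have : dot (l C') y <= dot (l C) y := Cmax C' (asboolT cC').
by rewrite -ell leNgt sl'.
Qed.

Lemma cell_sub_le A h C C' l l' : cell_by A h C l -> cell_by A h C' l' ->
  forall x, x \in C -> ev (l' - l) x <= 0.
Proof.
move=> Cl Cl' x xC; rewrite !evE subr_le0 (cell_eq Cl) //.
by case: Cl' => lh _ _; apply: lh; apply: (fintype.subsetP (cell_sub Cl)).
Qed.

Lemma cellI A h C C' l l' : cell_by A h C l -> cell_by A h C' l' ->
  C :&: C' = [set x in C | ev (l' - l) x == 0].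
Proof.
move=> Cl Cl'; apply/setP => x; rewrite !inE; case: (boolP (x \in C)) => //= xC.
rewrite !evE subr_eq0 (cell_eq Cl) //; apply/idP/eqP => [|e].
  exact: cell_eq Cl'.
by apply: (cell_in Cl') => //; apply: (fintype.subsetP (cell_sub Cl)).
Qed.

(** The difference of the two forms is nonpositive on one cell and nonnegative on the other, hence
    zero at a common point, which then lies on the face where it vanishes. *)
Lemma cellI_cone A h C C' y : cell A h C -> cell A h C' ->
  cone C y -> cone C' y -> cone (C :&: C') y.
Proof.
move=> [l Cl] [l' Cl'] Cy Cy'; rewrite (cellI Cl Cl').
apply: cone_tight => //; first exact: cell_sub_le Cl Cl'.
have h1 := cone_le0 (cell_sub_le Cl Cl') Cy.
have h2 := cone_le0 (cell_sub_le Cl' Cl) Cy'.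
by apply/eqP; rewrite eq_le h1 -oppr_le0 -dotNl opprB h2.
Qed.

(** The forms of the two cells agree on [B], so they differ by a multiple of [f]. Each stays below
    [h] on the other cell, and as both cells have points on the same side of [f], the multiple is
    zero. *)
Lemma side_uniq A h B f C C' : (forall u, ann B u -> exists c, u = c *: f) ->
  cell A h C -> cell A h C' -> B \subset C -> B \subset C' ->
  (exists2 x, x \in C & ev f x < 0) -> (exists2 x, x \in C' & ev f x < 0) ->
  C = C'.
Proof.
move=> Bf [l Cl] [l' Cl'] BC BC' [x xC xf] [x' xC' xf'].
have [c e] : exists c, l' - l = c *: f.
  apply: Bf => z zB; rewrite !evE (cell_eq Cl) ?(cell_eq Cl') ?subrr //.
    exact: (fintype.subsetP BC').
  exact: (fintype.subsetP BC).
have h1 := cell_sub_le Cl Cl' xC.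
have h2 := cell_sub_le Cl' Cl xC'.
rewrite -opprB e evN oppr_le0 evZ in h2; rewrite e evZ in h1.
have c0 : c = 0.
  by apply/eqP; rewrite eq_le -(nmulr_lge0 _ xf') h2 -(nmulr_lle0 _ xf) h1.
have ell : l' = l by apply/eqP; rewrite -subr_eq0 e c0 scale0r.
by rewrite ell in Cl'; apply: cell_by_inj Cl Cl'.
Qed.

(* The form of C is raised on the far side of B until it touches h again. *)
Lemma wall_cross A h C B f : cell A h C -> facet_by C B f ->
  (exists2 x, x \in A & 0 < ev f x) ->
  exists C', [/\ cell A h C', C' != C & facet_by C' B (- f)].
Proof.
move=> [l Cl] F [x0 x0A x0f]; have [fC eB f0 Bf] := F; have [lh _ sC] := Cl.
have [|t [t0 ht [x [xA xf hx]]]] := exists_min_ratio x0A x0f (a := fun x => h x - ev l x).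
  move=> x xA xf; rewrite subr_gt0 (cell_lt Cl) //.
  by apply/negP => /fC; rewrite leNgt xf.
set l' := l + t *: f; set C' := [set x in A | ev l' x == h x].
have l'E z : ev l' z = ev l z + t * ev f z by rewrite !evE.
have l'h z : z \in A -> ev l' z <= h z.
  move=> zA; rewrite l'E; case: (ltrP 0 (ev f z)) => zf.
    by have := ht z zA zf; lra.
  have := lh z zA; have : t * ev f z <= 0 by rewrite mulr_ge0_le0 // ltW.
  lra.
have fC' z : z \in C' -> 0 <= ev f z.
  rewrite inE l'E => /andP[zA /eqP e]; have := lh z zA.
  by rewrite -e lerDl pmulr_rge0.
have xC' : x \in C' by rewrite inE xA l'E hx; apply/eqP; ring.
have BC' : B \subset C'.
  apply/fintype.subsetP => z zB; have zC := fintype.subsetP (facet_sub F) z zB.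
  rewrite inE (fintype.subsetP (cell_sub Cl)) // l'E (facet_ann F) // mulr0 addr0.
  by apply/eqP; apply: cell_eq Cl zC.
exists C'; split.
- exists l'; split=> // u hu; have [z /(fintype.subsetP BC') /hu //|c e] := Bf u.
  have := hu x xC'; rewrite e evZ => /eqP; rewrite mulf_eq0 (gt_eqF xf) orbF.
  by move=> /eqP ->; rewrite scale0r.
- by apply/eqP => e; rewrite e in xC'; have := fC x xC'; rewrite leNgt xf.
- split.
  + by move=> z /fC'; rewrite evN oppr_le0.
  + apply/setP => z; apply/idP/idP => [zB|].
      by rewrite inE (fintype.subsetP BC') // evN (facet_ann F) ?oppr0 // eqxx.
    rewrite !inE evN oppr_eq0 l'E => /andP[/andP[zA /eqP e] /eqP zf].
    apply: (facet_in F) => //; apply: (cell_in Cl) => //.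
    by rewrite -e zf mulr0 addr0.
  + by rewrite oppr_eq0.
  + by move=> u /Bf[c ->]; exists (- c); rewrite scaleNr scalerN opprK.
Qed.

(** By [side_uniq] the side of the wall that contains [C] holds no other cell with this wall, so
    [C'] and [C''] both lie opposite and coincide. *)
Lemma wall_uniq A h B C C' C'' : cell A h C -> cell A h C' -> cell A h C'' ->
  facet C B -> facet C' B -> facet C'' B -> C' != C -> C'' != C -> C' = C''.
Proof.
move=> cC cC' cC'' [f F] [f' F'] [f'' F''] n' n''.
have [l [_ _ sC]] := cC.
have [_ _ _ Bf] := F.
have [x xC xf] := facet_spans F sC.
have Bf' : forall u, ann B u -> exists c, u = c *: (- f).
  by move=> u /Bf[c ->]; exists (- c); rewrite scaleNr scalerN opprK.
have side D g : cell A h D -> facet_by D B g -> D != C -> exists2 z, z \in D & ev (- f) z < 0.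
  move=> cD G nD; have [_ [_ _ sD]] := cD; have [_ _ f0 _] := F.
  have [z zD zf] := spans_ex sD f0; exists z => //.
  rewrite evN oppr_lt0 lt_neqAle eq_sym zf /= leNgt; apply/negP => zf'.
  case/eqP: nD; apply: (side_uniq Bf cD cC) => //.
  - exact: facet_sub G.
  - exact: facet_sub F.
  - by exists z.
  - by exists x.
exact: (side_uniq Bf' cC' cC'' (facet_sub F') (facet_sub F'')
  (side _ _ cC' F' n') (side _ _ cC'' F'' n'')).
Qed.

Lemma facet_uniq A B G G' : spans A -> facet A G -> facet A G' ->
  (exists f, forall u, ann B u -> exists c, u = c *: f) ->
  B \subset G -> B \subset G' -> G = G'.
Proof.
move=> sA [g Gg] [g' Gg'] [f Bf] BG BG'.
have [c ec] : exists c, g = c *: f by apply: Bf => x /(fintype.subsetP BG);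
    apply: facet_ann Gg _.
have [c' ec'] : exists c, g' = c *: f by apply: Bf => x /(fintype.subsetP BG');
    apply: facet_ann Gg' _.
have [_ -> g0 _] := Gg; have [_ -> g0' _] := Gg'.
apply/setP => x; rewrite !inE ec ec' !evZ !mulf_eq0.
have /negbTE -> : c != 0 by apply: contra g0 => /eqP e; rewrite ec e scale0r.
by have /negbTE -> : c' != 0 by apply: contra g0' => /eqP e; rewrite ec' e scale0r.
Qed.

(** All of [A] lies on one side of the facet [G], so [side_uniq] leaves room for a single cell. *)
Lemma boundary_cell_uniq A h B G C C' : facet A G -> B \subset G ->
  cell A h C -> cell A h C' -> facet C B -> B \subset C' -> C = C'.
Proof.
move=> [g Gg] BG cC cC' [f F] BC'.
have [_ _ f0 Bf] := F; have [gA _ g0 _] := Gg.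
have [c ec] : exists c, g = c *: f by apply: Bf => x /(fintype.subsetP BG);
    apply: facet_ann Gg _.
have c0 : c != 0 by apply: contra g0 => /eqP e; rewrite ec e scale0r.
have Bg u : ann B u -> exists c, u = c *: g.
  by move=> /Bf[d ->]; exists (d / c); rewrite ec scalerA divfK.
have neg D : cell A h D -> exists2 x, x \in D & ev g x < 0.
  move=> [l [lD eD sD]]; have [x xD xg] := spans_ex sD g0; exists x => //.
  rewrite lt_neqAle xg gA //; by move: xD; rewrite eD inE => /andP[].
exact: (side_uniq Bg cC cC' (facet_sub F) BC' (neg _ cC) (neg _ cC')).
Qed.

Lemma facet_cell_cap A h B G C f : facet A G -> B \subset G -> cell A h C ->
  facet_by C B f -> B = C :&: G.
Proof.
move=> [g Gg] BG [l Cl] F; have [_ _ f0 Bf] := F.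
have [c ec] : exists c, g = c *: f.
  by apply: Bf => x /(fintype.subsetP BG); apply: facet_ann Gg _.
have [_ _ g0 _] := Gg.
have c0 : c != 0 by apply: contra g0 => /eqP e; rewrite ec e scale0r.
apply/setP => x; rewrite inE; apply/idP/andP => [xB|[xC xG]].
  by rewrite (fintype.subsetP (facet_sub F)) // (fintype.subsetP BG).
apply: (facet_in F) => //; have := facet_ann Gg xG.
by rewrite ec evZ => /eqP; rewrite mulf_eq0 (negbTE c0) => /eqP.
Qed.

(** The matrix with the points of [b] as columns turns independence into full rank and [ann b] into
    its kernel, so that the cardinals below follow from rank and nullity. *)
Lemma indep_rank b : indep b -> exists M : 'M[R]_(n, #|b|),
  \rank M = #|b| /\ forall u, (u <= kermx M)%MS <-> ann b u.
Proof.
move=> ib; pose M : 'M[R]_(n, #|b|) := \matrix_(i, j) q (enum_val j) 0 i.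
have uM u j : (u *m M) 0 j = ev u (enum_val j).
  by rewrite mxE /ev dotE; apply: eq_bigr => i _; rewrite mxE.
exists M; split.
  apply/eqP; apply/row_fullP.
  have /choice[v hv] : forall j : 'I_#|b|, exists u, forall x, x \in b ->
      ev u x = (x == enum_val j)%:R.
    by move=> j; apply: ib.
  exists (\matrix_j v j); apply/row_matrixP => j; rewrite row_mul rowK.
  apply/rowP => i; rewrite uM hv ?enum_valP // !mxE (inj_eq enum_val_inj).
  by rewrite eq_sym.
move=> u; split=> [/sub_kermxP e x xb|hu].
  have := uM u (enum_rank_in xb x); rewrite e mxE enum_rankK_in //.
apply/sub_kermxP/rowP => j; rewrite uM mxE; exact: hu (enum_valP j).
Qed.

Lemma indep_spans_card b : indep b -> spans b -> #|b| = n.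
Proof.
move=> ib sb; have [M [rM kM]] := indep_rank ib.
have : kermx M = 0.
  by apply/eqP/rowV0P => u /kM /sb.
by move/eqP; rewrite -mxrank_eq0 mxrank_ker rM; have := rank_leq_row M; lia.
Qed.

Lemma indep_line_card b f : indep b -> f != 0 -> ann b f ->
  (forall u, ann b u -> exists c, u = c *: f) -> (#|b|.+1 = n)%N.
Proof.
move=> ib f0 bf h; have [M [rM kM]] := indep_rank ib.
have : \rank (kermx M) = 1%N.
  have <- : \rank f = 1%N by rewrite rank_rV f0.
  apply/eqP; rewrite eqn_leq; apply/andP; split; apply: mxrankS; last by apply/kM.
  by apply/rV_subP => u /kM /h[c ->]; exact: scalemx_sub.
by rewrite mxrank_ker rM; have := rank_leq_row M; lia.
Qed.

Lemma indep_card_line b f : indep b -> f != 0 -> ann b f -> (#|b|.+1 = n)%N ->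
  forall u, ann b u -> exists c, u = c *: f.
Proof.
move=> ib f0 bf cb u bu; have [M [rM kM]] := indep_rank ib.
apply/sub_rVP; suff /eqmxP fk : (f == kermx M)%MS by rewrite fk; apply/kM.
have fk : (f <= kermx M)%MS by apply/kM.
rewrite -(geq_leqif (mxrank_leqif_eq fk)) mxrank_ker rM rank_rV f0; lia.
Qed.

Lemma indep_card_le b : indep b -> (#|b| <= n)%N.
Proof. by move=> /indep_rank[M [rM _]]; have := rank_leq_row M; rewrite rM. Qed.

(** An independent subset of largest size works: a form vanishing on [b] but not at [x] would allow
    [x] to be added. *)
Lemma base_ex E : exists b, [/\ b \subset E, indep b &
  forall u, ann b u -> ann E u].
Proof.
have P0 : (finset.set0 \subset E) && `[< indep finset.set0 >].
  by rewrite finset.sub0set; apply/asboolP => g; exists 0 => x; rewrite inE.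
case: (@arg_maxnP _ finset.set0 (fun b => (b \subset E) && `[< indep b >]) (fun b => #|b|) P0).
move=> b /andP[bE /asboolP ib] bmax; exists b; split=> // u bu x xE.
apply/eqP; apply: contrapT => /negP ux.
have xb : x \notin b by apply/negP => /bu e; rewrite e eqxx in ux.
have := bmax (x |: b); rewrite cardsU1 xb => h.
suff /h : (x |: b \subset E) && `[< indep (x |: b) >] by rewrite add1n; lia.
apply/andP; split; first by rewrite finset.subUset finset.sub1set xE.
apply/asboolP => g; have [v hv] := ib g.
exists (v + ((g x - ev v x) / ev u x) *: u) => y; rewrite !inE !evE => /orP[/eqP ->|yb].
  by rewrite divfK // addrC subrK.
by rewrite (bu _ yb) mulr0 addr0 hv.
Qed.

(** [D] is dual to the basis [b]: [ev (D y) x] is the coordinate of the point [x] of [E] along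
    [y]. *)
Lemma dual_base_ex E : exists b (D : X -> 'rV[R]_n), [/\ b \subset E, indep b,
  forall u, ann b u -> ann E u,
  forall y z, z \in b -> ev (D y) z = (z == y)%:R &
  forall u x, x \in E -> ev u x = \sum_(y in b) ev u y * ev (D y) x].
Proof.
have [b [bE ib hb]] := base_ex E; exists b.
have /choice[D hD] : forall y, exists u, forall z, z \in b -> ev u z = (z == y)%:R.
  by move=> y; apply: ib.
exists D; split=> // u x xE.
have : ev (u - \sum_(y in b) ev u y *: D y) x = 0.
  apply: (hb _ _ x xE) => z zb; rewrite evD evN /ev dot_suml -/(ev u z).
  rewrite (big_setD1 z) //= dotZl -/(ev (D z) z) hD // eqxx mulr1 big1 ?addr0 ?subrr //.
  move=> y; rewrite !inE => /andP[yz yb]; rewrite dotZl -/(ev (D y) z) hD //.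
  by rewrite eq_sym (negbTE yz) mulr0.
rewrite evD evN => /eqP; rewrite subr_eq0 => /eqP ->.
by rewrite /ev dot_suml; apply: eq_bigr => y _; rewrite dotZl.
Qed.

End Cones.

Section LinearSystem.
Local Open Scope ring_scope.
Variables (R : realFieldType) (T J : finType).

(** A homogeneous system with fewer equations than unknowns has a nonzero solution; values outside
    [U] are pinned at 0. *)
Lemma linear_system_ex (U : {set T}) (Q : {set J}) (L : J -> (T -> R) -> R) :
  (forall j a h g, L j (fun t => a * h t + g t) = a * L j h + L j g) ->
  (#|Q| < #|U|)%N ->
  exists h, [/\ forall t, t \notin U -> h t = 0, exists t, h t != 0 &
    forall j, j \in Q -> L j h = 0].
Proof.
move=> Llin QU.
have L0 j : L j (fun=> 0) = 0.
  have h : L j (fun=> 0) = - 1 * L j (fun=> 0) + L j (fun=> 0).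
    by rewrite -Llin; congr (L j _); apply/funext => t; rewrite mulr0 addr0.
  by rewrite h mulN1r addNr.
have Lsum j (r : seq 'I_#|U|) (v : 'I_#|U| -> R) (d : 'I_#|U| -> T -> R) :
    L j (fun t => \sum_(i <- r) v i * d i t) = \sum_(i <- r) v i * L j (d i).
  elim: r => [|i r IH].
    by rewrite big_nil -[RHS](L0 j); congr (L j _); apply/funext => t; rewrite big_nil.
  rewrite big_cons -IH -Llin; congr (L j _); apply/funext => t; by rewrite big_cons.
pose d (i : 'I_#|U|) t : R := (t == enum_val i)%:R.
pose M : 'M[R]_(#|U|, #|Q|) := \matrix_(i, j) L (enum_val j) (d i).
have : kermx M != 0.
  rewrite -mxrank_eq0 mxrank_ker; have := rank_leq_col M; lia.
case/rowV0Pn => v /sub_kermxP vM v0; exists (fun t => \sum_i v 0 i * d i t); split.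
- move=> t tU; rewrite big1 // => i _; rewrite /d.
  by case: eqP => [e|]; rewrite ?mulr0 //; rewrite e enum_valP in tU.
- have [i vi] : exists i, v 0 i != 0.
    apply: contrapT => h; case/eqP: v0; apply/rowP => i; rewrite mxE.
    by apply/eqP; apply: contrapT => /negP h'; apply: h; exists i.
  exists (enum_val i); rewrite (bigD1 i) //= /d eqxx mulr1 big1 ?addr0 // => k ki.
  by rewrite (inj_eq enum_val_inj) eq_sym (negbTE ki) mulr0.
- move=> j jQ; rewrite Lsum; have := congr1 (fun A : 'rV_#|Q| => A 0 (enum_rank_in jQ j)) vM.
  rewrite !mxE => {2}<-; apply: eq_bigr => i _; rewrite mxE enum_rankK_in //.
Qed.

End LinearSystem.

Section Space.
Local Open Scope ring_scope.
Variables (R : realFieldType) (X : finType) (q : X -> 'rV[R]_4).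
Implicit Types (A B C E F T G : {set X}) (u l f : 'rV[R]_4).
Local Notation ev := (ev q).
Local Notation ann := (ann q).
Local Notation spans := (spans q).
Local Notation indep := (indep q).
Local Notation facet := (facet q).
Local Notation facet_by := (facet_by q).
Local Notation cone := (cone q).
Local Notation cell := (cell q).
Local Notation cell_by := (cell_by q).

(** * Counting the vertices of the facets *)

(** Strictly convex position: every point of [A] is a vertex of the hull, exposed by a form. In
    particular the points are distinct. *)
Definition convpos A := forall x, x \in A -> exists g, ev g x = 0 /\
  forall y, y \in A -> y != x -> ev g y < 0.

Lemma convposS A B : A \subset B -> convpos B -> convpos A.
Proof.
move=> /fintype.subsetP AB cB x /AB /cB[g [gx gB]]; exists g; split=> //.
by move=> y /AB /gB.
Qed.

Definition facets A := [set B | `[< facet A B >]].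

Lemma facetsP A B : (B \in facets A) <-> facet A B.
Proof. by rewrite inE; split=> /asboolP. Qed.

Variable e : 'rV[R]_4.
Hypothesis e1 : forall x, ev e x = 1.

(** The form has to avoid the hyperplanes orthogonal to finitely many differences, which are nonzero
    because points in convex position are distinct. *)
Lemma generic_form A : convpos A ->
  exists l, forall x y, x \in A -> y \in A -> ev l x = ev l y -> x = y.
Proof.
move=> cA; pose s := [seq q p.1 - q p.2 | p <- enum [set p : X * X | [&& p.1 \in A,
    p.2 \in A & p.1 != p.2]]].
have [|l hl] := @avoid_ex R 4 s.
  move=> _ /mapP[[x y] + ->]; rewrite mem_enum inE /= => /and3P[xA yA xy].
  rewrite subr_eq0; apply/eqP => exy; have [g [gx gA]] := cA x xA.
  have := gA y yA; rewrite eq_sym xy => /(_ isT).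
  by rewrite /ev -exy -/(ev g x) gx ltxx.
exists l => x y xA yA exy; apply/eqP; apply: contrapT => /negP xy.
have : q x - q y \in s.
  by apply/mapP; exists (x, y) => //; rewrite mem_enum inE /= xA yA.
by move=> /hl; rewrite dotDr dotNr subr_eq0 -/(ev l x) -/(ev l y) exy eqxx.
Qed.

(** A vertex strictly between two others in level is not on their line. The forms [e], [l] and the
    form [g] exposing [x] interpolate: [g] is negative at [a] and [b] while [l] leaves its value at
    [x] in opposite directions, so the determinant [D] is positive, and [s], [t] come from Cramer's
    rule. *)
Lemma indep3 A l x a b : convpos A -> x \in A -> a \in A -> b \in A ->
  ev l a < ev l x -> ev l x < ev l b ->
  indep [set x; a; b] /\ #|[set x; a; b]| = 3.
Proof.
move=> cA xA aA bA lax lxb; have [g [gx gA]] := cA x xA.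
have xa : a != x by apply/eqP => ax; rewrite ax ltxx in lax.
have xb : b != x by apply/eqP => bx; rewrite bx ltxx in lxb.
have ab : a != b by apply/eqP => e'; have := lt_trans lax lxb; rewrite e' ltxx.
have ga := gA a aA xa; have gb := gA b bA xb.
split; last by rewrite cardsU !cards2 cards1 eq_sym xa (_ : _ :&: _ = finset.set0)
  ?finset.cards0 //; apply/setP => z; rewrite !inE; apply/negP => /andP[/orP[]/eqP -> /eqP];
  [move/esym; exact/eqP | exact/eqP].
move=> v; pose p y := ev l y - ev l x.
have pa : p a < 0 by rewrite subr_lt0.
have pb : 0 < p b by rewrite subr_gt0.
pose D := p a * ev g b - p b * ev g a.
have D0 : D != 0.
  have : 0 < p a * ev g b by rewrite nmulr_rgt0.
  have : p b * ev g a < 0 by rewrite pmulr_rlt0.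
  by move=> *; rewrite gt_eqF // /D; lra.
pose s := ((v a - v x) * ev g b - (v b - v x) * ev g a) / D.
pose t := (p a * (v b - v x) - p b * (v a - v x)) / D.
exists (v x *: e + s *: (l - ev l x *: e) + t *: g) => y.
rewrite !inE !evE e1 !mulr1 -/(p y) => /orP[/orP[]|] /eqP ->.
- by rewrite /p gx subrr !mulr0 !addr0.
- by rewrite /s /t /D; field.
- by rewrite /s /t /D; field.
Qed.

Definition middle l B x := x \in B /\
  exists a b, [/\ a \in B, b \in B, ev l a < ev l x & ev l x < ev l b].

Lemma facet_eq3 A l x a b B B' : convpos A -> facet A B -> facet A B' ->
  x \in B -> a \in B -> b \in B -> x \in B' -> a \in B' -> b \in B' ->
  ev l a < ev l x -> ev l x < ev l b -> spans A -> B = B'.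
Proof.
move=> cA [f F] [f' F'] xB aB bB xB' aB' bB' lax lxb sA.
have BA := fintype.subsetP (facet_sub F).
have [i3 c3] := indep3 cA (BA _ xB) (BA _ aB) (BA _ bB) lax lxb.
have [_ _ f0 _] := F.
have sub : [set x; a; b] \subset B by apply/fintype.subsetP => z;
    rewrite !inE => /orP[/orP[]|] /eqP ->.
have sub' : [set x; a; b] \subset B' by apply/fintype.subsetP => z;
    rewrite !inE => /orP[/orP[]|] /eqP ->.
apply: (facet_uniq sA _ _ _ sub sub'); [by exists f|by exists f'|].
exists f; apply: (indep_card_line i3 f0); last by rewrite c3.
by move=> z /(fintype.subsetP sub); exact: facet_ann F _.
Qed.

(* The slice of A at the level of x is two-dimensional and has at most two
   edges at x: three edge directions would be linearly dependent. *)
Lemma middle_le2 A l x (B : 'I_3 -> {set X}) : convpos A -> spans A ->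
  injective B -> (forall i, facet A (B i)) -> (forall i, middle l (B i) x) -> False.
Proof.
move=> cA sA Binj /choice[f F] M.
have /choice[ab M'] : forall i, exists ab : X * X, [/\ ab.1 \in B i, ab.2 \in B i,
    ev l ab.1 < ev l x & ev l x < ev l ab.2].
  by move=> i; have [_ [a [b h]]] := M i; exists (a, b).
pose mu i := ev l (ab i).2 - ev l x; pose nu i := ev l x - ev l (ab i).1.
have mu0 i : 0 < mu i by rewrite subr_gt0; case: (M' i).
have nu0 i : 0 < nu i by rewrite subr_gt0; case: (M' i).
(* Up to scale, the direction from [x] to the point of the segment between [a] and [b] at the level
   of [x]; both [e] and [l] vanish on it. *)
pose U i := mu i *: q (ab i).1 + nu i *: q (ab i).2 - (mu i + nu i) *: q x.
have dU v i : dot v (U i) = mu i * ev v (ab i).1 + nu i * ev v (ab i).2 -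
    (mu i + nu i) * ev v x.
  by rewrite !(dotDr, dotNr, dotZr).
have xB i : x \in B i by case: (M i).
have fU i : dot (f i) (U i) = 0.
  by case: (M' i) => aB bB _ _; rewrite dU !(facet_ann (F i)) // !mulr0 addr0 subrr.
have fUlt i j : j != i -> dot (f j) (U i) < 0.
  move=> ij; rewrite dU (facet_ann (F j) (xB j)) mulr0 subr0.
  have [aB bB la lb] := M' i; have [fA _ _ _] := F j.
  have aA := fintype.subsetP (facet_sub (F i)) _ aB.
  have bA := fintype.subsetP (facet_sub (F i)) _ bB.
  have ha : mu i * ev (f j) (ab i).1 <= 0 by rewrite pmulr_rle0 // fA.
  have hb : nu i * ev (f j) (ab i).2 <= 0 by rewrite pmulr_rle0 // fA.
  rewrite lt_neqAle; apply/andP; split; last by lra.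
  apply/eqP => h0; case/eqP: ij; apply: Binj; apply/esym.
  have fj : facet A (B j) by exists (f j).
  have fi : facet A (B i) by exists (f i).
  have a0 : ev (f j) (ab i).1 = 0.
    by apply/eqP; have /eqP : mu i * ev (f j) (ab i).1 = 0 by [lra];
        rewrite mulf_eq0 (gt_eqF (mu0 i)).
  have b0 : ev (f j) (ab i).2 = 0.
    by apply/eqP; have /eqP : nu i * ev (f j) (ab i).2 = 0 by [lra];
        rewrite mulf_eq0 (gt_eqF (nu0 i)).
  exact: (facet_eq3 cA fi fj (xB i) aB bB (xB j) (facet_in (F j) aA a0) (facet_in
      (F j) bA b0) la lb sA).
(* Vectors orthogonal to the independent forms [e] and [l] in dimension four lie in a plane, so
   three of them are dependent. *)
pose W (j : 'I_2) := if j == 0 then e else l.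
have [||c c0 ec] := @dependency_ex R 4 3 2 U W isT.
- move=> i j; rewrite dotC /W dU; case: ifP => _; first by rewrite !e1; ring.
  by rewrite /mu /nu; ring.
- move=> c; rewrite !big_ord_recl big_ord0 addr0 /W /= => h.
  have hx v : c 0 0 * ev e v + c 0 (lift ord0 ord0) * ev l v = 0.
    by have := congr1 (fun z => dot z (q v)) h; rewrite dotDl !dotZl dot0l.
  have c1 : c 0 (lift ord0 ord0) = 0.
    have h1 := hx x; have h2 := hx (ab 0).1; rewrite !e1 in h1 h2.
    have : c 0 (lift ord0 ord0) * nu 0 = 0 by rewrite /nu; lra.
    by move/eqP; rewrite mulf_eq0 (gt_eqF (nu0 0)) orbF => /eqP.
  have := hx x; rewrite c1 e1 mul0r addr0 mulr1 => c00.
  apply/rowP => j; rewrite mxE.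
  have [->|->] : j = 0 \/ j = lift ord0 ord0 by case: j => -[|[|//]] ?; [left|right];
      apply/val_inj.
  - by [].
  - by [].
have hf j : \sum_i c 0 i * dot (f j) (U i) = 0.
  have h := congr1 (dot (f j)) ec; rewrite dot_sumr dot0r in h; rewrite -[RHS]h.
  by apply: eq_bigr => i _; rewrite dotZr.
pose i1 : 'I_3 := lift ord0 ord0; pose i2 : 'I_3 := lift ord0 (lift ord0 ord0).
have h0 := hf 0; have h1 := hf i1; have h2 := hf i2.
rewrite !big_ord_recl !big_ord0 /= -/i1 -/i2 !fU !mulr0 !(add0r, addr0) in h0 h1 h2.
have s01 : dot (f 0) (U i1) < 0 by apply: fUlt.
have s02 : dot (f 0) (U i2) < 0 by apply: fUlt.
have s10 : dot (f i1) (U 0) < 0 by apply: fUlt.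
have s12 : dot (f i1) (U i2) < 0 by apply: fUlt.
have s20 : dot (f i2) (U 0) < 0 by apply: fUlt.
have s21 : dot (f i2) (U i1) < 0 by apply: fUlt.
(* Each [f j] kills [U j] and is negative on the other two directions, so any two coefficients of
   the dependency have opposite signs or both vanish; three nonzero numbers cannot have pairwise
   opposite signs. *)
have opp (a b s t : R) : s < 0 -> t < 0 -> a * s + b * t = 0 ->
    (0 < a -> b < 0) /\ (a < 0 -> 0 < b).
  move=> s0 t0 h; split=> ha.
    by rewrite -(nmulr_lgt0 _ t0); have : a * s < 0 by [rewrite pmulr_rlt0]; lra.
  by rewrite -(nmulr_llt0 _ t0); have : 0 < a * s by [rewrite nmulr_rgt0]; lra.
have [p1 p2] := opp _ _ _ _ s01 s02 h0.
have [p3 p4] := opp _ _ _ _ s10 s12 h1.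
have [p5 p6] := opp _ _ _ _ s20 s21 h2.
have z0 : c 0 0 = 0.
  case: (ltrgtP (c 0 0) 0) => // hc.
    by have h := p1 (p6 hc); have := lt_trans h (p4 hc); rewrite ltxx.
  by have h := p2 (p5 hc); have := lt_trans h (p3 hc); rewrite ltxx.
rewrite z0 mul0r add0r in h1; rewrite z0 mul0r add0r in h2.
have z2 : c 0 i2 = 0 by move/eqP: h1; rewrite mulf_eq0 (lt_eqF s12) orbF => /eqP.
have z1 : c 0 i1 = 0 by move/eqP: h2; rewrite mulf_eq0 (lt_eqF s21) orbF => /eqP.
case/eqP: c0; apply/rowP => j; rewrite mxE.
have [->|[->|->]] : j = 0 \/ j = i1 \/ j = i2.
  by case: j => -[|[|[|//]]] ?; [left|right; left|right; right]; apply/val_inj.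
all: by [].
Qed.

(* Otherwise some d annihilated by e and by two forms defining all facets
   through x would be annihilated by every facet through x. *)
Lemma facets_at_ge3 A x : convpos A -> spans A -> x \in A ->
  (3 <= #|[set B in facets A | x \in B]|)%N.
Proof.
move=> cA sA xA; rewrite leqNgt; apply/negP => lt3.
have key d : d != 0 -> dot d e = 0 -> exists2 f, dot f d != 0 & exists2 B,
    facet_by A B f & x \in B.
  move=> d0 de; have [g [gx gA]] := cA x xA.
  have [g' [g'x g'A g'd]] : exists g', [/\ ev g' x = 0, forall y, y \in A -> y != x ->
      ev g' y < 0 & dot g' d != 0].
    have [gd|gd] := eqVneq (dot g d) 0; last by exists g.
    (* [w] vanishes at [x] and has positive product with [d], because [d] is orthogonal to [e]; a
       small multiple added to [g] keeps [x] exposed. *)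
    pose w := d - ev d x *: e.
    have [|eps eps0 heps] := small_eps (S := A :\ x) (a := ev g) (ev w).
      by move=> y; rewrite !inE => /andP[yx yA]; apply: gA.
    exists (g + eps *: w); split.
    - by rewrite !evE gx e1 mulr1 subrr mulr0 addr0.
    - by move=> y yA yx; rewrite evD evZ heps // !inE yx.
    - rewrite dotDl gd add0r dotZl mulf_neq0 ?gt_eqF //.
      by rewrite dotDl dotNl dotZl (dotC e) de mulr0 subr0 dot_gt0.
  wlog gd0 : d d0 de g'd / 0 < dot g' d.
    move=> hw; case: (ltrgtP (dot g' d) 0) => [lt|gt|e0]; last by rewrite e0 eqxx in g'd.
      have nd0 : - d != 0 by rewrite oppr_eq0.
      have nde : dot (- d) e = 0 by rewrite dotNl de oppr0.
      have g'nd : 0 < dot g' (- d) by rewrite dotNr oppr_gt0.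
      have [f fd fB] := hw _ nd0 nde (lt0r_neq0 g'nd) g'nd.
      by exists f => //; rewrite dotNr oppr_eq0 in fd.
    exact: hw.
  have evL y : scalar (fun u => ev u y) by move=> a u v; rewrite !evE.
  have dL : scalar (fun u => dot u d) by move=> a u v; rewrite dotDl dotZl.
  have g'A0 y : y \in A -> ev g' y <= 0.
    by move=> yA; have [->|yx] := eqVneq y x; rewrite ?g'x // ltW // g'A.
  (* Rotation makes [g'] the form of a facet still containing [x], with its product with [d] still
     positive. *)
  have [f [fA fd fZ fmax]] := rotation evL dL sA g'A0 gd0.
  exists f; first by rewrite gt_eqF.
  exists [set y in A | ev f y == 0]; last by rewrite inE xA fZ ?eqxx.
  split=> //; first by apply/eqP => f0; rewrite f0 dot0l ltxx in fd.
  move=> u hu; apply: fmax => y yA fy; apply: hu; by rewrite inE yA fy eqxx.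
have /choice[ff hff] : forall B, exists f, facet A B -> facet_by A B f.
  move=> B; case: (pselect (facet A B)) => [[f F]|nF]; first by exists f.
  by exists 0.
set S := [set B in _ | _] in lt3.
have [B1 [B2 hB]] : exists B1 B2, forall B, B \in S -> B = B1 \/ B = B2.
  rewrite cardE in lt3; have := mem_enum S; case: (enum S) lt3 => [|B1 [|B2 [|//]]] _ hS.
  - by exists finset.set0, finset.set0 => B; rewrite -hS.
  - by exists B1, B1 => B; rewrite -hS inE => /eqP ->; left.
  - by exists B1, B2 => B; rewrite -hS !inE => /orP[] /eqP ->; [left|right].
(* In dimension four some nonzero [d] is orthogonal to these three vectors, against [key]. *)
pose F (i : 'I_3) := match val i with 0 => e | 1 => ff B1 | _ => ff B2 end.
have [//|d d0 dF] := @orthogonal_ex R 4 3 F.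
have [f fd [B FB xB]] := key d d0 (dF (@Ordinal 3 0 isT)).
have fB : facet A B by exists f.
have [c ec] : exists c, f = c *: ff B.
  have [_ _ _ hmax] := hff B fB; apply: hmax; exact: facet_ann FB.
have BS : B \in S by rewrite inE xB andbT; apply/facetsP.
have : dot (ff B) d = 0.
  rewrite dotC; case: (hB B BS) => ->.
    exact: (dF (@Ordinal 3 1 isT)).
  exact: (dF (@Ordinal 3 2 isT)).
by move=> e0; rewrite ec dotZl e0 mulr0 eqxx in fd.
Qed.

Lemma facet_card3 A B : facet A B -> (3 <= #|B|)%N.
Proof.
move=> [f F]; have [b [bB ib hb]] := base_ex q B.
have [_ _ f0 Bf] := F.
have bf : ann b f by move=> x /(fintype.subsetP bB); exact: facet_ann F _.
have := indep_line_card ib f0 bf (fun u hu => Bf u (hb u hu)).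
by move=> [<-]; exact: subset_leq_card.
Qed.

Lemma spans_card4 A : spans A -> (4 <= #|A|)%N.
Proof.
move=> sA; have [b [bA ib hb]] := base_ex q A.
rewrite -(indep_spans_card ib (fun u hu => sA u (hb u hu))); exact: subset_leq_card.
Qed.

(** Double count of the pairs of a facet and a middle vertex of it: a facet [B] has at least
    [#|B| - 2] of them, a vertex is middle in at most two facets, and the lowest and the highest
    vertex of [A] in none. *)
Lemma facets_sum_sub2 A : convpos A -> spans A ->
  (\sum_(B in facets A) (#|B| - 2) <= 2 * (#|A| - 2))%N.
Proof.
move=> cA sA; have [l linj] := generic_form cA.
have A4 := spans_card4 sA.
have [x0 x0A] : exists x, x \in A by apply/card_gt0P; lia.
pose mid (B : {set X}) := [set x in B | `[< middle l B x >]].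
have ext (B : {set X}) : B \subset A -> (2 <= #|B|)%N ->
    exists x y, [/\ x \in B, y \in B, x != y &
    (forall z, z \in B -> ev l x <= ev l z <= ev l y)].
  move=> /fintype.subsetP BA B2; have [z zB] : exists z, z \in B by apply/card_gt0P; lia.
  case: (@Order.TotalTheory.arg_minP _ _ _ z (fun x => x \in B) (ev l) zB) => x xB xmin.
  case: (@Order.TotalTheory.arg_maxP _ _ _ z (fun x => x \in B) (ev l) zB) => y yB ymax.
  exists x, y; split=> //; last by move=> t tB; apply/andP; split; [exact: xmin|exact: ymax].
  apply/eqP => exy; have : B \subset [set x].
    apply/fintype.subsetP => t tB; rewrite inE; apply/eqP/linj; rewrite ?BA //.
    by apply/eqP; rewrite eq_le xmin // andbT exy; apply: ymax.
  by move=> /subset_leq_card; rewrite cards1; lia.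
have [xm [xM [xmA xMA xmM hxA]]] := ext A (fintype.subxx A) (ltnW (ltnW A4)).
have : (\sum_(B in facets A) (#|B| - 2) <= \sum_(B in facets A) #|mid B|)%N.
  apply: leq_sum => B /facetsP FB; have B3 := facet_card3 FB.
  have BA : B \subset A by case: FB => f; exact: facet_sub.
  have [x [y [xB yB xy hxy]]] := ext B BA (ltnW B3).
  have : B :\: [set x; y] \subset mid B.
    apply/fintype.subsetP => z; rewrite !inE negb_or => /andP[/andP[zx zy] zB].
    rewrite zB; apply/asboolP; split=> //; exists x, y; split=> //.
      rewrite lt_neqAle; case/andP: (hxy z zB) => -> _; rewrite andbT.
      by apply: contra zx => /eqP /linj ->//; apply: (fintype.subsetP BA).
    rewrite lt_neqAle; case/andP: (hxy z zB) => _ ->; rewrite andbT.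
    by apply: contra zy => /eqP /linj ->//; apply: (fintype.subsetP BA).
  move=> /subset_leq_card; rewrite cardsD; have : (#|B :&: [set x; y]| <= 2)%N.
    by apply: (leq_trans (subset_leq_card (finset.subsetIr _ _))); rewrite cards2;
        case: (x != y).
  lia.
move=> /leq_trans; apply.
under eq_bigr do rewrite -sum1_card.
rewrite (exchange_big_dep (fun x => x \in A)) /=; last first.
  move=> B x /facetsP [f F]; rewrite inE => /andP[+ _].
  exact: (fintype.subsetP (facet_sub F)).
rewrite (eq_bigr (fun x => #|[set B in facets A | x \in mid B]|)); last first.
  by move=> x _; rewrite -sum1_card; apply: eq_bigl => B; rewrite !inE.
have -> : (2 * (#|A| - 2) = \sum_(x in A :\: [set xm; xM]) 2)%N.
  rewrite sum_nat_const mulnC cardsD (_ : A :&: _ = [set xm; xM]).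
    by rewrite cards2 xmM.
  by apply/finset.setIidPr/fintype.subsetP => z; rewrite !inE => /orP[] /eqP ->.
rewrite (big_setID [set xm; xM]) /= [X in (X + _ <= _)%N]big1 ?add0n.
  apply: leq_sum => x _; rewrite leqNgt; apply/negP => /card_gt2P.
  move=> [B1 [B2 [B3 [[h1 h2 h3] [n12 n23 n31]]]]].
  pose BB (i : 'I_3) := match val i with 0 => B1 | 1 => B2 | _ => B3 end.
  have hBB i : BB i \in [set B in facets A | x \in mid B].
    by rewrite /BB; case: (val i) => [//|[|]].
  apply: (@middle_le2 A l x BB) => //.
  - move=> i j; rewrite /BB; case: i => -[|[|[|//]]] ?; case: j => -[|[|[|//]]] ? /= ee;
      try (by apply/val_inj); exfalso; move/eqP: ee;
          rewrite ?(negbTE n12) ?(negbTE n23) ?(negbTE n31) //;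
      by rewrite eq_sym ?(negbTE n12) ?(negbTE n23) ?(negbTE n31).
  - by move=> i; have := hBB i; rewrite inE => /andP[/facetsP].
  - by move=> i; have := hBB i; rewrite !inE => /andP[_ /andP[_ /asboolP]].
move=> x; rewrite !inE => /andP[xA xmM']; apply/eqP; rewrite cards_eq0 -finset.subset0.
apply/fintype.subsetP => B; rewrite !inE => /andP[/asboolP[f F] /andP[xB /asboolP[_ [a [b [aB bB lax lxb]]]]]].
have BA := fintype.subsetP (facet_sub F).
case/orP: xmM' => /eqP exm; rewrite exm in lax lxb.
  by have /andP[h _] := hxA a (BA _ aB); rewrite ltNge h in lax.
by have /andP[_ h] := hxA b (BA _ bB); rewrite ltNge h in lxb.
Qed.

(** Let S be the number of incidences, m that of facets, V that of vertices. The sweep gives S - 2m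
    <= 2(V - 2), and three facets at each vertex give 3V <= S. Hence 2(S - 3m) = 3(S - 2m) - S <=
    3(V - 4), which is below 4(V - 4) as soon as V > 4. *)
Lemma facets_sum_sub3 A : convpos A -> spans A ->
  (\sum_(B in facets A) (#|B| - 3) <= 2 * (#|A| - 4))%N /\
  (4 < #|A| -> \sum_(B in facets A) (#|B| - 3) < 2 * (#|A| - 4))%N.
Proof.
move=> cA sA; have h2 := facets_sum_sub2 cA sA; have A4 := spans_card4 sA.
set m := #|facets A|.
have e2 : (\sum_(B in facets A) #|B| = \sum_(B in facets A) (#|B| - 2) + 2 * m)%N.
  rewrite mulnC -sum_nat_const -big_split /=; apply: eq_bigr => B /facetsP /facet_card3; lia.
have e3 : (\sum_(B in facets A) #|B| = \sum_(B in facets A) (#|B| - 3) + 3 * m)%N.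
  rewrite mulnC -sum_nat_const -big_split /=; apply: eq_bigr => B /facetsP /facet_card3; lia.
have h3 : (3 * #|A| <= \sum_(B in facets A) #|B|)%N.
  rewrite mulnC -sum_nat_const.
  under [X in (_ <= X)%N]eq_bigr do rewrite -sum1_card.
  rewrite (exchange_big_dep (fun x => x \in A)) /=; last first.
    by move=> B x /facetsP [f F]; exact: (fintype.subsetP (facet_sub F)).
  apply: leq_sum => x xA; apply: (leq_trans (facets_at_ge3 cA sA xA)).
  by rewrite -sum1_card; apply: eq_leq; apply: eq_bigl => B; rewrite !inE.
lia.
Qed.

(** * Compatible heights *)

Lemma indep4_spans b : indep b -> #|b| = 4%N -> spans b.
Proof.
move=> ib b4 u /=; have [M [rM kM]] := indep_rank ib.
move=> /kM; have : \rank (kermx M) = 0%N by rewrite mxrank_ker rM b4.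
by move/eqP; rewrite mxrank_eq0 => /eqP ->; rewrite submx0 => /eqP.
Qed.

(** A basis [b] of [E] has at most three points. With three, [E] has codimension one. With fewer,
    [E] lies on an affine line, where convex position allows at most two points, so [E] is its own
    basis. The second case is the one in which nothing has to be glued. *)
Lemma face_dichotomy C E f : convpos C -> E \subset C -> f != 0 -> ann E f ->
  (forall u, ann E u -> exists c, u = c *: f) \/ indep E.
Proof.
move=> cC EC f0 Ef; have cE := convposS EC cC.
have [b [D [bE ib hb hD rep]]] := dual_base_ex q E.
have bsub := fintype.subsetP bE.
have bf : ann b f by move=> x /bsub; exact: Ef.
have b4 : (#|b| <= 3)%N.
  have := indep_card_le ib; rewrite leq_eqVlt => /orP[/eqP b4|//].
  by have := indep4_spans ib b4 bf => f00; rewrite f00 eqxx in f0.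
move: b4; rewrite leq_eqVlt => /orP[/eqP b3|b2].
  left=> u uE; apply: (indep_card_line ib f0 bf); first by rewrite b3.
  by move=> x /bsub; exact: uE.
right; suff -> : E = b by [].
apply/eqP; rewrite finset.eqEsubset bE andbT; apply/fintype.subsetP => x xE.
apply: contrapT => /negP xb.
have repr u := rep u x xE.
have neg y z : y \in b -> z \in b -> y != z -> (forall g,
    ev g x = ev g y * ev (D y) x + ev g z * ev (D z) x) ->
    0 < ev (D z) x.
  move=> yb zb yz hg; have [g [gy gE]] := cE y (bsub _ yb).
  have xy : x != y by apply/eqP => exy; rewrite exy yb in xb.
  have gx := gE x xE xy; have gz : ev g z < 0 by apply: gE; rewrite ?bsub // eq_sym.
  by rewrite hg gy mul0r add0r nmulr_rlt0 in gx.
have [g [gx gE]] := cE x xE.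
have gb y : y \in b -> ev g y < 0.
  by move=> yb; apply: gE; [exact: bsub|apply/eqP => eyx; rewrite -eyx yb in xb].
have [b0|b1|b2'] : [\/ #|b| = 0, #|b| = 1 | #|b| = 2]%N.
  by move: b2; case: #|b| => [|[|[|//]]] _; [apply: Or31|apply: Or32|apply: Or33].
- have /eqP b00 : b == finset.set0 by rewrite -cards_eq0 b0.
  by have := repr e; rewrite e1 b00 big_set0 => /eqP; rewrite oner_eq0.
- have /eqP/cards1P[y by'] := b1; have yb : y \in b by rewrite by' inE.
  have [g' [g'y g'E]] := cE y (bsub _ yb).
  have xy : x != y by apply/eqP => exy; rewrite exy yb in xb.
  by have := g'E x xE xy; rewrite repr by' big_set1 g'y mul0r ltxx.
- have /eqP/cards2P[y [z [yz byz]]] := b2'.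
  have yb : y \in b by rewrite byz !inE eqxx.
  have zb : z \in b by rewrite byz !inE eqxx orbT.
  have r2 g' : ev g' x = ev g' y * ev (D y) x + ev g' z * ev (D z) x.
    by rewrite [LHS]repr byz big_setU1 ?inE //= big_set1.
  have hz := neg y z yb zb yz r2.
  have hy : 0 < ev (D y) x.
    by apply: (neg z y zb yb); rewrite 1?eq_sym // => g'; rewrite r2 addrC.
  (* [x] is a combination of [y] and [z] with positive coefficients, yet [g] vanishes at [x] and is
     negative at both. *)
  have := r2 g; rewrite gx => /esym/eqP; rewrite lt_eqF //.
  have ty : ev g y * ev (D y) x < 0 by rewrite nmulr_rlt0 ?gb.
  have tz : ev g z * ev (D z) x < 0 by rewrite nmulr_rlt0 ?gb.
  by lra.
Qed.

Definition flag : finType := ({set X} * {set X})%type.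

Definition flags (CC : {set {set X}}) : {set flag} :=
  [set p | (p.1 \in CC) && (p.2 \in facets p.1)].

(* A flag (A, B) is a cell A with a facet B of it; tau pairs the flags, and pi p
   is the vertex map of the gluing of p, affine by glued_form. *)
Record glued (CC : {set {set X}}) (tau : flag -> flag) (pi : flag -> X -> X) :
    Prop := Glued {
  glued_spans : forall A, A \in CC -> spans A;
  glued_convpos : forall A, A \in CC -> convpos A;
  glued_sep : forall A A', A \in CC -> A' \in CC -> spans (A :&: A') -> A = A';
  glued_flag : forall p, p \in flags CC -> tau p \in flags CC;
  glued_inv : forall p, p \in flags CC -> tau (tau p) = p;
  glued_neq : forall p, p \in flags CC -> tau p != p;
  glued_map : forall p x, p \in flags CC -> x \in p.2 -> pi p x \in (tau p).2;
  glued_mapK : forall p x, p \in flags CC -> x \in p.2 ->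
    pi (tau p) (pi p x) = x;
  glued_form : forall p u, p \in flags CC ->
    exists u', forall x, x \in p.2 -> ev u' x = ev u (pi p x) }.

Definition compatible (CC : {set {set X}}) (tau : flag -> flag)
    (pi : flag -> X -> X) (H : {set X} -> X -> R) :=
  forall p, p \in flags CC -> exists a, forall x, x \in p.2 ->
    H p.1 x - H (tau p).1 (pi p x) = ev a x.

Section Heights.
Variables (CC : {set {set X}}) (tau : flag -> flag) (pi : flag -> X -> X).
Hypothesis gl : glued CC tau pi.

Lemma glued_card p : p \in flags CC -> #|(tau p).2| = #|p.2|.
Proof.
have le p' : p' \in flags CC -> (#|p'.2| <= #|(tau p').2|)%N.
  move=> pF; have inj : {in p'.2 &, injective (pi p')}.
    by move=> x y xp yp /(congr1 (pi (tau p'))); rewrite !(glued_mapK gl).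
  rewrite -(card_in_imset inj); apply/subset_leq_card/fintype.subsetP => y.
  by case/imsetP => x xp ->; exact: (glued_map gl pF xp).
move=> pF; apply/eqP; rewrite eqn_leq le // andbT -{2}(glued_inv gl pF).
by apply: le; exact: (glued_flag gl pF).
Qed.

Lemma flags_sum (g : flag -> nat) :
  (\sum_(p in flags CC) g p = \sum_(A in CC) \sum_(B in facets A) g (A, B))%N.
Proof.
rewrite pair_big_dep /=; apply: eq_big => [[A B]|[A B] _] //.
by rewrite inE.
Qed.

(* Twice the number of gluing conditions (|B| - 3 for each pair of flags) is
   less than twice the number of free heights (|A| - 4 for each A). *)
Lemma heights_ex : (exists2 A, A \in CC & (4 < #|A|)%N) ->
  exists H, compatible CC tau pi H /\
    exists2 A, A \in CC & ~ exists u, forall x, x \in A -> H A x = ev u x.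
Proof.
move=> [A0 A0C A04].
have /choice[b hb] : forall E, exists b : {set X}, [/\ b \subset E, indep b &
    forall u, ann b u -> ann E u] by move=> E; exact: base_ex.
have bsub E x : x \in b E -> x \in E.
  by case: (hb E) => /fintype.subsetP h _ _; exact: h.
have /choice[D hD] : forall Ey : {set X} * X, exists u, forall z, z \in b Ey.1 ->
    ev u z = (z == Ey.2)%:R.
  by move=> [E y]; case: (hb E) => _ ib _; exact: ib.
pose T : finType := ({set X} * X)%type; pose J : finType := (flag * X)%type.
(* Modulo linear forms the heights of [A] may be taken to vanish on the basis [b A], which leaves
   [#|A| - 4] unknowns. *)
pose U : {set T} := [set t : T | (t.1 \in CC) && (t.2 \in t.1 :\: b t.1)].
(* The ranks select one flag out of each glued pair, so that every gluing is counted once. *)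
pose fst_half (p : flag) := (p \in flags CC) && (enum_rank p < enum_rank (tau p))%N.
pose Q : {set J} := [set j : J | fst_half j.1 && (j.2 \in j.1.2 :\: b j.1.2)].
pose dd (p : flag) (h : T -> R) x := h (p.1, x) - h ((tau p).1, pi p x).
(* The deviation of the height difference at a point from its interpolation by the basis of the
   facet; if it vanishes at the [#|B| - 3] points off the basis, the difference is a linear form on
   the facet. *)
pose L (j : J) (h : T -> R) := dd j.1 h j.2 -
  \sum_(y in b j.1.2) dd j.1 h y * ev (D (j.1.2, y)) j.2.
have Llin j a h g : L j (fun t => a * h t + g t) = a * L j h + L j g.
  rewrite /L /dd mulrBr mulr_sumr addrACA -opprD -big_split /=; congr (_ - _).
    by ring.
  by apply: eq_bigr => y _; ring.
have cU : #|U| = (\sum_(A in CC) (#|A| - 4))%N.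
  rewrite -sum1_card (eq_bigr (fun A => \sum_(x in A :\: b A) 1)%N); last first.
    move=> A hAC; rewrite sum1_card cardsD; case: (hb A) => bA ib hA.
    rewrite (finset.setIidPr bA) (indep_spans_card ib) // => u /hA.
    exact: (glued_spans gl hAC).
  by rewrite pair_big_dep /=; apply: eq_bigl => [[A x]]; rewrite !inE.
have cQ : #|Q| = (\sum_(p | fst_half p) (#|p.2| - 3))%N.
  rewrite -sum1_card (eq_bigr (fun p : flag => \sum_(x in p.2 :\: b p.2) 1)%N); last first.
    move=> p /andP[pF _]; rewrite sum1_card cardsD; case: (hb p.2) => bA ib hA.
    rewrite (finset.setIidPr bA); move: pF; rewrite inE => /andP[_ /facetsP [f F]].
    have [_ _ f0 Bf] := F.
    have bf : ann (b p.2) f by move=> x /bsub; exact: facet_ann F _.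
    by case: (indep_line_card ib f0 bf (fun u hu => Bf u (hA u hu))) => ->.
  by rewrite pair_big_dep /=; apply: eq_bigl => [[p x]]; rewrite !inE.
have half : (\sum_(p in flags CC) (#|p.2| - 3) = 2 * #|Q|)%N.
  rewrite cQ (bigID (fun p : flag => enum_rank p < enum_rank (tau p))%N) /= mul2n -addnn.
  congr (_ + _)%N.
  rewrite (reindex_onto tau tau) /=; last by move=> p /andP[pF _]; exact: (glued_inv gl pF).
  apply: eq_big => [p|p /andP[/andP[h1 _] /eqP h2]].
    rewrite /fst_half; apply/idP/idP.
      move=> /andP[/andP[h1 h2] /eqP h3].
      have pF : p \in flags CC by rewrite -h3; exact: (glued_flag gl h1).
      rewrite pF h3 -leqNgt in h2 *; rewrite ltn_neqAle h2 andbT /=.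
      apply/negP => /eqP /val_inj /enum_rank_inj /esym/eqP; apply/negP;
          exact: (glued_neq gl pF).
    move=> /andP[pF h]; rewrite (glued_flag gl pF) (glued_inv gl pF) eqxx andbT -leqNgt.
    exact: ltnW.
  by rewrite -(glued_card h1) h2.
have QU : (#|Q| < #|U|)%N.
  rewrite -(ltn_pmul2l (isT : (0 < 2)%N)) -half cU flags_sum big_distrr /=.
  rewrite (bigD1 A0) //= [X in (_ < X)%N](bigD1 A0) //= -addSn.
  have cA A : A \in CC -> _ := fun hAC => facets_sum_sub3 (glued_convpos gl hAC)
      (glued_spans gl hAC).
  apply: leq_add; first by case: (cA A0 A0C) => _ /(_ A04).
  by apply: leq_sum => A /andP[hAC _]; case: (cA A hAC).
have [h [hU [t ht] hQ]] := linear_system_ex Llin QU.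
exists (fun A x => h (A, x)); split.
  have half_compat p : fst_half p -> exists a, forall x, x \in p.2 -> dd p h x = ev a x.
    move=> pF; exists (\sum_(y in b p.2) dd p h y *: D (p.2, y)) => x xp.
    rewrite /ev dot_suml; case: (boolP (x \in b p.2)) => xb.
      rewrite (big_setD1 x) //= dotZl -/(ev _ x) hD //= eqxx mulr1 big1 ?addr0 // => y.
      by rewrite !inE => /andP[yx yb]; rewrite dotZl -/(ev _ x) hD //= eq_sym (negbTE yx) mulr0.
    have := hQ (p, x); rewrite inE /= pF inE xb xp => /(_ isT) /eqP.
    rewrite /L /= subr_eq0 => /eqP ->; by apply: eq_bigr => y _; rewrite dotZl.
  move=> p pF; case: (ltngtP (enum_rank p) (enum_rank (tau p))) => pt.
  - by apply: half_compat; rewrite /fst_half pF.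
  - have [|a ha] := half_compat (tau p).
      by rewrite /fst_half (glued_flag gl pF) (glued_inv gl pF).
    have [a' ha'] := glued_form gl a pF; exists (- a') => x xp.
    rewrite evN ha' // -ha ?(glued_map gl) // /dd (glued_inv gl pF) (glued_mapK gl) //.
    by rewrite opprB.
  - by have := glued_neq gl pF; rewrite -(enum_rank_inj (val_inj pt)) eqxx.
have tU : t \in U by apply: contraNT ht => /hU ->.
move: tU ht; case: t => A x; rewrite inE /= => /andP[hAC]; rewrite inE => /andP[xb xA] hx.
exists A => // -[u hu]; case: (hb A) => _ _ hA.
(* A form inducing the heights of [A] vanishes on [b A], hence is zero, against the nonzero height
   at [x]. *)
have : u = 0.
  apply: (glued_spans gl hAC); apply: hA => y yb; rewrite -(hu y (bsub _ _ yb)).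
  by apply: hU; rewrite inE /= inE yb andbF.
by move=> u0; rewrite hu // u0 ev0 eqxx in hx.
Qed.

End Heights.

(** * Refinement and induction *)

Lemma spans4_indep T : spans T -> #|T| = 4%N -> indep T.
Proof.
move=> sT T4; have [b [bT ib hb]] := base_ex q T.
suff -> : T = b by [].
apply/esym/eqP; rewrite finset.eqEcard bT T4.
by rewrite (indep_spans_card ib) // => u /hb; exact: sT.
Qed.

(** The sum of the points of [E] lies in the cone of some [T], and then in that of [T :&: E]. Its
    coordinates in the independent set [E] are all 1, so no point of [E] is missing from [T]. *)
Lemma indep_face_covered (D : {set {set X}}) C E g :
  (forall T, T \in D -> T \subset C) ->
  (forall y, cone C y -> exists2 T, T \in D & cone T y) ->
  (forall x, x \in C -> ev g x <= 0) -> E = [set x in C | ev g x == 0] ->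
  indep E -> exists2 T, T \in D & E \subset T.
Proof.
move=> DC Dcov gC eE iE.
have EC : E \subset C by rewrite eE; apply/fintype.subsetP => x; rewrite inE => /andP[].
pose y := \sum_(x in E) (1 : R) *: q x.
have Ey : cone E y by exists (fun=> 1); split=> // _; exact: ler01.
have [T TD Ty] := Dcov y (coneS EC Ey); exists T => //.
have [w [_ wy]] := cone_face gC eE (DC _ TD) Ty Ey.
apply/fintype.subsetP => x xE; apply: contrapT => /negP xT.
have : y = \sum_(z in E) (if z \in T :&: E then w z else 0) *: q z.
  rewrite wy [RHS](big_setID (T :&: E)) /= [X in _ + X]big1 ?addr0; last first.
    by move=> z; rewrite inE => /andP[/negbTE -> _]; rewrite scale0r.
  rewrite (finset.setIidPr (finset.subsetIr T E)); apply: eq_bigr => z zTE.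
  by rewrite zTE.
move/(indep_uniq iE)/(_ x xE); rewrite inE (negbTE xT) /=.
by move/eqP; rewrite oner_eq0.
Qed.

(** In the last clause an inclusion suffices: a tetrahedron has at most three vertices on a facet,
    so the inclusion of the vertices of a triangle is an equality. *)
Definition solved (CC : {set {set X}}) (tau : flag -> flag) (pi : flag -> X -> X)
    (D : {set X} -> {set {set X}}) :=
  [/\ forall A T, A \in CC -> T \in D A -> [/\ T \subset A, spans T & #|T| = 4%N],
    forall A y, A \in CC -> cone A y -> exists2 T, T \in D A & cone T y,
    forall A T T' y, A \in CC -> T \in D A -> T' \in D A ->
      cone T y -> cone T' y -> cone (T :&: T') y &
    forall p T, p \in flags CC -> T \in D p.1 -> exists2 T', T' \in D (tau p).1 &
      forall x, x \in T -> x \in p.2 -> pi p x \in T'].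

(** * One subdivision step: the cells of the envelopes and their gluing *)

Section Step.
Variables (CC : {set {set X}}) (tau : flag -> flag) (pi : flag -> X -> X).
Variable H : {set X} -> X -> R.
Hypothesis gl : glued CC tau pi.
Hypothesis cH : compatible CC tau pi H.

Lemma flagsP (CC' : {set {set X}}) p :
  p \in flags CC' <-> p.1 \in CC' /\ facet p.1 p.2.
Proof.
rewrite inE; split=> [/andP[-> /facetsP]//|[-> h]]; exact/facetsP.
Qed.

(** Corrected by [a] and carried through the gluing, [l] supports the heights on the opposite facet
    exactly along the image of [C :&: p.2]. A large multiple of [f'], negative off that facet,
    pushes it strictly below the other heights, and it extends to a cell [C'] of which the image is
    a face. *)
Lemma transfer p C l : p \in flags CC -> cell_by p.1 (H p.1) C l ->
  exists C' l' g, [/\ cell_by (tau p).1 (H (tau p).1) C' l',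
    pi p @: (C :&: p.2) \subset C',
    forall x, x \in C' -> ev g x <= 0 &
    pi p @: (C :&: p.2) = [set x in C' | ev g x == 0]].
Proof.
move=> pF Cl; have tF := glued_flag gl pF.
have [hA [f F]] := (flagsP _ p).1 pF; have [hA' [f' F']] := (flagsP _ (tau p)).1 tF.
have [a ha] := cH pF.
have [v hv] := glued_form gl (l - a) tF.
set A := p.1 in hA F Cl ha *; set G := p.2 in F ha *.
set A' := (tau p).1 in hA' F' ha *; set G' := (tau p).2 in F' hv.
have tG x : x \in G' -> pi (tau p) x \in G.
  by move=> /(glued_map gl tF); rewrite (glued_inv gl pF).
have tK x : x \in G' -> pi p (pi (tau p) x) = x.
  by move=> /(glued_mapK gl tF); rewrite (glued_inv gl pF).
have [lA _ _] := Cl.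
have GA := fintype.subsetP (facet_sub F); have GA' := fintype.subsetP (facet_sub F').
have vE z : z \in G' -> H A' z - ev v z = H A (pi (tau p) z) - ev l (pi (tau p) z).
  by move=> zG; rewrite hv // evD evN -(ha _ (tG _ zG)) tK //; ring.
have vH z : z \in G' -> ev v z <= H A' z.
  by move=> zG; rewrite -subr_ge0 vE // subr_ge0 lA // GA // tG.
have [|M M0 hM] := large_M (S := A' :\: G') (a := ev f') (fun x => ev v x - H A' x).
  by move=> x; rewrite inE => /andP[xG xA]; exact: facet_lt F' xA xG.
pose l1 := v + M *: f'.
have l1G z : z \in G' -> ev l1 z = ev v z.
  by move=> zG; rewrite !evE (facet_ann F' zG) mulr0 addr0.
have l1lt z : z \in A' -> z \notin G' -> ev l1 z < H A' z.
  by move=> zA zG; have := hM z; rewrite inE zA zG !evE => /(_ isT); lra.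
have l1H z : z \in A' -> ev l1 z <= H A' z.
  move=> zA; case: (boolP (z \in G')) => zG; first by rewrite l1G // vH.
  exact/ltW/l1lt.
have l1eq z : z \in A' -> (ev l1 z == H A' z) = (z \in pi p @: (C :&: G)).
  move=> zA; apply/eqP/imsetP => [ez|[x + ->]].
    have zG : z \in G' by apply: contraT => /(l1lt z zA); rewrite ez ltxx.
    exists (pi (tau p) z); last by rewrite tK.
    rewrite inE tG // andbT; apply: (cell_in Cl); first by rewrite GA // tG.
    by apply/eqP; rewrite eq_sym -subr_eq0 -vE // -l1G // ez subrr.
  rewrite inE => /andP[xC xG]; have zG := glued_map gl pF xG.
  rewrite l1G //; apply/eqP; rewrite eq_sym -subr_eq0 vE // (glued_mapK gl) //.
  by rewrite (cell_eq Cl) // subrr.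
have [C' [l' [Cl' hC']]] := cell_extend (glued_spans gl hA') l1H.
have imG' z : z \in pi p @: (C :&: G) -> z \in A'.
  by case/imsetP => x; rewrite inE => /andP[_ xG] ->; apply: GA'; exact: (glued_map gl pF xG).
have imC' : pi p @: (C :&: G) \subset C'.
  by apply/fintype.subsetP => z zi; apply: hC'; [exact: imG'|apply/eqP; rewrite l1eq // imG'].
have CA' := fintype.subsetP (cell_sub Cl').
exists C', l', (l1 - l'); split=> //.
  by move=> x xC; rewrite evD evN (cell_eq Cl') // subr_le0 l1H // CA'.
apply/setP => z; rewrite [RHS]inE; case: (boolP (z \in C')) => zC /=; last first.
  by apply/negbTE; apply: contra zC; exact: (fintype.subsetP imC').
by rewrite evD evN (cell_eq Cl') // subr_eq0 l1eq // CA'.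
Qed.

(** A form vanishing on the image pulls back to a multiple of [f0], which vanishes on all of [p.2];
    hence it vanishes on the whole opposite facet and is a multiple of [f']. *)
Lemma transfer_facet p C l C' l' g : p \in flags CC ->
  cell_by p.1 (H p.1) C l -> cell_by (tau p).1 (H (tau p).1) C' l' ->
  pi p @: (C :&: p.2) = [set x in C' | ev g x == 0] ->
  facet C (C :&: p.2) -> facet C' (pi p @: (C :&: p.2)).
Proof.
move=> pF Cl Cl' eg [f0 F0]; have tF := glued_flag gl pF.
have [hA [f F]] := (flagsP _ p).1 pF; have [hA' [f' F']] := (flagsP _ (tau p)).1 tF.
have [_ _ f0n B0] := F0; have [fA' _ f'n B'] := F'; have [_ _ fn _] := F.
have CA' := fintype.subsetP (cell_sub Cl').
have [c ec] : exists c, f = c *: f0.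
  by apply: B0 => x; rewrite inE => /andP[_]; exact: (facet_ann F).
have c0 : c != 0 by apply: contra fn => /eqP cz; rewrite ec cz scale0r.
have f0G x : x \in p.2 -> ev f0 x = 0.
  move=> /(facet_ann F); rewrite ec evZ => /eqP.
  by rewrite mulf_eq0 (negbTE c0) => /eqP.
have tK x : x \in (tau p).2 -> pi p (pi (tau p) x) = x.
  by move=> /(glued_mapK gl tF); rewrite (glued_inv gl pF).
have tG x : x \in (tau p).2 -> pi (tau p) x \in p.2.
  by move=> /(glued_map gl tF); rewrite (glued_inv gl pF).
have annB u : ann (pi p @: (C :&: p.2)) u -> exists c, u = c *: f'.
  move=> hu; have [u' hu'] := glued_form gl u pF.
  have [d ed] : exists d, u' = d *: f0.
    apply: B0 => x xE; rewrite hu'; last by move: xE; rewrite inE => /andP[].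
    by apply: hu; apply: imset_f.
  apply: B' => z zG; rewrite -(tK z zG) -hu' ?tG // ed evZ f0G ?tG //.
  by rewrite mulr0.
exists f'; split=> //; first by move=> x /CA' /fA'.
apply/setP => z; rewrite [RHS]inE; apply/idP/andP.
  move=> zi; split; first by move: zi; rewrite eg inE => /andP[].
  case/imsetP: zi => x; rewrite inE => /andP[_ xG] ->.
  by apply/eqP; apply: (facet_ann F'); exact: (glued_map gl pF xG).
move=> [zC /eqP zf]; rewrite eg inE zC /=.
have [d ->] : exists c, g = c *: f'.
  by apply: annB => x; rewrite eg inE => /andP[_ /eqP].
by rewrite evZ zf mulr0.
Qed.

Definition cells A : {set {set X}} := [set C | `[< cell A (H A) C >]].

Lemma cellsP A C : C \in cells A <-> cell A (H A) C.
Proof. by rewrite inE; split=> /asboolP. Qed.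

Definition refined : {set {set X}} := \bigcup_(A in CC) cells A.

Lemma refinedP C : C \in refined <-> exists2 A, A \in CC & cell A (H A) C.
Proof.
split=> [/finset.bigcupP[A hA /cellsP]|[A hA /cellsP hC]]; first by exists A.
by apply/finset.bigcupP; exists A.
Qed.

Lemma parent_uniq A A' C : A \in CC -> A' \in CC -> cell A (H A) C ->
  cell A' (H A') C -> A = A'.
Proof.
move=> hA hA' [l Cl] [l' Cl']; apply: (glued_sep gl hA hA').
have [_ _ sC] := Cl; apply: spansS sC; rewrite finset.subsetI.
by rewrite (cell_sub Cl) (cell_sub Cl').
Qed.

(** A facet of a cell either lies in a facet [G] of its parent and follows the gluing of [G], or is
    an interior wall between two cells of the parent. A relation is used so that existence,
    uniqueness and symmetry can be proved apart; together they make the chosen partner an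
    involution. *)
Definition wall_glue A (p p' : flag) (m : X -> X) :=
  (exists G, [/\ facet A G, p.2 \subset G, m = pi (A, G),
     cell (tau (A, G)).1 (H (tau (A, G)).1) p'.1 &
     facet p'.1 p'.2 /\ p'.2 = m @: p.2]) \/
  [/\ forall G, facet A G -> ~~ (p.2 \subset G), cell A (H A) p'.1, p'.1 != p.1,
    facet p'.1 p'.2 & p'.2 = p.2 /\ m = id].

Definition glue (p p' : flag) (m : X -> X) :=
  exists A, [/\ A \in CC, cell A (H A) p.1 & wall_glue A p p' m].

Lemma glue_ex p : p \in flags refined -> exists pm : flag * (X -> X), glue p pm.1 pm.2.
Proof.
move=> /flagsP[/refinedP[A hA cC] FB].
case: (pselect (exists G, facet A G /\ p.2 \subset G)) => [[G [FG BG]]|nG].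
  have pF : (A, G) \in flags CC by apply/flagsP.
  have [l Cl] := cC; have [f F] := FB.
  have eB := facet_cell_cap FG BG cC F.
  have [C' [l' [g [Cl' sub gC eg]]]] := transfer pF Cl.
  exists ((C', pi (A, G) @: p.2), pi (A, G)); exists A; split=> //; left.
  exists G; split=> //=; first by exists l'.
  split=> //; rewrite eB; apply: (transfer_facet pF Cl Cl' eg).
  by rewrite -eB.
have [f F] := FB.
(* If all of [A] were on one side of [f], the wall would lie in a facet of [A]. *)
have [x xA xf] : exists2 x, x \in A & 0 < ev f x.
  apply: contrapT => nx; apply: nG; exists [set x in A | ev f x == 0].
  have [l Cl] := cC; have [_ _ f0 Bf] := F.
  have BG : p.2 \subset [set x in A | ev f x == 0].
    apply/fintype.subsetP => x xB; rewrite inE (facet_ann F xB) eqxx andbT.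
    by rewrite (fintype.subsetP (cell_sub Cl)) // (fintype.subsetP (facet_sub F) _ xB).
  split=> //; exists f; split=> //.
    by move=> x xA; rewrite leNgt; apply/negP => xf; apply: nx; exists x.
  by move=> u hu; apply: Bf => x /(fintype.subsetP BG); exact: hu.
have [C' [cC' nC F']] : exists C', [/\ cell A (H A) C', C' != p.1 & facet_by C' p.2 (- f)].
  by apply: (wall_cross cC F); exists x.
exists ((C', p.2), id); exists A; split=> //; right; split=> //=.
  by move=> G FG; apply/negP => BG; apply: nG; exists G.
by exists (- f).
Qed.

Lemma glue_uniq p p' p'' m m' : p \in flags refined ->
  glue p p' m -> glue p p'' m' -> p' = p'' /\ m = m'.
Proof.
move=> /flagsP[_ FB] [A [hA cC W]] [A2 [hA2 cC2 W2]].
have eA := parent_uniq hA2 hA cC2 cC; rewrite {A2 hA2 cC2}eA in W2.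
have sA := glued_spans gl hA.
have [f F] := FB; have [_ _ _ Bf] := F.
case: W => [[G [FG BG em cC' [FB' eB']]]|[nG cC' nC FB' [eB' em]]];
  case: W2 => [[G2 [FG2 BG2 em2 cC2 [FB2 eB2]]]|[nG2 cC2 nC2 FB2 [eB2 em2]]].
- have eG : G2 = G.
    by apply: (facet_uniq sA FG2 FG _ BG2 BG); exists f; exact: Bf.
  rewrite {G2 FG2 BG2}eG in em2 cC2.
  have emm : m = m' by rewrite em em2.
  split=> //; rewrite [p']surjective_pairing [p'']surjective_pairing.
  have eBB : p'.2 = p''.2 by rewrite eB' eB2 emm.
  congr (_, _) => //.
  have pF : (A, G) \in flags CC by apply/flagsP.
  have [_ FG'] := (flagsP _ _).1 (glued_flag gl pF).
  apply: (boundary_cell_uniq FG' _ cC' cC2 FB').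
    apply/fintype.subsetP => z; rewrite eB' em => /imsetP[x xB ->].
    exact: (glued_map gl pF (fintype.subsetP BG _ xB)).
  by rewrite eBB; have [f2 F2] := FB2; exact: facet_sub F2.
- by have := nG2 G FG; rewrite BG.
- by have := nG G2 FG2; rewrite BG2.
- split; last by rewrite em em2.
  rewrite [p']surjective_pairing [p'']surjective_pairing; congr (_, _); last by rewrite eB' eB2.
  rewrite eB' in FB'; rewrite eB2 in FB2.
  exact: (wall_uniq cC cC' cC2 FB FB' FB2 nC nC2).
Qed.

Lemma glue_flag p p' m : glue p p' m -> p' \in flags refined.
Proof.
move=> [A [hA cC W]]; apply/flagsP.
case: W => [[G [FG BG em cC' [FB' eB']]]|[nG cC' nC FB' [eB' em]]].
  split=> //; have pF : (A, G) \in flags CC by apply/flagsP.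
  apply/refinedP; exists (tau (A, G)).1 => //.
  by have [] := (flagsP _ _).1 (glued_flag gl pF).
by split=> //; apply/refinedP; exists A.
Qed.

Lemma glue_map p p' m x : glue p p' m -> x \in p.2 -> m x \in p'.2.
Proof.
move=> [A [hA cC [[G [FG BG em cC' [FB' eB']]]|[nG cC' nC FB' [eB' em]]]]] xB.
  by rewrite eB'; exact: imset_f.
by rewrite eB' em.
Qed.

Lemma glue_form p p' m u : glue p p' m ->
  exists u', forall x, x \in p.2 -> ev u' x = ev u (m x).
Proof.
move=> [A [hA cC [[G [FG BG em cC' [FB' eB']]]|[nG cC' nC FB' [eB' em]]]]]; last first.
  by exists u; rewrite em.
have pF : (A, G) \in flags CC by apply/flagsP.
have [u' hu'] := glued_form gl u pF; exists u' => x /(fintype.subsetP BG) xG.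
by rewrite em hu'.
Qed.

(** If a piece of a facet [G] were glued to itself, [G] would be glued to itself as well. *)
Lemma glue_neq p p' m : p \in flags refined -> glue p p' m -> p' != p.
Proof.
move=> /flagsP[_ FB].
move=> [A [hA cC [[G [FG BG em cC' [FB' eB']]]|[nG cC' nC FB' [eB' em]]]]]; last first.
  by apply: contra nC => /eqP ->.
apply/eqP => ep; rewrite ep in cC' FB' eB'.
have pF : (A, G) \in flags CC by apply/flagsP.
have tF := glued_flag gl pF.
have [hA' FG'] := (flagsP _ _).1 tF.
have eA := parent_uniq hA' hA cC' cC.
have [f F] := FB; have [_ _ _ Bf] := F.
have eG : (tau (A, G)).2 = G.
  rewrite eA in FG'; apply: (facet_uniq (glued_spans gl hA) FG' FG _ _ BG); first by exists f.
  apply/fintype.subsetP => z; rewrite eB' em => /imsetP[x xB ->].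
  exact: (glued_map gl pF (fintype.subsetP BG _ xB)).
by have := glued_neq gl pF; rewrite [tau _]surjective_pairing eA eG eqxx.
Qed.

Lemma glue_sym p p' m : p \in flags refined -> glue p p' m ->
  exists2 m', glue p' p m' & forall x, x \in p.2 -> m' (m x) = x.
Proof.
move=> /flagsP[_ FB].
move=> [A [hA cC [[G [FG BG em cC' [FB' eB']]]|[nG cC' nC FB' [eB' em]]]]]; last first.
  exists id; last by rewrite em.
  exists A; split=> //; right; split=> //; [by rewrite eB'|by rewrite eq_sym].
have pF : (A, G) \in flags CC by apply/flagsP.
have tF := glued_flag gl pF; have [hA' FG'] := (flagsP _ _).1 tF.
have mK x : x \in p.2 -> pi (tau (A, G)) (m x) = x.
  by move=> /(fintype.subsetP BG) xG; rewrite em (glued_mapK gl pF xG).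
exists (pi (tau (A, G))) => //.
exists (tau (A, G)).1; split=> //; left; exists (tau (A, G)).2.
rewrite -surjective_pairing (glued_inv gl pF); split=> //=.
  apply/fintype.subsetP => z; rewrite eB' em => /imsetP[x xB ->].
  exact: (glued_map gl pF (fintype.subsetP BG _ xB)).
split=> //; rewrite eB' -imset_comp; apply/setP => z; apply/idP/imsetP => [zB|[x xB ->]].
  by exists z => //=; rewrite mK.
by rewrite /= mK.
Qed.

Lemma refined_glued : exists tau' pi', glued refined tau' pi' /\
  forall p, p \in flags refined -> glue p (tau' p) (pi' p).
Proof.
have /choice[pm hpm] : forall p, exists pm : flag * (X -> X),
    p \in flags refined -> glue p pm.1 pm.2.
  move=> p; case: (boolP (p \in flags refined)) => pF; last by exists (p, id).
  by have [pm h] := glue_ex pF; exists pm.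
exists (fun p => (pm p).1), (fun p => (pm p).2); split=> //.
have tF p : p \in flags refined -> (pm p).1 \in flags refined.
  by move=> pF; exact: glue_flag (hpm p pF).
have back p : p \in flags refined -> (pm (pm p).1).1 = p /\
    forall x, x \in p.2 -> (pm (pm p).1).2 ((pm p).2 x) = x.
  move=> pF; have [m' hm' mK] := glue_sym pF (hpm p pF).
  by have [-> ->] := glue_uniq (tF p pF) (hpm _ (tF p pF)) hm'.
split.
- by move=> C /refinedP[A _ [l []]].
- move=> C /refinedP[A hA [l Cl]]; exact: convposS (cell_sub Cl) (glued_convpos gl hA).
- move=> C C' /refinedP[A hA [l Cl]] /refinedP[A' hA' [l' Cl']] s.
  have eA : A = A'.
    apply: (glued_sep gl hA hA'); apply: spansS s.
    by apply: finset.setISS; [exact: cell_sub Cl|exact: cell_sub Cl'].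
  by rewrite -eA in Cl'; exact: cell_spansI Cl Cl' s.
- exact: tF.
- by move=> p /back[].
- by move=> p pF; exact: glue_neq (hpm p pF).
- by move=> p x pF; exact: glue_map (hpm p pF).
- by move=> p x /back[_ h]; exact: h.
- by move=> p u pF; exact: glue_form (hpm p pF).
Qed.

(** Cells meeting in codimension one are glued there by the identity, so a solution of the refined
    system automatically agrees on their common wall. *)
Lemma cell_wall A C C' : A \in CC -> C \in cells A -> C' \in cells A -> C != C' ->
  facet C (C :&: C') -> glue (C, C :&: C') (C', C :&: C') id.
Proof.
move=> hA /cellsP cC /cellsP cC' nC F; exists A; split=> //; right; split=> //=.
- move=> G FG; apply/negP => BG; case/eqP: nC.
  exact: (boundary_cell_uniq FG BG cC cC' F (finset.subsetIr _ _)).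
- by rewrite eq_sym.
- have [l Cl] := cC; have [l' Cl'] := cC'.
  exists (l - l'); split; first exact: cell_sub_le Cl' Cl.
  + by rewrite finset.setIC; exact: cellI Cl' Cl.
  + rewrite subr_eq0; apply: contra nC => /eqP ell; rewrite -ell in Cl'.
    by rewrite (cell_by_inj Cl Cl').
  + have [f [_ _ _ Bf]] := F; have [c ec] : exists c, l - l' = c *: f.
      apply: Bf => x; rewrite inE => /andP[xC xC'].
      by rewrite evD evN (cell_eq Cl) // (cell_eq Cl') // subrr.
    move=> u /Bf[d ->].
    have c0 : c != 0.
      apply: contra nC => /eqP c0; move: ec; rewrite c0 scale0r => /eqP.
      by rewrite subr_eq0 => /eqP ell; rewrite -ell in Cl'; rewrite (cell_by_inj Cl Cl').
    by exists (d / c); rewrite ec scalerA divfK.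
Qed.

(** Two points need an argument: tetrahedra in different cells of one parent, and matching across a
    facet of the parent. In both, [face_dichotomy] applies to the common face: if it has codimension
    one, the refined gluing matches the tetrahedra; otherwise it is independent and
    [indep_face_covered] puts all of it into one tetrahedron of the other side. *)
Lemma solved_coarsen tau' pi' D' :
  (forall p, p \in flags refined -> glue p (tau' p) (pi' p)) ->
  solved refined tau' pi' D' ->
  solved CC tau pi (fun A => \bigcup_(C in cells A) D' C).
Proof.
move=> hg [Da Db Dc Dd].
have rC A C : A \in CC -> C \in cells A -> C \in refined.
  by move=> hA /cellsP cC; apply/refinedP; exists A.
have DS A C T : A \in CC -> C \in cells A -> T \in D' C -> T \subset C.
  by move=> hA hC hT; case: (Da C T (rC A C hA hC) hT).
have across p p' m T : p \in flags refined -> glue p p' m -> T \in D' p.1 ->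
    exists2 T', T' \in D' p'.1 & forall x, x \in T -> x \in p.2 -> m x \in T'.
  move=> pF g hT; have [<- <-] := glue_uniq pF (hg p pF) g; exact: Dd.
split.
- move=> A T hA /finset.bigcupP[C hC hT]; have [TC sT T4] := Da C T (rC A C hA hC) hT.
  split=> //; apply: (fintype.subset_trans TC); by case/cellsP: hC => l /cell_sub.
- move=> A y hA /(cell_cover (H A) e1 (glued_spans gl hA))[C cC Cy].
  have hC : C \in cells A by apply/cellsP.
  have [T hT Ty] := Db C y (rC A C hA hC) Cy.
  by exists T => //; apply/finset.bigcupP; exists C.
- move=> A T T' y hA /finset.bigcupP[C hC hT] /finset.bigcupP[C' hC' hT'] Ty Ty'.
  have [eC|nC] := eqVneq C C'.
    by rewrite -eC in hT'; exact: (Dc C T T' y (rC A C hA hC)).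
  have TC := DS A C T hA hC hT; have TC' := DS A C' T' hA hC' hT'.
  have cC := (cellsP A C).1 hC; have cC' := (cellsP A C').1 hC'.
  have [l Cl] := cC; have [l' Cl'] := cC'.
  have Ey := cellI_cone cC cC' (coneS TC Ty) (coneS TC' Ty').
  have f0 : l' - l != 0.
    rewrite subr_eq0; apply: contra nC => /eqP ell; rewrite ell in Cl'.
    by rewrite (cell_by_inj Cl Cl').
  have TEy := cone_face (cell_sub_le Cl Cl') (cellI Cl Cl') TC Ty Ey.
  (* A tetrahedron [T2] of [C'] containing the vertices of [T] on the common face stands in for [T],
     so that the intersection with [T'] is taken inside [C']. *)
  have [T2 hT2 sub] : exists2 T2, T2 \in D' C' & T :&: (C :&: C') \subset T2.
    have annf : ann (C :&: C') (l' - l).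
      move=> x; rewrite inE => /andP[xC xC'].
      by rewrite evD evN (cell_eq Cl) // (cell_eq Cl') // subrr.
    case: (face_dichotomy (convposS (cell_sub Cl) (glued_convpos gl hA))
        (finset.subsetIl C C') f0 annf) => [Bf|iE].
      have F : facet C (C :&: C').
        exists (l' - l); split=> //; [exact: cell_sub_le Cl Cl'|exact: cellI Cl Cl'].
      have pF : (C, C :&: C') \in flags refined.
        by apply/flagsP; split=> //=; exact: rC A C hA hC.
      have [T2 h2 s2] := across _ _ _ T pF (cell_wall hA hC hC' nC F) hT.
      by exists T2 => //; apply/fintype.subsetP => x; rewrite inE => /andP[xT xE]; exact: s2.
    have eE : C :&: C' = [set x in C' | ev (l - l') x == 0].
      by rewrite finset.setIC; exact: cellI Cl' Cl.
    have [T2 h2 s2] := indep_face_covered (fun T => DS A C' T hA hC')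
      (fun y => Db C' y (rC A C' hA hC')) (cell_sub_le Cl' Cl) eE iE.
    by exists T2 => //; apply: fintype.subset_trans s2; exact: finset.subsetIr.
  have [_ sT2 T24] := Da C' T2 (rC A C' hA hC') hT2.
  have T2y := Dc C' T2 T' y (rC A C' hA hC') hT2 hT' (coneS sub TEy) Ty'.
  have := cone_indepI (spans4_indep sT2 T24) sub (finset.subsetIl T2 T') TEy T2y.
  apply: coneS; apply/fintype.subsetP => x; rewrite !inE.
  by move=> /andP[/andP[-> _] /andP[_ ->]].
- move=> p T pF /finset.bigcupP[C hC hT].
  have [hA FG] := (flagsP _ p).1 pF; have [hA' FG'] := (flagsP _ _).1 (glued_flag gl pF).
  have cC := (cellsP p.1 C).1 hC; have [l Cl] := cC.
  have TC := DS p.1 C T hA hC hT.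
  have [C' [l' [g [Cl' sub gC eg]]]] := transfer pF Cl.
  have hC' : C' \in cells (tau p).1 by apply/cellsP; exists l'.
  have [f F] := FG; have [fA _ f0 _] := F.
  have CA := fintype.subsetP (cell_sub Cl).
  have annf : ann (C :&: p.2) f by move=> x; rewrite inE => /andP[_]; exact: (facet_ann F).
  suff [T2 h2 s2] : exists2 T2, T2 \in D' C' &
      forall x, x \in T -> x \in C :&: p.2 -> pi p x \in T2.
    exists T2; first by apply/finset.bigcupP; exists C'.
    by move=> x xT xG; apply: s2 => //; rewrite inE xG (fintype.subsetP TC).
  case: (face_dichotomy (convposS (cell_sub Cl) (glued_convpos gl hA))
      (finset.subsetIl C p.2) f0 annf) => [Bf|iE].
    have FB : facet C (C :&: p.2).
      exists f; split=> //; first by move=> x /CA /fA.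
      apply/setP => x; rewrite !inE; case: (boolP (x \in C)) => //= /CA xA.
      by case: F => _ -> _ _; rewrite inE xA.
    have FB' := transfer_facet pF Cl Cl' eg FB.
    have pF' : (C, C :&: p.2) \in flags refined.
      by apply/flagsP; split=> //=; exact: rC p.1 C hA hC.
    have G : glue (C, C :&: p.2) (C', pi p @: (C :&: p.2)) (pi p).
      exists p.1; split=> //; left; exists p.2; rewrite -surjective_pairing.
      by split=> //=; [exact: finset.subsetIr|exists l'].
    exact: (across _ _ _ T pF' G hT).
  have iE' : indep (pi p @: (C :&: p.2)).
    move=> h; have [u hu] := iE (fun x => h (pi p x)).
    have [v hv] := glued_form gl u (glued_flag gl pF).
    exists v => _ /imsetP[x xE ->]; have xG : x \in p.2 by move: xE; rewrite inE => /andP[].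
    by rewrite hv ?(glued_map gl pF xG) // (glued_mapK gl pF xG) hu.
  have [T2 h2 s2] := indep_face_covered (fun T => DS (tau p).1 C' T hA' hC')
    (fun y => Db C' y (rC (tau p).1 C' hA' hC')) gC eg iE'.
  by exists T2 => // x _ xE; apply: (fintype.subsetP s2); exact: imset_f.
Qed.

End Step.

(* The number of spanning subsets of cells drops at every proper subdivision. *)
Lemma glued_solved CC tau pi : glued CC tau pi -> exists D, solved CC tau pi D.
Proof.
pose W (CC : {set {set X}}) := [set T | `[< spans T >] && [exists A in CC, T \subset A]].
move: {2}#|W CC| (leqnn #|W CC|) => m; elim: m CC tau pi => [|m IH] CC tau pi Wm gl.
  exists (fun=> finset.set0); have nA A : A \in CC -> False.
    move=> hA; have : A \in W CC.
      rewrite inE (asboolT (glued_spans gl hA)) /=.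
      by apply/existsP; exists A; rewrite hA fintype.subxx.
    by move: Wm; rewrite leqn0 cards_eq0 => /eqP ->; rewrite inE.
  split=> [A T /nA//|A y /nA//|A T T' y /nA//|p T].
  by move=> /flagsP[/nA].
case: (pselect (exists2 A, A \in CC & (4 < #|A|)%N)) => [big|nbig]; last first.
  exists (fun A => [set A]); split.
  - move=> A T hA; rewrite inE => /eqP ->; split=> //; first exact: (glued_spans gl hA).
    apply/eqP; rewrite eqn_leq (spans_card4 (glued_spans gl hA)) andbT leqNgt.
    by apply/negP => h; apply: nbig; exists A.
  - by move=> A y hA Ay; exists A => //; rewrite inE.
  - by move=> A T T' y hA; rewrite !inE => /eqP -> /eqP ->; rewrite finset.setIid.
  - move=> p T pF; rewrite inE => /eqP ->; exists (tau p).1; first by rewrite inE.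
    move=> x _ xp; have [_ [f F]] := (flagsP _ _).1 (glued_flag gl pF).
    by apply: (fintype.subsetP (facet_sub F)); exact: (glued_map gl pF xp).
have [H [cH [A hA nlin]]] := heights_ex gl big.
have [tau' [pi' [gl' hg]]] := refined_glued gl cH.
have Wlt : (#|W (refined CC H)| <= m)%N.
  rewrite -ltnS; apply: leq_trans Wm; apply: proper_card; apply/fintype.properP; split.
    apply/fintype.subsetP => T; rewrite !inE => /andP[-> /existsP[C /andP[hC TC]]] /=.
    have [B hB [l Cl]] := (refinedP CC H C).1 hC.
    by apply/existsP; exists B; rewrite hB (fintype.subset_trans TC (cell_sub Cl)).
  (* [A] itself is lost: a cell containing it would have [A] as parent, and its form would induce
     the heights of [A]. *)
  exists A; rewrite inE (asboolT (glued_spans gl hA)) /=.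
    by apply/existsP; exists A; rewrite hA fintype.subxx.
  apply/negP => /existsP[C /andP[hC AC']].
  have [B hB [l Cl]] := (refinedP CC H C).1 hC.
  have AB := fintype.subset_trans AC' (cell_sub Cl).
  have eAB : A = B.
    apply: (glued_sep gl hA hB); rewrite (finset.setIidPl AB).
    exact: (glued_spans gl hA).
  apply: nlin; exists l => x xA; rewrite -eAB in Cl.
  by rewrite (cell_eq Cl) // (fintype.subsetP AC').
have [D' sD'] := IH _ _ _ Wlt gl'.
by exists (fun A => \bigcup_(C in cells H A) D' C); exact: solved_coarsen hg sD'.
Qed.

End Space.

(** * Convex hulls and faces in affine space *)

Section DotForm.
Local Open Scope ring_scope.
Variables (R : realFieldType) (n : nat).

(** Packaged as a linear map because [is_face] quantifies over bundled linear forms. *)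
Definition dot_form (v : 'rV[R]_n) (x : 'rV[R]_n) : R := dot v x.

Lemma dot_form_linear v : scalar (dot_form v).
Proof. by move=> a x y; rewrite /dot_form dotDr dotZr. Qed.

HB.instance Definition _ v :=
  GRing.isLinear.Build R 'rV[R]_n R (@GRing.mul R) (dot_form v) (dot_form_linear v).

End DotForm.

Section Hull.
Local Open Scope ring_scope.
Variables (R : realType).
Local Notation pt := 'rV[R]_3.

Definition homog (x : pt) : 'rV[R]_4 := row_mx (1%:M : 'M[R]_1) x.

Definition homog1 : 'rV[R]_4 := row_mx (1%:M : 'M[R]_1) (0 : 'rV[R]_3).

Lemma dot_row_mx (a c : 'rV[R]_1) (b d : pt) :
  dot (row_mx a b : 'rV[R]_4) (row_mx c d) = dot a c + dot b d.
Proof. by rewrite /dot (@tr_row_mx _ 1 1 3) (@mul_row_col _ 1 1 3 1) mxE. Qed.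

Lemma dot_homog1 x : dot homog1 (homog x) = 1.
Proof. by rewrite dot_row_mx dot0l addr0 /dot trmx1 mulmx1 mxE eqxx. Qed.

Lemma row4E (u : 'rV[R]_4) : exists c (b : pt), u = row_mx (c%:M : 'M[R]_1) b.
Proof.
exists (@lsubmx _ 1 1 3 u 0 0), (@rsubmx _ 1 1 3 u).
by rewrite -mx11_scalar (@hsubmxK _ 1 1 3 u).
Qed.

Lemma dot_homog c (b x : pt) : dot (row_mx (c%:M : 'M[R]_1) b) (homog x) = c + dot b x.
Proof. by rewrite dot_row_mx /dot trmx1 mulmx1 mxE eqxx mulr1n. Qed.

Lemma form_of_row (u : 'rV[R]_4) : exists (f : {scalar pt}) (c : R),
  forall x, dot u (homog x) = f x - c.
Proof.
have [c [b ->]] := row4E u.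
by exists (dot_form b : {scalar pt}), (- c) => x; rewrite dot_homog opprK addrC.
Qed.

Lemma row_of_form (f : {scalar pt}) (c : R) : exists u : 'rV[R]_4,
  forall x, dot u (homog x) = f x - c.
Proof.
exists (row_mx ((- c)%:M : 'M[R]_1) (\row_i f (delta_mx 0 i))) => x.
rewrite dot_homog addrC; congr (_ - _).
rewrite dotE [in RHS](row_sum_delta x) linear_sum; apply: eq_bigr => i _.
by rewrite linearZ mxE mulrC.
Qed.

Lemma homog_comb (X : finType) (A : {set X}) (w : X -> R) (p : X -> pt) :
  \sum_(x in A) w x *: homog (p x) =
  row_mx ((\sum_(x in A) w x)%:M : 'M[R]_1) (\sum_(x in A) w x *: p x).
Proof.
elim/big_rec3: _ => [|x a b c _ ->].
  by rewrite (scalemx0 : _) || by rewrite raddf0 (@row_mx0 _ 1 1 3).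
by rewrite /homog (@scale_row_mx _ 1 1 3) (@add_row_mx _ 1 1 3) raddfD /= scale_scalar_mx mulr1.
Qed.

(** The weights need no normalisation: the first coordinate 1 of [homog y] forces them to sum to
    1. *)
Definition hull (X : finType) (p : X -> pt) (A : {set X}) : set pt :=
  fun y => cone (fun x => homog (p x)) A (homog y).

Lemma hullP (X : finType) (p : X -> pt) (A : {set X}) y : hull p A y <->
  exists w : X -> R, [/\ forall x, 0 <= w x, \sum_(x in A) w x = 1 &
    y = \sum_(x in A) w x *: p x].
Proof.
split=> [[w [w0 e]]|[w [w0 w1 ->]]]; exists w; last first.
  by split=> //; rewrite homog_comb w1.
rewrite homog_comb in e; have [e1 e2] := @eq_row_mx _ 1 1 3 _ _ _ _ e; split=> //.
by have := congr1 (fun M : 'M[R]_1 => M 0 0) e1; rewrite !mxE eqxx !mulr1n.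
Qed.

Lemma hull_gen (X : finType) (p : X -> pt) (A : {set X}) x : x \in A -> hull p A (p x).
Proof. by move=> xA; exact: (cone_gen (fun x => homog (p x))). Qed.

Lemma conv_hull_hull (X : finType) (p : X -> pt) (A : {set X}) k (v : 'I_k -> X) :
  injective v -> (forall x, x \in A <-> exists i, v i = x) ->
  conv_hull (fun i => p (v i)) = hull p A.
Proof.
move=> vinj vA.
have e (V : nmodType) (F : X -> V) : \sum_(x in A) F x = \sum_i F (v i).
  rewrite (eq_bigl (mem (v @: [set: 'I_k]))) => [|x] /=; last first.
    apply/idP/imsetP => [/vA[i <-]|[i _ ->]]; first by exists i; rewrite ?inE.
    by apply/vA; exists i.
  rewrite big_imset /=; last by move=> ? ? _ _; exact: vinj.
  by apply: eq_bigl => i; rewrite inE.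
apply/seteqP; split=> y; last first.
  move=> /hullP[w [w0 w1 ->]]; exists (fun i => w (v i)).
  by split=> //; [rewrite -(e _ w)|rewrite -(e _ (fun x => w x *: p x))].
move=> [w [w0 w1 ->]]; apply/hullP.
exists (fun x => if [pick i | v i == x] is Some i then w i else 0).
have vK i : (if [pick j | v j == v i] is Some j then w j else 0) = w i.
  by case: pickP => [j /eqP /vinj -> //|/(_ i)]; rewrite eqxx.
split; first by move=> x; case: pickP.
  by rewrite e -[RHS]w1; apply: eq_bigr => i _; rewrite vK.
by rewrite e; apply: eq_bigr => i _; rewrite vK.
Qed.

Lemma aff_indepE k (v : 'I_k -> pt) : aff_indep v <->
  indep (fun i => homog (v i)) [set: 'I_k].
Proof.
split=> [hv|iv c c0 cv i].
  pose M : 'M[R]_(k, 4) := \matrix_i homog (v i).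
  have : row_free M.
    apply: inj_row_free => a; rewrite mulmx_sum_row => ea.
    have := homog_comb [set: 'I_k] (fun i => a 0 i) v.
    rewrite (eq_bigl predT) => [|i]; last by rewrite inE.
    rewrite (eq_bigr (fun i => a 0 i *: row i M)) => [|i _]; last by rewrite rowK.
    rewrite ea => /esym e; have e' : row_mx ((\sum_(x in [set: 'I_k]) a 0 x)%:M : 'M[R]_1)
       (\sum_(x in [set: 'I_k]) a 0 x *: v x) = row_mx (0 : 'M[R]_1) (0 : pt).
      by rewrite e (@row_mx0 _ 1 1 3).
    have [e1 e2] := @eq_row_mx _ 1 1 3 _ _ _ _ e'.
    apply/rowP => i; rewrite mxE; apply: (hv (fun i => a 0 i)).
      have h := congr1 (fun M : 'M[R]_1 => M 0 0) e1; rewrite !mxE eqxx mulr1n in h.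
      by rewrite -[RHS]h; apply: eq_bigl => j; rewrite inE.
    by rewrite -[RHS]e2; apply: eq_bigl => j; rewrite inE.
  case/row_freeP => N MN g; exists (N *m (\col_i g i))^T => i _.
  rewrite /ev dotC /dot trmxK mulmxA.
  have -> : homog (v i) *m N = row i (1%:M : 'M[R]_k) by rewrite -MN row_mul rowK.
  by rewrite row1 -rowE !mxE.
have [u hu] := iv (fun j => (j == i)%:R).
have e : \sum_(x in [set: 'I_k]) c x *: homog (v x) = 0.
  rewrite homog_comb (eq_bigl predT) ?c0; last by move=> j; rewrite inE.
  rewrite (eq_bigl predT) ?cv; last by move=> j; rewrite inE.
  by rewrite raddf0 (@row_mx0 _ 1 1 3).
have := congr1 (dot u) e; rewrite dot_sumr dot0r (bigD1 i) ?inE //= dotZr.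
rewrite -/(ev (fun i => homog (v i)) u i) hu ?inE // eqxx mulr1 big1 ?addr0 // => j /andP[_ ji].
by rewrite dotZr -/(ev (fun i => homog (v i)) u j) hu ?inE // (negbTE ji) mulr0.
Qed.

Section Points.
Variables (X : finType) (p : X -> pt).
Local Notation q := (fun x => homog (p x)).
Local Notation hull := (hull p).
Implicit Types (A B E T b : {set X}) (f g u : 'rV[R]_4).

Lemma ev_homog1 x : ev q homog1 x = 1.
Proof. exact: dot_homog1. Qed.

Lemma hullS A B : A \subset B -> (hull A `<=` hull B)%classic.
Proof. by move=> AB y; exact: coneS. Qed.

Lemma ann_hull A u y : ann q A u -> hull A y -> dot u (homog y) = 0.
Proof.
move=> Au [w [_ ->]]; rewrite (dot_cone (fun x => homog (p x))) big1 // => x xA.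
by rewrite Au // mulr0.
Qed.

Lemma indep_enum E k : indep q E -> #|E| = k -> exists v : 'I_k -> X,
  [/\ injective v, forall x, x \in E <-> exists i, v i = x & aff_indep (fun i => p (v i))].
Proof.
move=> iE kE; have castE : k = #|E| by [].
pose v (i : 'I_k) := enum_val (cast_ord castE i).
have vinj : injective v by move=> i j /enum_val_inj /cast_ord_inj.
have vE i : v i \in E by apply: enum_valP.
exists v; split=> //.
  move=> x; split=> [xE|[i <-]]; last exact: vE.
  exists (cast_ord (esym castE) (enum_rank_in xE x)).
  by rewrite /v cast_ordKV enum_rankK_in.
apply/aff_indepE => g.
have [u hu] := iE (fun x => if [pick i | v i == x] is Some i then g i else 0).
exists u => i _; rewrite -[LHS]/(ev q u (v i)) hu //.
by case: pickP => [j /eqP /vinj -> //|/(_ i)]; rewrite eqxx.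
Qed.

Lemma no_aff_indep4 E f : f != 0 -> ann q E f ->
  ~ (exists v : 'I_4 -> pt, aff_indep v /\ forall i, hull E (v i)).
Proof.
move=> f0 Ef [v [/aff_indepE iv vE]]; case/eqP: f0.
apply: (indep4_spans iv); first by rewrite cardsT card_ord.
by move=> i _; apply: ann_hull (vE i).
Qed.

Lemma aff_dim_hull E b f : b \subset E -> indep q b -> #|b| = 3 ->
  f != 0 -> ann q E f -> aff_dim (hull E) 2.
Proof.
move=> bE ib b3 f0 Ef; split; last exact: (no_aff_indep4 f0 Ef).
have [v [_ hv iv]] := indep_enum ib b3; exists (fun i => p (v i)); split=> // i.
by apply: hull_gen; apply: (fintype.subsetP bE); apply/hv; exists i.
Qed.

Lemma aff_dim_ann E f u : aff_dim (hull E) 2 -> f != 0 -> ann q E f ->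
  ann q E u -> exists c, u = c *: f.
Proof.
move=> [[v [/aff_indepE iv vE]] _] f0 Ef Eu.
apply: (indep_card_line iv f0); rewrite ?cardsT ?card_ord //.
  by move=> i _; apply: ann_hull (vE i).
by move=> i _; apply: ann_hull (vE i).
Qed.

Lemma aff_dim_card E : aff_dim (hull E) 2 -> (3 <= #|E|)%N.
Proof.
move=> [[v [/aff_indepE iv vE]] dimE]; rewrite leqNgt; apply/negP => E3.
have [f f0 hf] := @orthogonal_ex R 4 3 (fun i => homog (v i)) isT.
(* The lifted points of [E], padded with [f] by the default of [nth]. As [E] has fewer than three
   points, the last entry is [f], so [d] is orthogonal to [f] although it vanishes on [E]. *)
pose F (i : 'I_3) := nth f [seq q x | x <- enum E] i.
have [d d0 hd] := @orthogonal_ex R 4 3 F isT.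
have dE : ann q E d.
  move=> x xE; have xs : x \in enum E by rewrite mem_enum.
  have i3 : (index x (enum E) < 3)%N.
    by apply: leq_trans E3; rewrite ltnS cardE ltnW // index_mem.
  have := hd (Ordinal i3); rewrite /F /= (nth_map x) ?index_mem // nth_index //.
have df : dot d f = 0.
  have h := hd (@Ordinal 3 2 isT); rewrite /F nth_default in h; first by [].
  by rewrite size_map -cardE; exact: E3.
have [c ec] : exists c, d = c *: f.
  apply: (indep_card_line iv f0); rewrite ?cardsT ?card_ord //.
    by move=> i _; exact: hf.
  by move=> i _; apply: ann_hull (vE i).
have c0 : c != 0 by apply: contra d0 => /eqP c0; rewrite ec c0 scale0r.
move: df; rewrite ec dotZl => /eqP; rewrite mulf_eq0 (negbTE c0) /= dot_eq0.
exact/negP.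
Qed.

Lemma is_face_of_form P g (F : set pt) : (forall y, P y -> dot g (homog y) <= 0) ->
  (forall y, F y <-> P y /\ dot g (homog y) = 0) -> is_face P F.
Proof.
move=> gP hF; have [f [c hfc]] := form_of_row g; exists f, c; split.
  by move=> y /gP; rewrite hfc subr_le0.
apply/seteqP; split=> y.
  by move=> /hF[Py /eqP]; rewrite hfc subr_eq0 => /eqP fc; split.
by move=> [Py fc]; apply/hF; split=> //; rewrite hfc fc subrr.
Qed.

Lemma form_of_is_face P (F : set pt) : is_face P F -> exists g,
  (forall y, P y -> dot g (homog y) <= 0) /\ (forall y, F y <-> P y /\ dot g (homog y) = 0).
Proof.
move=> [f [c [fc ->]]]; have [g hg] := row_of_form f c; exists g; split.
  by move=> y /fc; rewrite hg subr_le0.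
move=> y; split=> [[Py /= e]|[Py /eqP]]; first by split=> //; rewrite hg e subrr.
by rewrite hg subr_eq0 => /eqP e; split.
Qed.

Lemma hull_facet A B g : (forall x, x \in A -> ev q g x <= 0) ->
  B = [set x in A | ev q g x == 0] ->
  forall y, hull B y <-> hull A y /\ dot g (homog y) = 0.
Proof.
move=> gA eB y; split=> [By|[Ay gy]].
  split; last by apply: ann_hull By => x; rewrite eB inE => /andP[_ /eqP].
  by apply: hullS By; rewrite eB; apply/fintype.subsetP => x; rewrite inE => /andP[].
by rewrite eB; exact: cone_tight.
Qed.

Lemma hull_sub_form A g y : (forall x, x \in A -> ev q g x <= 0) -> hull A y ->
  dot g (homog y) <= 0.
Proof. exact: cone_le0. Qed.

Lemma hull_convpos A T x : convpos q A -> T \subset A -> x \in A -> hull T (p x) -> x \in T.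
Proof.
move=> cA TA xA Tx; have [g [gx gA]] := cA x xA; apply: contraT => xT.
have gT z : z \in T -> ev q g z < 0.
  by move=> zT; apply: gA; [exact: (fintype.subsetP TA)|apply: contra xT => /eqP <-].
have := @cone_tight _ _ _ q g T (homog (p x)) (fun z zT => ltW (gT z zT)) Tx gx.
rewrite (_ : [set z in T | _] = finset.set0); last first.
  by apply/setP => z; rewrite !inE; apply/negP => /andP[/gT]; move=> h /eqP e;
      rewrite e ltxx in h.
move=> [w [_]]; rewrite big_set0 => e; have := dot_homog1 (p x).
by rewrite e dot0r => /eqP; rewrite eq_sym oner_eq0.
Qed.

Lemma hull1 x y : hull [set x] y -> y = p x.
Proof. by move=> /hullP[w [_]]; rewrite !big_set1 => -> ->; rewrite scale1r. Qed.

Lemma convpos_inj A : convpos q A -> {in A &, injective p}.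
Proof.
move=> cA x y xA yA exy.
have : hull [set y] (p x) by rewrite exy; apply: hull_gen; rewrite inE.
by move=> /(hull_convpos cA) => h; apply/set1P; apply: h; rewrite ?finset.sub1set.
Qed.

Lemma vertex_convpos A x : convpos q A -> x \in A -> is_vertex (hull A) (p x).
Proof.
move=> cA xA; have [g [gx gA]] := cA x xA.
have gA' z : z \in A -> ev q g z <= 0.
  by move=> zA; have [->|zx] := eqVneq z x; rewrite ?gx // ltW // gA.
apply: (is_face_of_form (g := g)); first by move=> y; exact: hull_sub_form.
move=> y; have eB : [set x] = [set z in A | ev q g z == 0].
  apply/setP => z; rewrite !inE; apply/eqP/andP => [->|[zA /eqP zg]].
    by rewrite xA gx eqxx.
  by apply: contrapT => /eqP zx; have := gA z zA zx; rewrite zg ltxx.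
rewrite -(hull_facet gA' eB); split=> [->|/hull1//].
by apply: hull_gen; rewrite inE.
Qed.

End Points.
End Hull.

(** * Affine maps on faces and their action on vertices *)

Section Affine.
Local Open Scope ring_scope.
Variables (R : realType).
Local Notation pt := 'rV[R]_3.
Implicit Types (F G : set pt) (phi psi : pt -> pt).

Definition convex_sub F := forall x y (t : R), F x -> F y -> 0 <= t <= 1 ->
  F (t *: x + (1 - t) *: y).

Lemma homog_comb2 (x y : pt) (t : R) :
  homog (t *: x + (1 - t) *: y) = t *: homog x + (1 - t) *: homog y.
Proof.
rewrite /homog !(@scale_row_mx _ 1 1 3) (@add_row_mx _ 1 1 3).
by rewrite -(scalerDl (1%:M : 'M[R]_1)) addrCA subrr addr0 scale1r.
Qed.

Lemma hull_convex (X : finType) (p : X -> pt) (A : {set X}) : convex_sub (hull p A).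
Proof.
move=> x y t [w [w0 ex]] [w' [w0' ey]] /andP[t0 t1].
exists (fun z => t * w z + (1 - t) * w' z); split.
  by move=> z; rewrite addr_ge0 ?mulr_ge0 ?subr_ge0.
rewrite homog_comb2 ex ey !scaler_sumr -big_split /=; apply: eq_bigr => z _.
by rewrite [RHS]scalerDl !scalerA.
Qed.

(** [affine_on] speaks of two points only; one point is split off and the other weights are rescaled
    by their sum [s], unless [s = 0], when all weight sits on that point. *)
Lemma affine_comb F phi (X : finType) (A : {set X}) (w : X -> R) (y : X -> pt) :
  convex_sub F -> affine_on F phi -> (forall x, 0 <= w x) ->
  \sum_(x in A) w x = 1 -> (forall x, x \in A -> F (y x)) ->
  F (\sum_(x in A) w x *: y x) /\
  phi (\sum_(x in A) w x *: y x) = \sum_(x in A) w x *: phi (y x).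
Proof.
move=> cF aF; elim: {A}#|A| {-2}A (erefl #|A|) w => [|m IH] A cA w w0 w1 yF.
  have /eqP A0 : A == finset.set0 by rewrite -cards_eq0 cA.
  by move: w1; rewrite A0 big_set0 => /esym/eqP; rewrite oner_eq0.
have [k kA] : exists k, k \in A by apply/card_gt0P; rewrite cA.
rewrite (big_setD1 k) //= in w1.
set s := \sum_(x in A :\ k) w x in w1.
have s0 : 0 <= s by apply: sumr_ge0.
have ks : s = 1 - w k by rewrite -w1 addrAC subrr add0r.
rewrite !(big_setD1 k kA) /=.
have [s00|sn] := eqVneq s 0.
  have wz x : x \in A :\ k -> w x = 0.
    move=> xA; move/eqP: s00; rewrite psumr_eq0 // => /allP /(_ x (mem_index_enum _)).
    by rewrite xA => /eqP.
  have wk : w k = 1 by rewrite -w1 s00 addr0.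
  rewrite !big1 ?addr0 ?wk ?scale1r; first by split=> //; exact: yF.
    by move=> x /wz ->; rewrite scale0r.
  by move=> x /wz ->; rewrite scale0r.
have cA' : #|A :\ k| = m by move: (cardsD1 k A); rewrite kA cA => -[].
have [|||hF hphi] := IH _ cA' (fun x => w x / s).
- by move=> x; rewrite divr_ge0.
- by rewrite -mulr_suml divff.
- by move=> x; rewrite !inE => /andP[_ /yF].
have e (z : X -> pt) : \sum_(x in A :\ k) w x *: z x =
    (1 - w k) *: \sum_(x in A :\ k) (w x / s) *: z x.
  by rewrite scaler_sumr; apply: eq_bigr => x _; rewrite scalerA -ks mulrC divfK.
have wk01 : 0 <= w k <= 1 by rewrite w0 -w1 lerDl.
rewrite !e -hphi; split; first by apply: cF => //; exact: yF.
by rewrite aF //; exact: yF.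
Qed.

Definition affine_bij F G phi := set_bij F G phi /\ affine_on F phi.

Lemma affine_bij_inv F G phi : convex_sub F -> affine_bij F G phi ->
  exists psi, [/\ affine_bij G F psi, forall x, F x -> psi (phi x) = x &
    forall y, G y -> phi (psi y) = y].
Proof.
move=> cF [[fG inj surj] aF].
have /choice[psi hpsi] : forall y, exists x, G y -> F x /\ phi x = y.
  move=> y; case: (pselect (G y)) => [Gy|nG]; last by exists 0.
  by have [x Fx e] := surj y Gy; exists x.
have inj' x y : F x -> F y -> phi x = phi y -> x = y.
  by move=> Fx Fy; apply: inj; rewrite inE.
have psiK x : F x -> psi (phi x) = x.
  by move=> Fx; have [h e] := hpsi _ (fG x Fx); exact: inj' e.
exists psi; split=> //; last by move=> y /hpsi[].
split; last first.
  move=> y z t Gy Gz t01; have [Fy ey] := hpsi y Gy; have [Fz ez] := hpsi z Gz.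
  rewrite -[RHS]psiK; last exact: cF.
  by rewrite aF // ey ez.
split.
- by move=> y /hpsi[].
- by move=> y z; rewrite !inE => Gy Gz e; have [_ <-] := hpsi y Gy; rewrite e;
    case: (hpsi z Gz).
- by move=> x Fx; exists (phi x); [exact: fG|exact: psiK].
Qed.

Section Vertices.
Variables (X : finType) (p : X -> pt).
Local Notation q := (fun x => homog (p x)).
Local Notation hull := (hull p).
Implicit Types (A B E T b : {set X}) (f g u : 'rV[R]_4).

(** The positive and the negative part of the dependency have the same total weight [S]. Divided by
    [S], they are two convex combinations giving the same point, at which [phi] is evaluated in both
    ways. *)
Lemma affine_dependency B phi (c : X -> R) : affine_on (hull B) phi ->
  \sum_(x in B) c x *: q x = 0 -> \sum_(x in B) c x *: homog (phi (p x)) = 0.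
Proof.
move=> aF e.
pose cp x := Num.max (c x) 0; pose cn x := Num.max (- c x) 0.
have cE x : c x = cp x - cn x.
  rewrite /cp /cn; case: (leP (c x) 0) => h1; case: (leP (- c x) 0) => h2; lra.
have cp0 x : 0 <= cp x by rewrite le_max lexx orbT.
have cn0 x : 0 <= cn x by rewrite le_max lexx orbT.
have e' : \sum_(x in B) cp x *: q x = \sum_(x in B) cn x *: q x.
  apply/eqP; rewrite -subr_eq0 -sumrB -[X in _ == X]e; apply/eqP; apply: eq_bigr => x _.
  by rewrite cE scalerBl.
set S := \sum_(x in B) cp x.
have eS : \sum_(x in B) cn x = S.
  have h (d : X -> R) : \sum_(x in B) d x = dot (homog1 R) (\sum_(x in B) d x *: q x).
    by rewrite (dot_cone q); apply: eq_bigr => x _; rewrite ev_homog1 mulr1.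
  by rewrite /S !h e'.
have [S0|Sn] := eqVneq S 0.
  rewrite big1 // => x xB; rewrite cE.
  have -> : cp x = 0.
    move/eqP: S0; rewrite psumr_eq0 // => /allP /(_ x (mem_index_enum _)).
    by rewrite xB => /eqP.
  have -> : cn x = 0.
    move/eqP: S0; rewrite -eS psumr_eq0 // => /allP /(_ x (mem_index_enum _)).
    by rewrite xB => /eqP.
  by rewrite subrr scale0r.
have S0 : 0 <= S by apply: sumr_ge0.
have comb (d : X -> R) (z : X -> pt) : \sum_(x in B)
    (d x / S) *: z x = S^-1 *: \sum_(x in B) d x *: z x.
  by rewrite scaler_sumr; apply: eq_bigr => x _; rewrite scalerA mulrC.
have comb1 (d : X -> R) : \sum_(x in B) d x = S -> \sum_(x in B) d x / S = 1.
  by move=> dS; rewrite -mulr_suml dS divff.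
have inB x : x \in B -> hull B (p x) by exact: hull_gen.
have [_ h1] := affine_comb (hull_convex (p := p) (A := B)) aF (fun x => divr_ge0 (cp0 x) S0)
  (comb1 cp (erefl _)) inB.
have [_ h2] := affine_comb (hull_convex (p := p) (A := B)) aF (fun x => divr_ge0 (cn0 x) S0)
  (comb1 cn eS) inB.
rewrite !comb in h1; rewrite !comb in h2.
have ep : \sum_(x in B) cp x *: p x = \sum_(x in B) cn x *: p x.
  by move: e'; rewrite !homog_comb => /(@eq_row_mx _ 1 1 3)[].
have eph : \sum_(x in B) cp x *: phi (p x) = \sum_(x in B) cn x *: phi (p x).
  apply: (scalerI (_ : S^-1 != 0)); first by rewrite invr_eq0.
  by rewrite -h1 -h2 ep.
rewrite (eq_bigr (fun x => cp x *: homog (phi (p x)) - cn x *: homog (phi (p x)))); last first.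
  by move=> x _; rewrite cE scalerBl.
rewrite sumrB !(homog_comb B _ (fun x => phi (p x))) eph eS.
by rewrite subrr.
Qed.

(** The form is prescribed on a basis [b] of [B]. Every other point of [B] is tied to [b] by a
    linear dependency, and [phi] preserves it. *)
Lemma affine_pullback B phi u : affine_on (hull B) phi ->
  exists u', forall x, x \in B -> ev q u' x = dot u (homog (phi (p x))).
Proof.
move=> aF; have [b [D [bB ib hb hD rep]]] := dual_base_ex q B.
exists (\sum_(z in b) dot u (homog (phi (p z))) *: D z) => x xB.
rewrite /ev dot_suml.
pose c z : R := (z == x)%:R - (if z \in b then ev q (D z) x else 0).
have cE (V : lmodType R) (h : X -> V) : \sum_(z in B) c z *: h z =
    h x - \sum_(z in b) ev q (D z) x *: h z.
  rewrite (eq_bigr (fun z => (z == x)%:R *: h z - (if z \in b then ev q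
      (D z) x else 0) *: h z)); last first.
    by move=> z _; rewrite scalerBl.
  rewrite sumrB; congr (_ - _).
    rewrite (big_setD1 x) //= eqxx scale1r big1 ?addr0 // => z.
    by rewrite !inE => /andP[/negbTE -> _]; rewrite scale0r.
  rewrite (big_setID b) /= [X in _ + X]big1 ?addr0; last first.
    by move=> z; rewrite inE => /andP[/negbTE -> _]; rewrite scale0r.
  by rewrite (finset.setIidPr bB); apply: eq_bigr => z ->.
have c0 : \sum_(z in B) c z *: q z = 0.
  rewrite cE; apply: dot_eq0P => v; rewrite dotC dotDr dotNr -/(ev q v x) (rep _ _ xB) dot_sumr.
  apply/eqP; rewrite subr_eq0; apply/eqP; apply: eq_bigr => z _.
  by rewrite dotZr mulrC.
have := affine_dependency aF c0; rewrite cE => /eqP; rewrite subr_eq0 => /eqP ->.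
by rewrite dot_sumr; apply: eq_bigr => z _; rewrite dotZl dotZr mulrC.
Qed.

(** Pulled back by the inverse, [phi (p x)] as a combination of points of [B'] exhibits [p x] as a
    combination of points of [hull B]. As [x] is exposed, any of these with nonzero weight equals
    [p x]. *)
Lemma affine_vertex B B' phi x : convpos q B ->
  affine_bij (hull B) (hull B') phi -> x \in B ->
  exists2 y, y \in B' & p y = phi (p x).
Proof.
move=> cB Fphi xB; have [psi [[[sG _ _] aG] psiK _]] :=
    affine_bij_inv (hull_convex (p := p) (A := B)) Fphi.
have [[fG _ _] _] := Fphi.
have [g [gx gB]] := cB x xB.
have gB' z : z \in B -> ev q g z <= 0.
  by move=> zB; have [->|zx] := eqVneq z x; rewrite ?gx // ltW // gB.
have /hullP[w [w0 w1 e]] := fG _ (hull_gen p xB).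
have inB z : z \in B' -> hull B' (p z) by exact: hull_gen.
have [_ h] := affine_comb (hull_convex (p := p) (A := B')) aG w0 w1 inB.
rewrite -e psiK in h; last exact: hull_gen.
have gz z : z \in B' -> dot g (homog (psi (p z))) <= 0.
  by move=> zB; apply: (hull_sub_form gB'); apply: sG; exact: inB.
have ehom : homog (p x) = \sum_(z in B') w z *: homog (psi (p z)).
  by rewrite homog_comb w1 h.
have gsum : \sum_(z in B') - (w z * dot g (homog (psi (p z)))) == 0.
  rewrite sumrN oppr_eq0; apply/eqP; rewrite -[RHS]gx /ev ehom dot_sumr.
  by apply: eq_bigr => z _; rewrite dotZr.
have [z zB wz] : exists2 z, z \in B' & w z != 0.
  apply: contrapT => hz; have : \sum_(z in B') w z = 0.
    rewrite big1 // => z zB; apply/eqP; apply: contrapT => /negP wz; apply: hz.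
    by exists z.
  by rewrite w1 => /eqP; rewrite oner_eq0.
exists z => //.
have gz0 : dot g (homog (psi (p z))) = 0.
  move: gsum; rewrite psumr_eq0; last by move=> t tB; rewrite oppr_ge0 mulr_ge0_le0 ?gz.
  move=> /allP /(_ z (mem_index_enum _)) /implyP /(_ zB).
  by rewrite oppr_eq0 mulf_eq0 (negbTE wz) => /eqP.
have : hull [set x] (psi (p z)).
  have -> : [set x] = [set t in B | ev q g t == 0].
    apply/setP => t; rewrite !inE; apply/eqP/andP => [->|[tB /eqP tg]].
      by rewrite xB gx eqxx.
    by apply: contrapT => /eqP tx; have := gB t tB tx; rewrite tg ltxx.
  by apply: cone_tight => //; apply: sG; exact: inB.
move=> /hull1 ez.
have [[_ _ surj] _] := Fphi; have [t Ft et] := surj _ (inB z zB).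
by rewrite -ez -et psiK.
Qed.

Lemma affine_image B phi E : affine_on (hull B) phi -> E \subset B ->
  forall m : X -> X, (forall x, x \in E -> p (m x) = phi (p x)) -> {in E &, injective m} ->
  (phi @` (hull E) = hull (m @: E))%classic.
Proof.
move=> aF EB m hm minj.
have inE x : x \in E -> hull B (p x).
  by move=> xE; apply: hull_gen; exact: (fintype.subsetP EB).
have img (w : X -> R) : (forall x, 0 <= w x) -> \sum_(x in E) w x = 1 ->
    phi (\sum_(x in E) w x *: p x) = \sum_(x in E) w x *: p (m x).
  move=> w0 w1; have [_ ->] := affine_comb (hull_convex (p := p) (A := B)) aF w0 w1 inE.
  by apply: eq_bigr => x xE; rewrite hm.
apply/seteqP; split=> y.
  move=> [x /hullP[w [w0 w1 ->]] <-]; rewrite img //; apply/hullP.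
  pose w' y := if [pick x in E | m x == y] is Some x then w x else 0.
  have w'E x' : x' \in E -> w' (m x') = w x'.
    move=> xE; rewrite /w'; case: pickP => [t /andP[tE /eqP /minj -> //]|/(_ x')].
    by rewrite xE eqxx.
  exists w'; split.
  - by move=> z; rewrite /w'; case: pickP.
  - by rewrite big_imset //= -[RHS]w1; apply: eq_bigr => t tE; rewrite w'E.
  - by rewrite big_imset //=; apply: eq_bigr => t tE; rewrite w'E.
move=> /hullP[w [w0 w1 ->]]; rewrite !big_imset //= in w1 *.
exists (\sum_(x in E) w (m x) *: p x); last exact: img.
by apply/hullP; exists (w \o m); split=> //= x; exact: w0.
Qed.

End Vertices.
End Affine.

(** * Polyhedra as finite vertex sets in convex position *)

Section Polyhedra.
Local Open Scope ring_scope.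
Variables (R : realType).
Local Notation pt := 'rV[R]_3.

(** Moving an interior point by [t] along the linear part [b] of [u] changes the value by
    [t * dot b b]; so [b] vanishes, and then the constant term. *)
Lemma interior_spans (P : set pt) (u : 'rV[R]_4) : (interior P !=set0)%classic ->
  (forall y, P y -> dot u (homog y) = 0) -> u = 0.
Proof.
move=> [x0 Px0] uP; have [c [b e]] := row4E u; rewrite {u}e in uP *.
have [t t0 Pt] : exists2 t : R, t != 0 & P (x0 + t *: b).
  have cv : (x0 + t *: b @[t --> (0 : R)] --> x0 + (0 : R) *: b)%classic.
    by apply: cvgD; [exact: cvg_cst|apply: cvgZr_tmp; exact: cvg_id].
  rewrite scale0r addr0 in cv.
  have /nbhs_ballP[r /= r0 hr] := cv _ Px0.
  exists (r / 2); first by rewrite gt_eqF // divr_gt0.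
  apply: hr; rewrite /ball /= sub0r normrN gtr0_norm ?divr_gt0 //.
  by rewrite ltr_pdivrMr // ltr_pMr // ltr1n.
have h0 := uP _ (interior_subset Px0); have h1 := uP _ Pt.
rewrite !dot_homog dotDr dotZr in h0 h1.
have /eqP : t * dot b b = 0 by rewrite -[RHS]h1 addrA h0 add0r.
rewrite mulf_eq0 (negbTE t0) /= dot_eq0 => /eqP b0.
rewrite b0 dot0l addr0 in h0; rewrite h0 b0 raddf0; exact: (@row_mx0 _ 1 1 3).
Qed.

(** Take a generating subset of least size. By Farkas each generator is either a combination of the
    others, and could be dropped, or strictly separated from them; subtracting the constant value at
    the point makes the separating form expose it. *)
Lemma polyhedron_vertices (P : set pt) : polyhedron P ->
  exists (n : nat) (v : 'I_n -> pt), [/\ P = conv_hull v,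
    convpos (fun i => homog (v i)) [set: 'I_n] &
    spans (fun i => homog (v i)) [set: 'I_n]].
Proof.
move=> [[k [v0 eP]] Pint].
have hullT n (v : 'I_n -> pt) : conv_hull v = hull v [set: 'I_n].
  by apply: (@conv_hull_hull R _ v [set: 'I_n] n id) => // x; split=> // _; exists x.
pose good S := `[< hull v0 S = P >].
have gT : good [set: 'I_k] by apply/asboolP; rewrite eP hullT.
case: (@arg_minnP _ [set: 'I_k] good (fun S => #|S|) gT) => S /asboolP hS Smin.
pose v (i : 'I_#|S|) := v0 (enum_val i).
have hv : conv_hull v = P.
  rewrite -hS; apply: (@conv_hull_hull R _ v0 S #|S| enum_val); first exact: enum_val_inj.
  move=> x; split=> [xS|[i <-]]; last exact: enum_valP.
  by exists (enum_rank_in xS x); rewrite enum_rankK_in.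
exists #|S|, v; split=> //; last first.
  move=> u hu; apply: (interior_spans Pint) => y; rewrite -hv hullT.
  exact: ann_hull.
move=> i _; pose x := enum_val i; have xS : x \in S := enum_valP i.
case: (farkas (S :\ x) (fun j => homog (v0 j)) (homog (v0 x))) => [[w [w0 ew]]|[u [uS ux]]].
  have : good (S :\ x); last first.
    by move=> /Smin h; exfalso; move: h (cardsD1 x S); rewrite xS; lia.
  apply/asboolP; rewrite -hS; apply/seteqP; split; first exact: (hullS (finset.subsetDl _ _)).
  move=> y [w' [w'0 ey]]; rewrite (big_setD1 x) //= ew scaler_sumr -big_split /= in ey.
  exists (fun j => w' x * w j + w' j); split; first by move=> j; rewrite addr_ge0 ?mulr_ge0.
  by rewrite ey; apply: eq_bigr => j _; rewrite scalerDl scalerA.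
exists (u - dot u (homog (v0 x)) *: homog1 R); split.
  by rewrite !evE ev_homog1 mulr1 subrr.
move=> j _ ji; rewrite !evE ev_homog1 mulr1 subr_lt0.
apply: le_lt_trans ux; apply: uS; rewrite !inE enum_valP andbT.
by rewrite (inj_eq enum_val_inj).
Qed.

(** The vertex sets are placed in a disjoint sum, so that different polyhedra share no element of
    [X] even where they overlap in the model space. *)
Lemma polyhedra_vertices (N : nat) (P : 'I_N -> set pt) : (forall i, polyhedron (P i)) ->
  exists (X : finType) (p : X -> pt) (A : 'I_N -> {set X}),
    [/\ forall i, P i = hull p (A i),
      forall i, convpos (fun x => homog (p x)) (A i),
      forall i, spans (fun x => homog (p x)) (A i) &
      forall i j x, x \in A i -> x \in A j -> i = j].
Proof.
move=> hP.
have /choice[nv hnv] : forall i, exists nv : {n : nat & 'I_n ->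
    pt}, [/\ P i = conv_hull (projT2 nv),
    convpos (fun i => homog (projT2 nv i)) [set: 'I_(projT1 nv)] &
    spans (fun i => homog (projT2 nv i)) [set: 'I_(projT1 nv)]].
  by move=> i; have [n [v h]] := polyhedron_vertices (hP i); exists (existT _ n v).
pose n i := projT1 (nv i); pose v i : 'I_(n i) -> pt := projT2 (nv i).
pose X : finType := {i : 'I_N & 'I_(n i)}.
pose p (x : X) := v (tag x) (tagged x).
pose A i : {set X} := [set x : X | tag x == i].
pose J i (j : 'I_(n i)) : X := Tagged (fun i => 'I_(n i)) j.
have AJ i x : x \in A i <-> exists j, J i j = x.
  rewrite inE; split=> [/eqP|[j <-]//]; case: x => i' j /= e.
  by move: j; rewrite e => j; exists j.
exists X, p, A; split.
- move=> i; have [-> _ _] := hnv i.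
  have Jinj : injective (J i).
    by move=> j j' /eqP; rewrite -tag_eqE /tag_eq /= eqxx /= tagged_asE => /eqP.
  exact: (conv_hull_hull p Jinj (AJ i)).
- move=> i x /AJ[j <-]; have [_ c _] := hnv i.
  have [g [gx gA]] := c j (finset.in_setT _); exists g; split=> //.
  move=> y /AJ[j' <-] jj'; apply: (gA j'); first exact: finset.in_setT.
  by apply/eqP => ej; rewrite ej eqxx in jj'.
- move=> i u hu; have [_ _ s] := hnv i; apply: s => j _.
  by apply: (hu (J i j)); apply/AJ; exists j.
- by move=> i j x; rewrite !inE => /eqP -> /eqP.
Qed.

End Polyhedra.

(** * The system of a face pairing *)

Section Pairing.
Local Open Scope ring_scope.
Variables (R : realType) (N : nat) (P : 'I_N -> set 'rV[R]_3).
Variables (K : Type) (Fm Fp : K -> 'I_N * set 'rV[R]_3).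
Variables (phi psi : K -> 'rV[R]_3 -> 'rV[R]_3).
Hypothesis hpair : face_pairing P Fm Fp phi.
Variables (X : finType) (p : X -> 'rV[R]_3) (A : 'I_N -> {set X}).
Local Notation q := (fun x => homog (p x)).
Local Notation facet := (facet q).
Local Notation hull := (hull p).
Local Notation flag := (flag X).
Implicit Types (B T : {set X}) (s : flag).
Hypothesis PA : forall i, P i = hull (A i).
Hypothesis cA : forall i, convpos q (A i).
Hypothesis sA : forall i, spans q (A i).
Hypothesis dA : forall i j x, x \in A i -> x \in A j -> i = j.
Hypothesis psi_bij : forall a, affine_bij (Fp a).2 (Fm a).2 (psi a).
Hypothesis psiK : forall a x, (Fm a).2 x -> psi a (phi a x) = x.
Hypothesis phiK : forall a y, (Fp a).2 y -> phi a (psi a y) = y.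

Lemma A_inj : injective A.
Proof.
move=> i j eA; have [x xA] : exists x, x \in A i.
  by apply/card_gt0P; rewrite (leq_trans _ (spans_card4 (@sA i))).
by apply: (dA xA); rewrite -eA.
Qed.

Lemma facet_2face i B : facet (A i) B -> is_2face P (i, hull B).
Proof.
move=> [f F]; have [fA eB f0 Bf] := F; split=> /=.
  rewrite PA; apply: (is_face_of_form (g := f)); last exact: hull_facet fA eB.
  by move=> y; exact: hull_sub_form.
have [b [bB ib hb]] := base_ex q B.
have bf : ann q b f by move=> x /(fintype.subsetP bB); exact: (facet_ann F).
apply: (aff_dim_hull bB ib _ f0 (facet_ann F)).
by case: (indep_line_card ib f0 bf (fun u hu => Bf u (hb u hu))).
Qed.

Lemma facet_of_2face F : is_2face P F -> exists2 B, facet (A F.1) B & F.2 = hull B.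
Proof.
case: F => i F [/= fF dimF]; rewrite PA in fF.
have [g [gP hF]] := form_of_is_face fF.
have gA x : x \in A i -> ev q g x <= 0 by move=> xA; apply: gP; exact: hull_gen.
pose B := [set x in A i | ev q g x == 0].
have eF : F = hull B.
  apply/seteqP; split=> y.
    by move=> /hF h; apply/(hull_facet gA (erefl B)).
  by move=> /(hull_facet gA (erefl B)) h; apply/hF.
have Bg : ann q B g by move=> x; rewrite inE => /andP[_ /eqP].
exists B => //; exists g; rewrite eF in dimF.
have g0 : g != 0.
  (* With [g = 0] the face would be the whole polyhedron, which has four affinely independent
     vertices. *)
  apply/eqP => g00; have [b [bA ib hb]] := base_ex q (A i).
  have b4 := indep_spans_card ib (fun u hu => sA (hb u hu)).
  have [v [_ hv iv]] := indep_enum ib b4.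
  case: dimF => _; apply; exists (fun k => p (v k)); split=> // k.
  apply: hull_gen; rewrite inE g00 ev0 eqxx andbT.
  by apply: (fintype.subsetP bA); apply/hv; exists k.
by split=> // u; exact: (aff_dim_ann dimF g0 Bg).
Qed.

Lemma facet_sub_vertices i B : facet (A i) B -> B \subset A i.
Proof. by move=> [f]; exact: facet_sub. Qed.

Lemma facet_hull_inj i B B' : facet (A i) B -> facet (A i) B' ->
  hull B = hull B' -> B = B'.
Proof.
move=> /facet_sub_vertices BA /facet_sub_vertices BA' e.
apply/setP => x; apply/idP/idP => xB.
  by apply: (hull_convpos (cA (i := i)) BA' (fintype.subsetP BA _ xB)); rewrite -e;
      exact: hull_gen.
by apply: (hull_convpos (cA (i := i)) BA (fintype.subsetP BA' _ xB)); rewrite e;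
    exact: hull_gen.
Qed.

(** The pairing made symmetric: each pair is read in both directions, through [phi] or through its
    inverse [psi]. *)
Definition linked a (f : 'rV[R]_3 -> 'rV[R]_3) (F G : 'I_N * set 'rV[R]_3) :=
  [/\ F = Fm a, G = Fp a & f = phi a] \/ [/\ F = Fp a, G = Fm a & f = psi a].

Lemma linked_bij a f F G : linked a f F G -> affine_bij F.2 G.2 f.
Proof.
case=> -[-> -> ->]; last exact: psi_bij.
by have [h1 h2 _ _] := pairing_homeo hpair a; split.
Qed.

Lemma linked_sym a f F G : linked a f F G ->
  exists2 g, linked a g G F & forall x, F.2 x -> g (f x) = x.
Proof.
case=> -[-> -> ->]; [exists (psi a); first by right | exists (phi a); first by left].
- exact: psiK.
- exact: phiK.
Qed.

Lemma linked_neq a f F G : linked a f F G -> F <> G.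
Proof.
by case=> -[-> -> _] e; apply: (pairing_distinct hpair (a := a)).
Qed.

Lemma linked_2face a f F G : linked a f F G -> is_2face P F /\ is_2face P G.
Proof.
have h1 := pairing_neg hpair a; have h2 := pairing_pos hpair a.
by case=> -[-> -> _].
Qed.

Lemma linked_ex F : is_2face P F -> exists a f G, linked a f F G.
Proof.
move=> /(pairing_partition hpair)[a [[e|e] _]].
  by exists a, (phi a), (Fp a); left.
by exists a, (psi a), (Fm a); right.
Qed.

(** The partition property determines the pair containing [F], and the distinctness of its two faces
    determines the direction. *)
Lemma linked_uniq a a' f f' F G G' : linked a f F G -> linked a' f' F G' ->
  G = G' /\ f = f'.
Proof.
move=> L L'; have [F2 _] := linked_2face L.
have [b [_ hb]] := pairing_partition hpair F2.
have ea : a = a'.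
  rewrite -(hb a) ?(hb a') //.
    by case: L' => -[-> _ _]; [left|right].
  by case: L => -[-> _ _]; [left|right].
rewrite -{a'}ea in L'; have dist := pairing_distinct hpair (a := a).
case: L => -[eF -> ->]; case: L' => -[eF' -> ->] //; case: dist.
  by rewrite -eF -eF'.
by rewrite -eF -eF'.
Qed.

Definition vertex_cells : {set {set X}} := [set A i | i in 'I_N].

Definition joined s (s' : flag) (m : X -> X) := exists i j a f,
  [/\ s.1 = A i, s'.1 = A j, facet (A j) s'.2,
    linked a f (i, hull s.2) (j, hull s'.2) &
    forall x, x \in s.2 -> m x \in s'.2 /\ p (m x) = f (p x)].

Lemma vertex_flags s : s \in flags q vertex_cells <->
  exists2 i, s.1 = A i & facet (A i) s.2.
Proof.
rewrite flagsP; split=> [[/imsetP[i _ e] F]|[i e F]]; first by exists i; rewrite -?e.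
by split; rewrite e //; exact: imset_f.
Qed.

Lemma joined_ex s : s \in flags q vertex_cells ->
  exists sm : flag * (X -> X), joined s sm.1 sm.2.
Proof.
move=> /vertex_flags[i es F].
have [a [f [[j G] L]]] := linked_ex (facet_2face F).
have [_ /facet_of_2face[B' F' /= eG]] := linked_2face L.
rewrite /= in F'; rewrite {G}eG in L *.
have cB := convposS (facet_sub_vertices F) (cA (i := i)).
have /choice[m hm] : forall x, exists y, x \in s.2 -> y \in B' /\ p y = f (p x).
  move=> x; case: (boolP (x \in s.2)) => xs; last by exists x.
  by have [y yB e] := affine_vertex cB (linked_bij L) xs; exists y.
by exists ((A j, B'), m), i, j, a, f; split.
Qed.

Lemma joined_back s s' s'' m m' : s \in flags q vertex_cells ->
  joined s s' m -> joined s' s'' m' ->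
  s'' = s /\ forall x, x \in s.2 -> m' (m x) = x.
Proof.
move=> /vertex_flags[i0 es0 F0] [i [j [a [f [es es' F L hm]]]]].
move=> [j2 [k [a' [f' [es2 es'' F2 L' hm']]]]].
have ej : j2 = j by apply: A_inj; rewrite -es2.
have ei : i0 = i by apply: A_inj; rewrite -es0.
rewrite {j2 es2}ej in L'; rewrite {i0 es0}ei in F0.
have [g Lg gK] := linked_sym L.
have [[ek eh] ef] := linked_uniq L' Lg.
rewrite ek in es'' F2.
have eB : s''.2 = s.2 by apply: facet_hull_inj F2 F0 eh.
split; first by rewrite [s'']surjective_pairing [s]surjective_pairing es es'' eB.
move=> x xs; have [mx e] := hm x xs; have [mx' e'] := hm' _ mx.
have sub := fintype.subsetP (facet_sub_vertices F0).
apply: (convpos_inj (cA (i := i))); [by apply: sub; rewrite -eB|exact: sub|].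
by rewrite e' e ef gK //; exact: hull_gen.
Qed.

Lemma joined_glued : exists tau pi, glued q vertex_cells tau pi /\
  forall s, s \in flags q vertex_cells -> joined s (tau s) (pi s).
Proof.
have /choice[sm hsm] : forall s, exists sm : flag * (X -> X),
    s \in flags q vertex_cells -> joined s sm.1 sm.2.
  move=> s; case: (boolP (s \in flags q vertex_cells)) => sF; last by exists (s, id).
  by have [sm h] := joined_ex sF; exists sm.
exists (fun s => (sm s).1), (fun s => (sm s).2); split=> //.
have tF s : s \in flags q vertex_cells -> (sm s).1 \in flags q vertex_cells.
  move=> /hsm[i [j [a [f [_ e F _ _]]]]]; apply/vertex_flags; by exists j.
have back s : s \in flags q vertex_cells -> (sm (sm s).1).1 = s /\
    forall x, x \in s.2 -> (sm (sm s).1).2 ((sm s).2 x) = x.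
  by move=> sF; exact: joined_back (hsm s sF) (hsm _ (tF s sF)).
split.
- by move=> _ /imsetP[i _ ->]; exact: sA.
- by move=> _ /imsetP[i _ ->]; exact: cA.
- move=> _ _ /imsetP[i _ ->] /imsetP[j _ ->] /spans_card4 c4.
  have [x] : exists x, x \in A i :&: A j by apply/card_gt0P; rewrite (leq_trans _ c4).
  by rewrite inE => /andP[xi xj]; rewrite (dA xi xj).
- exact: tF.
- by move=> s /back[].
- move=> s sF; have [i [j [a [f [es es' _ L _]]]]] := hsm s sF.
  apply/eqP => e; apply: (linked_neq L); rewrite e; congr (_, _).
  by apply: A_inj; rewrite -es -es' e.
- by move=> s x sF xs; have [i [j [a [f [_ _ _ _ /(_ x xs)[]]]]]] := hsm s sF.
- by move=> s x /back[_ h]; exact: h.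
- move=> s u sF; have [i [j [a [f [_ _ _ L hm]]]]] := hsm s sF.
  have [_ aF] := linked_bij L; have [u' hu'] := affine_pullback u aF.
  by exists u' => x xs; rewrite hu' //; have [_ <-] := hm x xs.
Qed.

(** * From the combinatorial solution to the geometric subdivisions *)

Section Solution.
Variables (tau : flag -> flag) (pi : flag -> X -> X) (DD : {set X} -> {set {set X}}).
Hypothesis gl : glued q vertex_cells tau pi.
Hypothesis hj : forall s, s \in flags q vertex_cells -> joined s (tau s) (pi s).
Hypothesis sol : solved q vertex_cells tau pi DD.

Definition tets i : set (set 'rV[R]_3) := (hull @` [set T | T \in DD (A i)])%classic.

Lemma vertex_cell i : A i \in vertex_cells.
Proof. exact: imset_f. Qed.

Lemma tets_subdivision i : tet_subdivision (P i) (tets i).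
Proof.
have [Da Db Dc Dd] := sol; have iC := vertex_cell i.
have Ti T : T \in DD (A i) -> indep q T.
  by move=> hT; have [_ sT T4] := Da _ T iC hT; exact: spans4_indep.
have face T T' : T \in DD (A i) -> T' \in DD (A i) ->
    is_face (hull T) (hull T `&` hull T')%classic.
  (* The form that is 0 at the common vertices and -1 at the other vertices of [T] cuts out the
     common face. *)
  move=> hT hT'; have [g hg] := Ti T hT (fun x => if x \in T' then 0 else -1).
  have gT x : x \in T -> ev q g x <= 0.
    by move=> xT; rewrite hg //; case: ifP => // _; rewrite oppr_le0.
  have eT : T :&: T' = [set x in T | ev q g x == 0].
    apply/setP => x; rewrite !inE; case: (boolP (x \in T)) => //= xT.
    by rewrite hg //; case: ifP; rewrite ?eqxx // oppr_eq0 oner_eq0.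
  apply: (is_face_of_form (g := g)); first by move=> y; exact: hull_sub_form.
  move=> y; rewrite -(hull_facet gT eT); split=> [[Ty Ty']|h].
    exact: (Dc _ T T' _ iC hT hT').
  by split; apply: hullS h; [exact: finset.subsetIl|exact: finset.subsetIr].
split.
- by apply: finite_image; exact: finite_finset.
- move=> _ [T hT <-]; have [TA sT T4] := Da _ T iC hT.
  have [v [vinj hv iv]] := indep_enum (Ti T hT) T4.
  exists (fun k => p (v k)); split=> //; last by rewrite (conv_hull_hull p vinj hv).
  move=> k; rewrite PA; apply: vertex_convpos (cA (i := i)) _.
  by apply: (fintype.subsetP TA); apply/hv; exists k.
- apply/seteqP; split=> y; rewrite PA.
    move=> [_ [T hT <-] Ty]; have [TA _ _] := Da _ T iC hT; exact: hullS TA _ Ty.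
  move=> Ay; have [T hT Ty] := Db _ _ iC Ay.
  by exists (hull T) => //; exists T.
- move=> _ _ [T hT <-] [T' hT' <-]; split; first exact: face.
  by rewrite setIC; exact: face.
Qed.

Lemma hull_facet_cap i B T : facet (A i) B -> T \subset A i ->
  (hull T `&` hull B)%classic = hull (T :&: B).
Proof.
move=> [f [fA eB _ _]] TA; apply/seteqP; split=> y.
  by move=> [Ty By]; exact: cone_face fA eB TA Ty By.
by move=> h; split; apply: hullS h; [exact: finset.subsetIl|exact: finset.subsetIr].
Qed.

(** A triangle has at least three vertices, and their images lie among the vertices of [T'] on the
    opposite facet. These are independent and annihilated by a nonzero form, hence at most three, so
    the two sets coincide. *)
Lemma induced_image s i j a f G : s \in flags q vertex_cells ->
  s.1 = A i -> (tau s).1 = A j -> linked a f (i, hull s.2) (j, hull (tau s).2) ->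
  induced_triangulation (tets i) (hull s.2) G ->
  induced_triangulation (tets j) (hull (tau s).2) (f @` G)%classic.
Proof.
move=> sF es es' L [dimG [_ [T hT <-] eG]]; have [Da Db Dc Dd] := sol.
have [i' [j' [a' [f' [es2 es2' F' L' hm]]]]] := hj sF.
have ei : i' = i by apply: A_inj; rewrite -es2.
have ej : j' = j by apply: A_inj; rewrite -es2'.
rewrite ei ej in L'; rewrite ej in F'.
have [_ ef] := linked_uniq L' L; rewrite ef in hm.
have F : facet (A i) s.2.
  by have /vertex_flags[k e] := sF; rewrite -e es.
have [TA sT T4] := Da _ T (vertex_cell i) hT.
rewrite (hull_facet_cap F TA) in eG; rewrite {G}eG in dimG *.
set E := T :&: s.2 in dimG *.
have [T' hT' sub] : exists2 T', T' \in DD (A j) & pi s @: E \subset T'.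
  rewrite -es in hT; have [T' hT' h] := Dd s T sF hT; rewrite es' in hT'.
  exists T' => //; apply/fintype.subsetP => _ /imsetP[x + ->].
  by rewrite inE => /andP[xT xs]; exact: h.
have [TA' sT' T4'] := Da _ T' (vertex_cell j) hT'.
have minj : {in E &, injective (pi s)}.
  move=> x y; rewrite !inE => /andP[_ xs] /andP[_ ys] /(congr1 (pi (tau s))).
  by rewrite !(glued_mapK gl sF).
have subE : pi s @: E \subset T' :&: (tau s).2.
  rewrite finset.subsetI sub; apply/fintype.subsetP => _ /imsetP[x + ->].
  by rewrite inE => /andP[_ xs]; have [] := hm x xs.
have iE : indep q (T' :&: (tau s).2).
  by apply: indepS (spans4_indep sT' T4'); exact: finset.subsetIl.
have [f0 FF] := F'; have [_ _ f0n _] := FF.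
have annE : ann q (T' :&: (tau s).2) f0.
  by move=> x; rewrite inE => /andP[_]; exact: (facet_ann FF).
have E3 : (#|T' :&: (tau s).2| <= 3)%N.
  have := indep_card_le iE; rewrite leq_eqVlt => /orP[/eqP c4|//].
  by have := indep4_spans iE c4 annE => f00; rewrite f00 eqxx in f0n.
have eE : pi s @: E = T' :&: (tau s).2.
  apply/eqP; rewrite finset.eqEcard subE card_in_imset //.
  exact: leq_trans E3 (aff_dim_card dimG).
have [_ aF] := linked_bij L.
have img : (f @` hull E)%classic = hull (T' :&: (tau s).2).
  rewrite -eE; apply: (affine_image aF (finset.subsetIr _ _)) => // x.
  by rewrite inE => /andP[_ xs]; have [] := hm x xs.
split; last first.
  exists (hull T'); first by exists T'.
  by rewrite img (hull_facet_cap F' TA').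
rewrite img; apply: (aff_dim_hull (fintype.subxx _) iE _ f0n annE).
apply/eqP; rewrite eqn_leq E3 -eE card_in_imset //; exact: aff_dim_card dimG.
Qed.

(** One inclusion is [induced_image] for the flag of [Fm a]; the other is the same statement for the
    partner flag, whose map is [psi a]. *)
Lemma induced_pairing a :
  [set phi a @` G | G in induced_triangulation (tets (Fm a).1) (Fm a).2]%classic =
  induced_triangulation (tets (Fp a).1) (Fp a).2.
Proof.
have [B F eF] := facet_of_2face (pairing_neg hpair a).
set i := (Fm a).1 in F *; pose s : flag := (A i, B).
have sF : s \in flags q vertex_cells by apply/vertex_flags; exists i.
have tF := glued_flag gl sF.
have eFm : Fm a = (i, hull B) by rewrite [LHS]surjective_pairing eF.
have [i' [j [a' [f [es es' F' L hm]]]]] := hj sF.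
have ei : i' = i by apply: A_inj; rewrite -es.
rewrite ei /= in L.
have La : linked a (phi a) (i, hull B) (Fp a) by left.
have [eFp ef] := linked_uniq La L; rewrite -ef in L.
have [k [l [b [g [et et' _ L' _]]]]] := hj tF; rewrite (glued_inv gl sF) in et' L'.
have ek : k = j by apply: A_inj; rewrite -et.
have el : l = i by apply: A_inj; rewrite -et'.
rewrite ek el in L'.
have Lb : linked a (psi a) (j, hull (tau s).2) (Fm a) by right.
have [_ eg] := linked_uniq L' Lb; rewrite eg in L'.
have psiG G : (G `<=` hull (tau s).2)%classic -> (phi a @` (psi a @` G))%classic = G.
  move=> GF; apply/seteqP; split=> y; last first.
    move=> Gy; exists (psi a y); first by exists y.
    by apply: phiK; rewrite eFp; exact: GF.
  by move=> [_ [z Gz <-] <-]; rewrite phiK // eFp; exact: GF.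
rewrite eF eFp /=; apply/seteqP; split=> G.
  by move=> [G' hG' <-]; exact: (induced_image sF _ es' L hG').
move=> hG; exists (psi a @` G)%classic; last first.
  by apply: psiG; case: hG => _ [T _ ->] y [].
have := induced_image tF es' _ _ hG; rewrite (glued_inv gl sF); apply=> //.
exact: L'.
Qed.

End Solution.
End Pairing.

Local Open Scope classical_set_scope.

Theorem theorem1p2 (R : realType) (N : nat) (P : 'I_N -> set 'rV[R]_3)
    (K : Type) (Fm Fp : K -> 'I_N * set 'rV[R]_3)
    (phi : K -> 'rV[R]_3 -> 'rV[R]_3)
    (hP : forall i, polyhedron (P i))
    (hpair : face_pairing P Fm Fp phi) :
  exists D : 'I_N -> set (set 'rV[R]_3),
    (forall i, tet_subdivision (P i) (D i)) /\
    (forall a : K,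
       [set phi a @` G | G in induced_triangulation (D (Fm a).1) (Fm a).2] =
       induced_triangulation (D (Fp a).1) (Fp a).2).
Proof.
have [X [p [A [PA cA sA dA]]]] := polyhedra_vertices hP.
have /choice[psi hpsi] : forall a, exists psi, [/\ affine_bij (Fp a).2 (Fm a).2 psi,
    forall x, (Fm a).2 x -> psi (phi a x) = x & forall y, (Fp a).2 y -> phi a (psi y) = y].
  move=> a; have [h1 h2 _ _] := pairing_homeo hpair a.
  have [B _ eB] := facet_of_2face PA sA (pairing_neg hpair a).
  apply: affine_bij_inv; last by split.
  by rewrite eB; exact: hull_convex.
have psi_bij a : affine_bij (Fp a).2 (Fm a).2 (psi a) by case: (hpsi a).
have psiK a x : (Fm a).2 x -> psi a (phi a x) = x by case: (hpsi a) => _ h _; exact: h.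
have phiK a y : (Fp a).2 y -> phi a (psi a y) = y by case: (hpsi a) => _ _; exact.
have [tau [pi [gl hj]]] := joined_glued hpair PA cA sA dA psi_bij psiK phiK.
have [DD sol] := glued_solved (@ev_homog1 R X p) gl.
exists (tets p A DD); split=> [i|a].
  exact (tets_subdivision PA cA sol i).
exact (induced_pairing hpair PA sA dA psi_bij phiK gl hj sol a).
Qed.
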